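(* Let $n\ge2$ and $1\le k\le n-1$. Let $T(n,k)$ be the number of facets of $\mathcal D^\ast_{n,k}$ (the number of type-B generalized $k$-triangulations of the $2n$-gon). Then $T(n,k)$ satisfies the following bounds. Lower bound: $$T(n,k)\ge\det\left[\binom{2n-i-j}{n-i}\right]_{i,j=1,\dots,k}=\det\left[\binom{2(n-k)}{n-k+i-j}\right]_{i,j=1,\dots,k}=\prod_{h=1}^{n-k}\prod_{i=1}^{k}\prod_{j=1}^{n-k}\frac{h+i+j-1}{h+i+j-2}.$$ Upper bound, given by the number of facets of the $k(n-k)$-dimensional cyclic polytope with $n(n-k)$ vertices: $$T(n,k)\le\begin{cases}2\binom{(n-k)^2+\frac{k(n-k)-1}{2}}{(n-k)^2}&\text{if }k(n-k)\text{ is odd},\\[2mm] 2\binom{(n-k)^2+\frac{k(n-k)}{2}}{(n-k)^2}+\binom{(n-k)^2-1+\frac{k(n-k)}{2}}{(n-k)^2-1}&\text{if }k(n-k)\text{ is even}.\end{cases}$$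
   Context: Label the vertices of a convex regular $2n$-gon by $1,\dots,2n$ in cyclic order. A segment is a $2$-subset $\{a,b\}\subseteq[2n]$. Two segments cross if their four endpoints are distinct and interleave in the cyclic order. A $(k+1)$-crossing is a set of $k+1$ pairwise crossing segments. The cyclic length of $\{a,b\}$ is $\min(|a-b|,2n-|a-b|)$, and $\Omega_{2n,k}$ is the set of segments of cyclic length $>k$. The $180^\circ$-rotation sends $\{a,b\}$ to $\{a+n,b+n\}$ (indices mod $2n$). $\mathcal F_{n,k}$ is the set of rotation orbits of segments in $\Omega_{2n,k}$. $\mathcal D^\ast_{n,k}$ is the simplicial complex on $\mathcal F_{n,k}$ whose faces are the sets of orbits whose union contains no $(k+1)$-crossing.
   Formalization: For k(n-k) even the displayed upper bound is not the number of facets of the cyclic polytope (n=3, k=1: 14 versus 6); there it is proved that T(n,k) ≤ that facet number ≤ the displayed value, with equality of the last two stated only for k(n-k) odd. *)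

(* Defs.v *)
From mathcomp Require Import all_boot all_order all_algebra.
From mathcomp Require Import boolp.

Set Implicit Arguments.
Unset Strict Implicit.
Unset Printing Implicit Defensive.

Import Order.TTheory GRing.Theory Num.Theory.

(* The vertices 1, ..., 2n of the polygon are the elements 0, ..., 2n - 1 of
   'I_(2 * n); a segment is a 2-subset. *)
Section Polygon.
Variable n : nat.
Local Notation V := 'I_(2 * n).
Implicit Types (a b : V) (s t : {set V}).

Definition segment s : bool := #|s| == 2.

Definition interleave s t : bool :=
  [exists a : V, exists b : V, exists c : V, exists d : V,
    [&& a < b, b < c, c < d, s == [set a; c] & t == [set b; d]]].

Definition cross s t : bool := interleave s t || interleave t s.

Definition is_crossing (m : nat) (C : {set {set V}}) : bool :=
  [&& #|C| == m,
      [forall s in C, segment s] &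
      [forall s in C, forall t in C, (s != t) ==> cross s t]].

Definition cyclic_length a b : nat :=
  let l := maxn a b - minn a b in minn l (2 * n - l).

Definition Omega (k : nat) : {set {set V}} :=
  [set s | segment s &&
    [exists a : V, exists b : V, (s == [set a; b]) && (k < cyclic_length a b)]].

(* ordS is the cyclic successor, so this is a |-> a + n mod 2n. *)
Definition half_turn : V -> V := iter n (@ordS (2 * n)).

Definition rotation_orbit s : {set {set V}} :=
  [set s; half_turn @: s].

Definition orbits (k : nat) : {set {set {set V}}} :=
  [set rotation_orbit s | s in Omega k].

Definition Dstar_face (k : nat) (A : {set {set {set V}}}) : bool :=
  (A \subset orbits k) &&
  ~~ [exists C : {set {set V}},
        is_crossing k.+1 C && (C \subset cover A)].

Definition Dstar_facets (k : nat) : {set {set {set {set V}}}} :=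
  [set A | maxset (Dstar_face k) A].

End Polygon.

Definition T (n k : nat) : nat := #|Dstar_facets n k|.

(* Binomial coefficient with an integer lower index, 0 when it is negative. *)
Definition binz (m : nat) (z : int) : nat :=
  if z is Posz l then 'C(m, l) else 0.

Section CyclicPolytope.
Local Open Scope ring_scope.
Variables (R : realFieldType) (N d : nat).

(* A face of the convex hull of p_0, ..., p_(N-1) is the convex hull of the p_i
   it contains, hence is determined by their set of indices S: the hyperplane
   {v | v *m c = b} supports the hull and meets it in the face of index set S. *)
Definition hull_face (p : 'I_N -> 'rV[R]_d) (S : {set 'I_N}) : Prop :=
  exists (c : 'cV[R]_d) (b : R),
    forall i, (p i *m c) 0 0 <= b ?= iff (i \in S).

Definition hull_facets (p : 'I_N -> 'rV[R]_d) : {set {set 'I_N}} :=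
  [set S | maxset (fun S' => (S' != setT) && `[< hull_face p S' >]) S].

Definition moment_curve (x : R) : 'rV[R]_d := \row_j x ^+ j.+1.

(* Number of facets of the cyclic polytope with vertices at the parameters
   t_0 < ... < t_(N-1) of the moment curve of R^d. *)
Definition cyclic_polytope_facets (t : 'I_N -> R) : nat :=
  #|hull_facets (fun i => moment_curve (t i))|.

End CyclicPolytope.

(* Both halvings are exact. For even d the value exceeds the number of facets of
   the d-dimensional cyclic polytope with D + d vertices, which is
   2 * 'C(D + d/2 - 1, D) + 'C(D + d/2 - 1, D - 1). *)
Definition upper_bound (n k : nat) : nat :=
  let D := (n - k) ^ 2 in
  let d := k * (n - k) in
  if odd d then 2 * 'C(D + (d - 1) %/ 2, D)
  else 2 * 'C(D + d %/ 2, D) + 'C(D - 1 + d %/ 2, D - 1).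

(* Main.v *)
(* Write m = n - k. An orbit of segments is a cell of the strip 'I_n x 'I_m, and a
   set of cells is a face of D* iff the remaining letters of the word c^n in the
   hyperoctahedral group B_m (c a Coxeter element) have Demazure product w0: the
   bubble sort they perform is governed by longest chains of crossing segments.
   So D* is a subword complex, its facets are complements of reduced words of w0,
   and its faces are partitioned by the intervals [R(F), F], R(F) the set of
   letters of F which are ascents. Rotating the word (w0 is central) gives
   (i+1) h_(i+1) + (d-i) h_i <= N h_i as in McMullen's proof of the upper bound
   theorem, whence T <= number of facets of the cyclic polytope, which Gale's
   evenness condition counts.

   For the lower bound let X = Y Z be an n x n matrix of rank at most k. For the
   weights l (4n - l), l the length of a cell, a (k+1)-crossing is the unique
   heaviest term of a vanishing minor, so the monomials supported on faces (short
   cells being free) span all monomials in the entries of X. Products of minors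
   indexed by pairs of Gelfand-Tsetlin patterns with equal top row have distinct
   leading exponents, hence there are at least as many face monomials of each
   degree. Summing over degrees with a weight t < 1, the face monomials contribute
   at most T / (1 - t)^(n^2 - m^2), while the pairs of patterns give, by the
   determinantal count of patterns and Andreief's identity, the determinant of
   the sums over z of t^z C(z, n-i) C(z, n-j). Letting t tend to 1 yields
   det [C(2n-i-j, n-i)] <= T. *)
Require Import Defs.
From mathcomp Require Import all_boot all_order all_fingroup all_algebra.
From mathcomp Require Import boolp.
From mathcomp Require Import zify ring lra.

Set Implicit Arguments.
Unset Strict Implicit.
Unset Printing Implicit Defensive.

Import Order.TTheory GRing.Theory Num.Theory.

(** * Hankel determinants of binomial coefficients *)

Local Open Scope ring_scope.

(** The intervals [[R F, F]] give an h-vector that face numbers determine, so it is the same for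
    every such partition. One complex can thus be read through the reversed word, which makes h
    symmetric, and through the rotation that puts a chosen vertex last, where it lies in no [R F].
    Demazure products are controlled by the rank functions [prof]: one step acts on them by a
    monotone max-plus rule. Monotonicity yields the subword property, and the same rule is the
    recurrence for longest chains, which is how crossings enter.

    The lower bound is a chain of inequalities: the face monomials span, the products of minors are
    independent. Exponents in the entries of Y and Z are packed as base-B digits into the degree of
    a polynomial in one indeterminate, so a leading term is a degree. The limit is elementary: t = Q
    / (Q + 1), finite sums, error O(1 / Q). The orders of the pole at t = 1 agree: scaling rows and
    columns of the Hankel matrix costs a sum of k odd numbers, n^2 - m^2, which is the number of
    free cells of a facet. *)

Lemma det_rev (R : comNzRingType) k (f : nat -> nat -> R) :
  \det (\matrix_(i < k, j < k) f (k - i.+1)%N (k - j.+1)%N) =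
  \det (\matrix_(i < k, j < k) f i j).
Proof.
pose s := perm (@rev_ord_inj k).
have -> : \matrix_(i < k, j < k) f (k - i.+1)%N (k - j.+1)%N =
          row_perm s (col_perm s (\matrix_(i < k, j < k) f i j)).
  by apply/matrixP=> i j; rewrite !mxE !permE.
rewrite row_permE col_permE !det_mulmx !det_perm odd_permV.
by rewrite mulrC -mulrA -expr2 -exprM mulnC exprM sqrrN !expr1n mulr1.
Qed.

Lemma binzS a (z : int) : binz a.+1 (z + 1) = (binz a (z + 1) + binz a z)%N.
Proof.
case: z => z; first by rewrite -PoszD addn1 /= binS.
case: z => [|z]; first by have -> : (Negz 0 + 1 = 0%:Z)%R by []; rewrite /= !bin0.
by have -> : (Negz z.+1 + 1 = Negz z)%R by lia.
Qed.

(** Pascal's rule moved from the binomial onto [f]; the strict bound on [r] kills the boundary term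
    at p = K - 1. *)
Lemma sum_binS K r (f : nat -> nat) : (r.+1 < K)%N ->
  (\sum_(p < K) 'C(r.+1, p) * f p = \sum_(p < K) 'C(r, p) * (f p + f p.+1))%N.
Proof.
case: K => [|K] // rK.
rewrite big_ord_recl bin0 mul1n /=.
under eq_bigr => i _ do rewrite /bump /= add1n binS mulnDl.
under [RHS]eq_bigr => i _ do rewrite mulnDr.
rewrite !big_split /= addnA; congr addn.
  rewrite [RHS]big_ord_recl bin0 mul1n; congr addn.
by rewrite [RHS]big_ord_recr /= bin_small // mul0n addn0.
Qed.

(** This form raises the lower index with [p] and serves the rows of a matrix; [binz_VandermondeB]
    lowers it and serves the columns. The common range [K] turns both into matrix products. *)
Lemma binz_VandermondeD K r a (z : int) : (r < K)%N ->
  binz (a + r) (z + r%:Z) = (\sum_(p < K) 'C(r, p) * binz a (z + p%:Z))%N.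
Proof.
elim: r a z => [|r IHr] a z rK.
  case: K rK => // K _; rewrite big_ord_recl /= mul1n big1 ?addn0 //.
rewrite (sum_binS (fun p => binz a (z + p%:Z))) // addnS -addSn.
have -> : (z + r.+1%:Z = (z + 1) + r%:Z)%R by lia.
rewrite IHr ?(ltnW rK) //; apply: eq_bigr => p _; congr muln.
have -> : (z + 1 + p%:Z = (z + p%:Z) + 1)%R by lia.
rewrite binzS addnC; congr (_ + binz _ _)%N; lia.
Qed.

Lemma binz_VandermondeB K s a (z : int) : (s < K)%N ->
  binz (a + s) z = (\sum_(q < K) 'C(s, q) * binz a (z - q%:Z))%N.
Proof.
elim: s a z => [|s IHs] a z sK.
  case: K sK => // K _; rewrite big_ord_recl /= mul1n big1 ?addn0 ?subr0 //.
rewrite (sum_binS (fun q => binz a (z - q%:Z))) // addnS -addSn.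
rewrite IHs ?(ltnW sK) //; apply: eq_bigr => q _; congr muln.
have -> : (z - q%:Z = (z - q.+1%:Z) + 1)%R by lia.
by rewrite binzS.
Qed.

Lemma det_unitrig (R : comNzRingType) k (A : 'M[R]_k) :
  (forall i j : 'I_k, (i < j)%N -> A i j = 0) ->
  (forall i, A i i = 1) -> \det A = 1.
Proof.
move=> A0 A1; rewrite det_trig; last by apply/is_trig_mxP.
by rewrite big1.
Qed.

(** Expanding in [s] and then in [r] factors the left matrix as [L *m B *m L^T], with [L] Pascal's
    unitriangular matrix. *)
Lemma det_bin_shift m k :
  \det (\matrix_(r < k, s < k) ('C(2 * m + r + s, m + r))%:R : 'M[rat]_k) =
  \det (\matrix_(i < k, j < k) (binz (2 * m) (m%:Z + i%:Z - j%:Z))%:R).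
Proof.
pose L : 'M[rat]_k := \matrix_(r < k, p < k) 'C(r, p)%:R.
set B := (X in _ = \det X).
have -> : \matrix_(r < k, s < k) ('C(2 * m + r + s, m + r))%:R = L *m B *m L^T.
  apply/matrixP=> r s; rewrite !mxE.
  have -> : 'C(2 * m + r + s, m + r) = binz (2 * m + r + s) (m + r)%:Z by [].
  rewrite (@binz_VandermondeB k) // natr_sum; apply: eq_bigr => q _.
  rewrite !mxE natrM mulrC; congr (_ * _).
  have -> : ((m + r)%:Z - q%:Z = (m%:Z - q%:Z) + r%:Z)%R by lia.
  rewrite (@binz_VandermondeD k) // natr_sum; apply: eq_bigr => p _.
  by rewrite !mxE natrM; congr (_ * (binz _ _)%:R); lia.
rewrite !det_mulmx det_tr (_ : \det L = 1) ?mul1r ?mulr1 //.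
by apply: det_unitrig => [i j ij|i]; rewrite mxE ?binn // bin_small.
Qed.

(** The coefficients of monic polynomials of degrees 0, 1, ... form a unitriangular matrix, so only
    the Vandermonde factor remains. *)
Lemma det_monic_horner (R : comNzRingType) k (p : nat -> {poly R}) (x : nat -> R) :
  (forall j, p j \is monic) -> (forall j, size (p j) = j.+1) ->
  \det (\matrix_(i < k, j < k) (p j).[x i]) =
  \prod_(i < k) \prod_(j < k | (i < j)%N) (x j - x i).
Proof.
move=> pm ps.
pose U : 'M[R]_k := \matrix_(j < k, l < k) (p j)`_l.
pose V := @Vandermonde R k k (\row_j x j).
have -> : \matrix_(i < k, j < k) (p j).[x i] = (U *m V)^T.
  apply/matrixP=> i j; rewrite !mxE (horner_coef_wide (n := k)) ?ps //.
  by apply: eq_bigr => l _; rewrite !mxE.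
rewrite det_tr det_mulmx (_ : \det U = 1) ?mul1r.
  rewrite det_Vandermonde; apply: eq_bigr => i _; apply: eq_bigr => j _.
  by rewrite !mxE.
apply: det_unitrig => [i j ij|i]; rewrite mxE; first by rewrite nth_default ?ps.
by have /monicP := pm i; rewrite lead_coefE ps.
Qed.

Lemma fact_neq0 (n : nat) : (n`!)%:R != 0 :> rat.
Proof. by rewrite pnatr_eq0 -lt0n fact_gt0. Qed.

Lemma det_bin_prod m k :
  \det (\matrix_(r < k, s < k) ('C(2 * m + r + s, m + r))%:R : 'M[rat]_k) =
  \prod_(r < k) ((r`! * (2 * m + r)`!)%:R / ((m + r)`! ^ 2)%:R).
Proof.
(* [p s] is (X + 1) ... (X + s), with value (x + s)! / x! at x. The binomial matrix is then [p]
   evaluated at the points 2m + r, up to row and column factors. *)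
pose p s : {poly rat} := \prod_(j < s) ('X - (- j.+1%:R)%:P).
have pm s : p s \is monic by apply: monic_prod => j _; apply: monicXsubC.
have ps s : size (p s) = s.+1 by rewrite size_prod_XsubC /index_enum -enumT size_enum_ord.
have pE s x : (p s).[x%:R] = ((x + s)`!)%:R / (x`!)%:R.
  elim: s => [|s IHs]; first by rewrite /p big_ord0 hornerC addn0 divff ?fact_neq0.
  rewrite /p big_ord_recr hornerM -/(p s) IHs hornerXsubC addnS factS natrM opprK.
  by rewrite -natrD addnS mulrC mulrA.
pose R0 : 'M[rat]_k := diag_mx (\row_r ((2 * m + r)`!%:R / ((m + r)`!)%:R)).
pose C0 : 'M[rat]_k := diag_mx (\row_r ((m + r)`!%:R)^-1).
pose H : 'M[rat]_k := \matrix_(i < k, j < k) (p j).[(2 * m + i)%N%:R].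
have -> : \matrix_(r < k, s < k) ('C(2 * m + r + s, m + r))%:R = R0 *m H *m C0.
  apply/matrixP=> r s; rewrite mul_mx_diag mul_diag_mx !mxE pE.
  have h : (m + r <= 2 * m + r + s)%N by lia.
  have := bin_fact h; rewrite (_ : (2 * m + r + s - (m + r) = m + s)%N); last by lia.
  move/(congr1 (fun x : nat => x%:R : rat)); rewrite !natrM => <-.
  by field; rewrite !fact_neq0.
rewrite !det_mulmx !det_diag (det_monic_horner k (fun i => (2 * m + i)%N%:R) pm ps).
(* The points are consecutive integers, so the differences with a fixed larger index j multiply to
   j!. *)
have -> : \prod_(i < k) \prod_(j < k | (i < j)%N)
            ((2 * m + j)%N%:R - (2 * m + i)%N%:R) = \prod_(j < k) (j`!)%:R :> rat.
  rewrite (exchange_big_dep predT) //=; apply: eq_bigr => j _.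
  rewrite fact_prod natr_prod big_add1 /= big_mkord.
  rewrite (eq_bigr (fun i : 'I_k => (j - i)%N%:R)); last first.
    by move=> i ij; rewrite natrB ?(ltnW ij) // !natrD opprD addrACA subrr add0r.
  rewrite -(big_ord_widen k (fun i => (j - i)%N%:R) (ltnW (ltn_ord j))).
  rewrite (reindex_inj rev_ord_inj) /=.
  by apply: eq_bigr => i _; congr (_%:R); have := ltn_ord i; lia.
rewrite -!big_split /=; apply: eq_bigr => r _; rewrite !mxE natrX natrM.
by field; rewrite fact_neq0.
Qed.

(** The product over [j] telescopes to (h + i + m - 1) / (h + i - 1); the product over [h] is then a
    ratio of factorials. *)
Lemma box_prod m k :
  \prod_(1 <= h < m.+1) \prod_(1 <= i < k.+1) \prod_(1 <= j < m.+1)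
     ((h + i + j - 1)%:R / (h + i + j - 2)%:R) =
  \prod_(r < k) ((r`! * (2 * m + r)`!)%:R / ((m + r)`! ^ 2)%:R) :> rat.
Proof.
rewrite exchange_big /= big_add1 /= big_mkord; apply: eq_bigr => r _.
have inner h : \prod_(1 <= j < m.+1) ((h.+1 + r.+1 + j - 1)%:R / (h.+1 + r.+1 + j - 2)%:R)
   = (h.+1 + r + m)%:R / (h.+1 + r)%:R :> rat.
  elim: m => [|q IHq]; first by rewrite big_geq // addn0 divff // pnatr_eq0.
  rewrite big_nat_recr //= IHq.
  have -> : (h.+1 + r.+1 + q.+1 - 1 = h.+1 + r + q.+1)%N by lia.
  have -> : (h.+1 + r.+1 + q.+1 - 2 = h.+1 + r + q)%N by lia.
  by rewrite mulrC mulrA mulfVK // pnatr_eq0; lia.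
rewrite big_add1 /= (eq_bigr (fun h => (h.+1 + r + m)%:R / (h.+1 + r)%:R)); last first.
  by move=> h _; rewrite inner.
have tele q : \prod_(0 <= h < q) ((h.+1 + r + m)%:R / (h.+1 + r)%:R) =
   (r`! * (m + r + q)`!)%:R / ((m + r)`! * (q + r)`!)%:R :> rat.
  elim: q => [|q IHq].
    rewrite big_geq // addn0 add0n mulnC divff // pnatr_eq0 muln_eq0.
    by rewrite negb_or -!lt0n !fact_gt0.
  rewrite big_nat_recr //= IHq addnS addSn !factS !natrM.
  have -> : ((m + r + q).+1 = q.+1 + r + m)%N by lia.
  have ->: (q.+1 + r = (q + r).+1)%N by [].
  set u := _.+1; have u0 : u%:R != 0 :> rat by rewrite pnatr_eq0.
  by field; rewrite u0 !fact_neq0.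
by rewrite tele natrX natrM expr2 -natrM; congr (_%:R / _); congr (_ * _`!)%N; lia.
Qed.

(** * Facets of cyclic polytopes (Gale evenness) *)

Local Open Scope ring_scope.

(** The product is a square times (-1)^(e + f). In the application [a] is a leading coefficient and
    [b], [c] are two values of the nodal polynomial. *)
Lemma eq_sign_bits (R : realFieldType) (a b c : R) (e f : bool) :
  0 < a * b * (a * c) * ((-1) ^+ e * b * ((-1) ^+ f * c)) -> e == f.
Proof. by case: e; case: f => //; rewrite ?expr1 ?expr0 => h; exfalso; nra. Qed.

Section GaleEvenness.
Variables (R : realFieldType) (N d : nat) (t : 'I_N -> R).
Hypothesis t_incr : forall i j : 'I_N, (i < j)%N -> t i < t j.
Hypothesis dN : (d < N)%N.
Implicit Types (S : {set 'I_N}) (q : {poly R}).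

(** For [j] outside [S] its parity is the sign at [t j] of the polynomial with simple roots at the
    parameters of [S]. [gale] asks that these signs agree. *)
Definition above (S : {set 'I_N}) (j : 'I_N) : nat := #|[set x in S | (j < x)%N]|.

Definition gale (S : {set 'I_N}) : bool :=
  [forall i, forall j, (i \notin S) && (j \notin S) ==>
     (odd (above S i) == odd (above S j))].

(** The hyperplane [(c, b)] corresponds to the polynomial b - sum_j c_j x^(j+1), whose values at the
    parameters are the slacks of the vertices. *)
Lemma hull_faceP S :
  hull_face (fun i => moment_curve d (t i)) S <->
  exists2 q : {poly R}, (size q <= d.+1)%N &
    forall i, 0 <= q.[t i] /\ (q.[t i] == 0) = (i \in S).
Proof.
have mcE (c : 'cV[R]_d) x : (moment_curve d x *m c) 0 0 = \sum_(j < d) c j 0 * x ^+ j.+1.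
  by rewrite mxE; apply: eq_bigr => j _; rewrite mxE mulrC.
split=> [[c [b Hcb]]|[q sq Hq]].
  pose q : {poly R} := b%:P - 'X * rVpoly c^T.
  have qE x : q.[x] = b - (moment_curve d x *m c) 0 0.
    rewrite mcE !hornerE; congr (_ - _).
    rewrite (horner_coef_wide (n := d)) ?size_poly // mulr_sumr.
    apply: eq_bigr => j _; rewrite coef_rVpoly_ord mxE exprS; ring.
  exists q => [|i].
    rewrite (leq_trans (size_polyD _ _)) // geq_max size_polyN.
    rewrite (leq_trans (size_polyC_leq1 _)) //= mulrC.
    have [->|nz] := eqVneq (rVpoly c^T) 0; first by rewrite mul0r size_poly0.
    by rewrite size_mulX // ltnS size_poly.
  have [h1 h2] := Hcb i.
  by rewrite qE subr_ge0; split; rewrite // subr_eq0 eq_sym.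
exists (\col_j (- q`_j.+1)), q`_0 => i.
have qE : q.[t i] = q`_0 - (moment_curve d (t i) *m \col_j (- q`_j.+1)) 0 0.
  rewrite mcE (horner_coef_wide _ sq) big_ord_recl expr0 mulr1 -sumrN; congr (_ + _).
  by apply: eq_bigr => j _; rewrite mxE mulNr opprK.
have [h1 h2] := Hq i; rewrite qE in h1 h2; split; first by rewrite subr_ge0 in h1.
by rewrite -h2 subr_eq0 eq_sym.
Qed.

Let t_inj : injective t.
Proof.
move=> i j tij; apply/val_inj; case: (ltngtP i j) => // /t_incr; rewrite tij ltxx //.
Qed.

Let pS (S : {set 'I_N}) : {poly R} := \prod_(i in S) ('X - (t i)%:P).

Let pSE S : pS S = \prod_(z <- [seq t i | i <- enum S]) ('X - z%:P).
Proof. by rewrite big_map big_enum. Qed.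

Let size_pS S : size (pS S) = #|S|.+1.
Proof. by rewrite pSE size_prod_XsubC size_map -cardE. Qed.

Let root_pS S i : (pS S).[t i] == 0 = (i \in S).
Proof.
have -> : ((pS S).[t i] == 0) = root (pS S) (t i) by [].
by rewrite pSE root_prod_XsubC (mem_map t_inj) mem_enum.
Qed.

Lemma nodal_poly_sign S j : j \notin S -> 0 < (-1) ^+ above S j * (pS S).[t j].
Proof.
move=> jS; have -> : above S j = (\sum_(i in S) (j < i)%N)%N.
  rewrite /above -sum1_card big_mkcond [RHS]big_mkcond; apply: eq_bigr => i _.
  by rewrite inE; case: (i \in S) => //=; case: (j < i)%N.
rewrite expr_sum horner_prod -big_split /=; apply: prodr_gt0 => i iS.
rewrite hornerXsubC; case: (ltngtP j i) => [ji|ij|/val_inj ji].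
- by rewrite expr1 mulN1r opprB subr_gt0 t_incr.
- by rewrite expr0 mul1r subr_gt0 t_incr.
- by rewrite ji iS in jS.
Qed.

Lemma face_card S q : (size q <= d.+1)%N ->
  (forall i, (q.[t i] == 0) = (i \in S)) -> S != setT -> (#|S| <= d)%N.
Proof.
move=> sq Hq; rewrite -subTset => /subsetPn[u _ uS].
have q0 : q != 0 by apply/eqP => q0; rewrite -Hq q0 horner0 eqxx in uS.
rewrite cardE -(size_map t) -ltnS (leq_trans _ sq) //; apply: max_poly_roots => //.
  by apply/allP=> x /mapP[i]; rewrite mem_enum -Hq => qi ->.
by rewrite map_inj_uniq ?enum_uniq.
Qed.

(* Push the supporting polynomial q along a polynomial r vanishing on S and at u
   until it touches a new point: u keeps the enlarged face proper. *)
Lemma face_extend S q : (size q <= d.+1)%N ->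
  (forall i, 0 <= q.[t i] /\ (q.[t i] == 0) = (i \in S)) -> (#|S| < d)%N ->
  exists S' : {set 'I_N}, [/\ S \proper S', S' != setT &
    hull_face (fun i => moment_curve d (t i)) S'].
Proof.
move=> sq Hq Sd.
have [u uS] : exists u, u \notin S.
  have /subsetPn[u _ uS] : ~~ (setT \subset S).
    by apply/negP=> /subset_leq_card; rewrite cardsT card_ord; lia.
  by exists u.
pose U := u |: S; have cU : #|U| = #|S|.+1 by rewrite cardsU1 uS.
have [j jU] : exists j, j \notin U.
  have /subsetPn[j _ jU] : ~~ (setT \subset U).
    by apply/negP=> /subset_leq_card; rewrite cardsT card_ord cU; lia.
  by exists j.
pose r := (pS U).[t j] *: pS U.
have rj : 0 < r.[t j].
  by rewrite hornerZ -expr2 exprn_even_gt0 //= root_pS.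
pose P i := 0 < r.[t i].
have [/= i Pi imin] := Order.TotalTheory.arg_minP (P := P) (fun i => q.[t i] / r.[t i]) rj.
pose l := q.[t i] / r.[t i].
have l0 : 0 <= l by apply: divr_ge0; [case: (Hq i)|apply: ltW].
pose q' := q - l *: r.
have q'E x : q'.[x] = q.[x] - l * r.[x] by rewrite !hornerE.
have q'ge x : 0 <= q'.[t x].
  rewrite q'E subr_ge0; case: (ltP 0 r.[t x]) => rx.
    by rewrite -ler_pdivlMr //; apply: imin.
  by apply: le_trans (proj1 (Hq x)); apply: mulr_ge0_le0.
exists [set x | q'.[t x] == 0]; split.
- apply/properP; split.
    apply/subsetP=> x xS; rewrite inE q'E hornerZ.
    have /eqP -> : (pS U).[t x] == 0 by rewrite root_pS !inE xS orbT.
    by rewrite !mulr0 subr0 (proj2 (Hq x)).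
  exists i; first by rewrite inE q'E /l divfK ?subrr // gt_eqF.
  apply/negP=> iS; move: Pi; rewrite /P hornerZ.
  have /eqP -> : (pS U).[t i] == 0 by rewrite root_pS !inE iS orbT.
  by rewrite mulr0 ltxx.
- apply/eqP=> /setP/(_ u); rewrite !inE q'E hornerZ.
  have /eqP -> : (pS U).[t u] == 0 by rewrite root_pS !inE eqxx.
  by rewrite !mulr0 subr0 (proj2 (Hq u)) (negPf uS).
apply/hull_faceP; exists q' => [|x]; last by rewrite inE.
rewrite (leq_trans (size_polyD _ _)) // geq_max sq size_polyN.
by rewrite (leq_trans (size_scale_leq _ _)) // (leq_trans (size_scale_leq _ _)) // size_pS cU.
Qed.

(** By [face_extend] a facet has exactly [d] points. Its supporting polynomial then has [d] known
    roots and degree [d], so it is a multiple of the nodal polynomial, and its signs off [S] must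
    agree. Conversely that multiple supports [S], which is maximal by [face_card]. *)
Lemma hull_facets_gale :
  hull_facets (fun i => moment_curve d (t i)) = [set S : {set 'I_N} | (#|S| == d) && gale S].
Proof.
apply/setP=> S; rewrite !inE; apply/maxsetP/andP => [[/andP[ST /asboolP]]|[/eqP Sd gS]].
  move=> /hull_faceP[q sq Hq] Smax.
  have leSd := face_card sq (fun i => proj2 (Hq i)) ST.
  have Sd : #|S| = d.
    apply/eqP; rewrite eqn_leq leSd leqNgt; apply/negP=> ltSd.
    have [S' [SS' S'T fS']] := face_extend sq Hq ltSd.
    have S'S : S' = S.
      by apply: Smax; [rewrite S'T; apply/asboolP|apply: proper_sub].
    by move: SS'; rewrite S'S properxx.
  split; first exact/eqP.
  have [u uS] : exists u, u \notin S by move: ST; rewrite -subTset => /subsetPn[u _]; exists u.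
  have q0 : q != 0 by apply/eqP => q0; move: uS; rewrite -(proj2 (Hq u)) q0 horner0 eqxx.
  have uq : uniq [seq t i | i <- enum S] by rewrite map_inj_uniq ?enum_uniq.
  have aq : all (root q) [seq t i | i <- enum S].
    by apply/allP=> x /mapP[i]; rewrite mem_enum -(proj2 (Hq i)) => qi ->.
  have szq : size q = (size [seq t i | i <- enum S]).+1.
    apply/eqP; rewrite eqn_leq max_poly_roots // andbT.
    by rewrite size_map -cardE Sd.
  have qE : q = lead_coef q *: pS S.
    by rewrite pSE; apply: all_roots_prod_XsubC => //; rewrite uniq_rootsE.
  have pos i : i \notin S -> 0 < lead_coef q * (pS S).[t i].
    move=> iS; rewrite -hornerZ -qE lt_def (proj1 (Hq i)) andbT.
    by rewrite (proj2 (Hq i)).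
  apply/forallP=> i; apply/forallP=> j; apply/implyP=> /andP[iS jS].
  have [pi pj] := (pos i iS, pos j jS).
  have [si sj] := (nodal_poly_sign iS, nodal_poly_sign jS).
  have := mulr_gt0 (mulr_gt0 pi pj) (mulr_gt0 si sj).
  rewrite -(signr_odd _ (above S i)) -(signr_odd _ (above S j)).
  exact: eq_sign_bits.
have ST : S != setT.
  by apply/eqP=> ST; move: Sd; rewrite ST cardsT card_ord; lia.
have [u uS] : exists u, u \notin S by move: ST; rewrite -subTset => /subsetPn[u _]; exists u.
split.
  rewrite ST /=; apply/asboolP/hull_faceP; exists ((-1) ^+ above S u *: pS S).
    by rewrite (leq_trans (size_scale_leq _ _)) // size_pS Sd.
  move=> i; rewrite hornerZ mulf_eq0 signr_eq0 /= root_pS; split=> //.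
  case: (boolP (i \in S)) => iS.
    by have /eqP -> : (pS S).[t i] == 0 by [rewrite root_pS]; rewrite mulr0.
  move/forallP/(_ u)/forallP/(_ i): gS; rewrite uS iS /= => /eqP e.
  by rewrite -signr_odd e signr_odd ltW // nodal_poly_sign.
move=> S' /andP[S'T /asboolP/hull_faceP[q sq Hq]] SS'; apply/eqP.
by rewrite eq_sym eqEcard SS' Sd (face_card sq (fun i => proj2 (Hq i))).
Qed.

End GaleEvenness.

Local Open Scope nat_scope.

Lemma card_set_ordS N (P : pred {set 'I_N.+1}) :
  #|[set S | P S]| = #|[set S : {set 'I_N} | P (lift ord0 @: S)]| +
                     #|[set S : {set 'I_N} | P (ord0 |: lift ord0 @: S)]|.
Proof.
have li := @lift_inj N.+1 ord0.
have l0 (S : {set 'I_N}) : ord0 \notin lift ord0 @: S.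
  by apply/negP=> /imsetP[x _] /eqP; rewrite (negPf (neq_lift _ _)).
have pre (S : {set 'I_N}) : lift ord0 @^-1: (lift ord0 @: S) = S.
  by apply/setP=> x; rewrite inE mem_imset.
have pre' (S : {set 'I_N}) : lift ord0 @^-1: (ord0 |: lift ord0 @: S) = S.
  by apply/setP=> x; rewrite !inE mem_imset.
have imp (S : {set 'I_N.+1}) : lift ord0 @: (lift ord0 @^-1: S) = S :\ ord0.
  apply/setP=> x; rewrite !inE; case: (unliftP ord0 x) => [y ->|->].
    by rewrite mem_imset // inE eq_sym neq_lift.
  by rewrite eqxx; apply/negbTE.
have fi : injective (fun S : {set 'I_N} => lift ord0 @: S).
  by move=> A B /= E; rewrite -(pre A) -(pre B) E.
have fi' : injective (fun S : {set 'I_N} => ord0 |: lift ord0 @: S).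
  by move=> A B /= E; rewrite -(pre' A) -(pre' B) E.
rewrite -(cardsID [set S : {set 'I_N.+1} | ord0 \notin S]); congr addn.
  rewrite -(card_imset _ fi); apply: eq_card => S.
  rewrite !inE; apply/andP/imsetP => [[PS S0]|[S' PS' ->]].
    have E : lift ord0 @: (lift ord0 @^-1: S) = S.
      by rewrite imp; apply/setDidPl; rewrite disjoint_sym disjoints1.
    by exists (lift ord0 @^-1: S); rewrite ?inE E.
  by rewrite inE in PS'.
rewrite -(card_imset _ fi'); apply: eq_card => S.
rewrite !inE negbK; apply/andP/imsetP => [[S0 PS]|[S' PS' ->]].
  have E : ord0 |: lift ord0 @: (lift ord0 @^-1: S) = S by rewrite imp setD1K.
  by exists (lift ord0 @^-1: S); rewrite ?inE E.
by rewrite inE in PS'; rewrite !inE eqxx.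
Qed.

(** Fixing the common parity turns Gale's condition into one on single indices, which allows a
    recursion on [N]. *)
Definition parity_sets (b : bool) (N d : nat) : {set {set 'I_N}} :=
  [set S : {set 'I_N} | (#|S| == d) && [forall j, (j \notin S) ==> (odd (above S j) == b)]].

Lemma forall_ordS N (P : pred 'I_N.+1) :
  [forall j, P j] = P ord0 && [forall j, P (lift ord0 j)].
Proof.
apply/forallP/andP => [H|[H0 /forallP H] j]; first by split=> //; apply/forallP.
by case: (unliftP ord0 j) => [x ->|->].
Qed.

(** Removing the lowest index 0 changes no other value of [above]. If 0 is outside the set, all [d]
    members lie above it, whence the test on the parity of [d]. *)
Lemma card_parity_setsS b N d :
  #|parity_sets b N.+1 d| =
    (odd d == b) * #|parity_sets b N d| + (if d is d'.+1 then #|parity_sets b N d'| else 0).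
Proof.
have li := @lift_inj N.+1 ord0.
have l0 (S : {set 'I_N}) : ord0 \notin lift ord0 @: S.
  by apply/negP=> /imsetP[x _] /eqP; rewrite (negPf (neq_lift _ _)).
have ab (S : {set 'I_N}) (A : {set 'I_N.+1}) j : A :\ ord0 = lift ord0 @: S ->
    above A (lift ord0 j) = above S j.
  move=> AS; rewrite /above -(card_imset _ li); apply: eq_card => x.
  rewrite !inE; case: (unliftP ord0 x) => [y ->|->].
    rewrite mem_imset // inE; have := mem_imset S y li; rewrite -AS !inE eq_sym neq_lift /= => <-.
    by rewrite /= /bump !leq0n !add1n ltnS.
  by rewrite andbF; apply/esym/negbTE.
have ab0 (S : {set 'I_N}) : above (lift ord0 @: S) ord0 = #|S|.
  rewrite /above -(card_imset _ li); apply: eq_card => x; rewrite inE andb_idr //.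
  by move=> /imsetP[y _ ->]; rewrite lift0.
rewrite card_set_ordS; congr addn.
  transitivity #|pred_of_set (if odd d == b then parity_sets b N d else set0)|; last first.
    by case: (_ == _); rewrite ?cards0 ?mul1n.
  apply: eq_card => S; rewrite inE card_imset // forall_ordS l0 ab0 /=.
  have -> : [forall j, (lift ord0 j \notin lift ord0 @: S) ==>
               (odd (above (lift ord0 @: S) (lift ord0 j)) == b)] =
            [forall j, (j \notin S) ==> (odd (above S j) == b)].
    apply: eq_forallb => j; rewrite mem_imset // (@ab S) //.
    by apply/setDidPl; rewrite disjoint_sym disjoints1.
  case: (#|S| =P d) => [Sd|/eqP h] /=; last by case: ifP; rewrite !inE ?(negPf h).
  by rewrite Sd; case: (odd d == b) => /=; rewrite !inE ?Sd ?eqxx.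
case: d => [|d].
  apply: eq_card0 => S; rewrite !inE cardsU1 l0 //.
apply: eq_card => S; rewrite !inE cardsU1 l0 card_imset // eqSS forall_ordS !inE eqxx /=.
congr andb; apply: eq_forallb => j; rewrite !inE eq_sym (negPf (neq_lift _ _)) /=.
rewrite mem_imset // (@ab S) //; apply/setP=> x; rewrite !inE.
case: eqP => [->|//]; by apply/esym/negbTE.
Qed.

Lemma card_parity_sets0 d b : #|parity_sets b 0 d| = (d == 0).
Proof.
have P S : S \in parity_sets b 0 d = (0 == d).
  rewrite inE (_ : [forall j, _] = true) ?andbT; last by apply/forallP=> -[].
  by rewrite (_ : #|S| = 0) //; apply: eq_card0 => -[].
case: d P => [|d] P; last by apply: eq_card0 => S; rewrite P.
rewrite (_ : parity_sets b 0 0 = [set set0]) ?cards1 //.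
by apply/setP=> S; rewrite P inE; apply/esym/eqP/setP=> -[].
Qed.

Lemma card_parity_sets_gt b N d : N < d -> #|parity_sets b N d| = 0.
Proof.
move=> Nd; apply: eq_card0 => S; rewrite inE; apply/negbTE/nandP; left.
by rewrite neq_ltn (leq_ltn_trans (max_card _)) // card_ord.
Qed.

(** Read from the top, the members form adjacent pairs, with one left at the bottom when [d] is odd;
    D nonmembers and d/2 pairs are arranged freely. *)
Lemma card_parity_sets_even D d : #|parity_sets false (D + d) d| = 'C(D + d./2, D).
Proof.
move: {2}(D + d) (erefl (D + d)) => N; elim: N D d => [|N IHN] D d Dd.
  have [-> ->] : D = 0 /\ d = 0 by lia.
  exact: card_parity_sets0.
rewrite Dd card_parity_setsS.
case: D Dd => [|D] Dd.
  have {}Dd : d = N.+1 by rewrite -Dd.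
  subst d.
  by rewrite card_parity_sets_gt // muln0 add0n; have := IHN 0 N erefl; rewrite !bin0.
have E1 : #|parity_sets false N d| = 'C(D + d./2, D) by rewrite -IHN; last lia; congr #|pred_of_set (parity_sets _ _ _)|; lia.
case: d Dd E1 => [|d] Dd E1; first by rewrite E1 /= mul1n !addn0 !binn.
have E2 : #|parity_sets false N d| = 'C(D.+1 + d./2, D.+1).
  by rewrite -IHN; last lia; congr #|pred_of_set (parity_sets _ _ _)|; lia.
rewrite E1 E2; case: (boolP (odd d)) => od.
  have -> : d.+1./2 = d./2.+1 by lia.
  have -> : (odd d.+1 == false) = true by rewrite /= od.
  by rewrite mul1n addnS addSn addSn binS addnC -addSnnS.
have -> : d.+1./2 = d./2 by lia.
by have -> : (odd d.+1 == false) = false by rewrite /= od.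
Qed.

(** The top index always belongs to the set; without it the even case for [d - 1] remains. *)
Lemma card_parity_sets_odd D d : 0 < d -> #|parity_sets true (D + d) d| = 'C(D + d.-1./2, D).
Proof.
move: {2}(D + d) (erefl (D + d)) => N; elim: N D d => [|N IHN] D d Dd d0; first by lia.
rewrite Dd card_parity_setsS; case: d d0 Dd => // d _ Dd /=.
case: D Dd => [|D] Dd.
  rewrite card_parity_sets_gt ?muln0 ?add0n ?bin0; last by lia.
  have -> : N = d by lia.
  case: d Dd => [|d] Dd; first exact: card_parity_sets0.
  by have := IHN 0 d.+1; rewrite add0n bin0 => -> //; lia.
have E1 : #|parity_sets true N d.+1| = 'C(D + d./2, D).
  by rewrite -(IHN D d.+1) //; last lia; congr #|pred_of_set (parity_sets _ _ _)|; lia.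
rewrite E1; case: d Dd E1 => [|d] Dd E1.
  rewrite /= mul1n !addn0 !binn.
  suff -> : #|parity_sets true N 0| = 0 by [].
  apply: eq_card0 => S; rewrite inE; apply/negbTE/nandP.
  case: (#|S| =P 0) => /= S0; [right|by left].
  have N0 : 0 < N by lia.
  rewrite negb_forall; apply/existsP; exists (Ordinal N0).
  have -> : S = set0 by apply/eqP; rewrite -cards_eq0 S0.
  by rewrite in_set0 /= /above (_ : [set x in set0 | _] = set0) ?cards0 //; apply/setP=> x; rewrite !inE.
have E2 : #|parity_sets true N d.+1| = 'C(D.+1 + d./2, D.+1).
  by rewrite -(IHN D.+1 d.+1) //; last lia; congr #|pred_of_set (parity_sets _ _ _)|; lia.
rewrite E2; case: (boolP (odd d)) => od /=; rewrite ?od ?(negPf od) /=.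
  have -> : uphalf d = d./2.+1 by lia.
  by rewrite mul1n addnS addSn addSn binS addnC -addSnnS.
by have -> : uphalf d = d./2 by lia.
Qed.

(** As [0 < D], some index lies outside the set, so exactly one of the two parities applies. *)
Lemma card_gale D d : 0 < D -> 0 < d ->
  #|[set S : {set 'I_(D + d)} | (#|S| == d) && gale S]| =
  'C(D + d./2, D) + 'C(D + d.-1./2, D).
Proof.
move=> D0 d0; rewrite -card_parity_sets_even -card_parity_sets_odd //.
rewrite -cardsUI (_ : _ :&: _ = set0).
  rewrite cards0 addn0; apply: eq_card => S; rewrite !inE -andb_orr.
  case: (#|S| =P d) => //= Sd.
  have [u uS] : exists u, u \notin S.
    have /subsetPn[u _ uS] : ~~ (setT \subset S).
      by apply/negP=> /subset_leq_card; rewrite cardsT card_ord Sd; lia.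
    by exists u.
  apply/forallP/orP => [H|[] /forallP H i].
  - case E : (odd (above S u)); [right|left]; apply/forallP => j; apply/implyP=> jS.
      by have /forallP/(_ u) := H j; rewrite jS uS E.
    by have /forallP/(_ u) := H j; rewrite jS uS E.
  - apply/forallP=> j; apply/implyP=> /andP[iS jS].
    by have := H i; have := H j; rewrite iS jS => /eqP -> /eqP ->.
  - apply/forallP=> j; apply/implyP=> /andP[iS jS].
    by have := H i; have := H j; rewrite iS jS => /eqP -> /eqP ->.
apply/setP=> S; rewrite !inE; apply/negP=> /andP[/andP[/eqP Sd /forallP H0] /andP[_ /forallP H1]].
have /subsetPn[u _ uS] : ~~ (setT \subset S).
  by apply/negP=> /subset_leq_card; rewrite cardsT card_ord Sd; lia.
by have := H0 u; have := H1 u; rewrite uS /= => /eqP ->.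
Qed.

Lemma cyclic_polytope_facetsE (R : realFieldType) N D d (t : 'I_N -> R) :
  N = D + d -> 0 < D -> 0 < d -> (forall i j : 'I_N, i < j -> (t i < t j)%R) ->
  cyclic_polytope_facets d t = 'C(D + d./2, D) + 'C(D + d.-1./2, D).
Proof.
move=> ND D0 d0; subst N => tincr; rewrite /cyclic_polytope_facets hull_facets_gale ?card_gale //.
lia.
Qed.

(** * Upper bound for complexes with symmetric partitions *)

Local Open Scope nat_scope.

Lemma card_set_sum (T : finType) (A : pred T) : #|[set x | A x]| = \sum_x (A x : nat).
Proof. by rewrite -sum1_card big_mkcond; apply: eq_bigr => x _; rewrite inE; case: (A x). Qed.

Section UpperBound.
Variables (V : finType) (d : nat) (Fs : {set {set V}}).
Hypothesis Fs_card : forall F, F \in Fs -> #|F| = d.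
Implicit Types (F G W : {set V}) (R : {set V} -> {set V}).

(** The second clause says that each face lies in exactly one interval from [R F] to [F], the
    boolean being read as 1 or 0. *)
Definition partitions_faces R : Prop :=
  (forall F, F \in Fs -> R F \subset F) /\
  (forall G, #|[set F in Fs | (R F \subset G) && (G \subset F)]| =
             [exists F in Fs, G \subset F]).

(** The faces containing [W] are partitioned by the intervals from [R F :|: W] to [F]. For
    [W = set0] this is the h-vector, for a vertex that of its link with the index shifted by one. *)
Definition hvec R W a : nat := #|[set F in Fs | (W \subset F) && (#|R F :|: W| == a)]|.

Lemma card_between (A F : {set V}) s : A \subset F ->
  #|[set G : {set V} | [&& A \subset G, G \subset F & #|G| == s]]| =
  if #|A| <= s then 'C(#|F| - #|A|, s - #|A|) else 0.
Proof.
move=> AF; case: leqP => [As|sA]; last first.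
  apply: eq_card0 => G; rewrite inE; apply/negP=> /and3P[/subset_leq_card AG _ /eqP Gs].
  by rewrite Gs leqNgt sA in AG.
rewrite -cardsDS // -cards_draws.
have U : forall B : {set V}, B \subset F :\: A -> [disjoint A & B].
  by move=> B; rewrite subsetD => /andP[_]; rewrite disjoint_sym.
have inj : {in [set B : {set V} | B \subset F :\: A & #|B| == s - #|A|] &,
            injective (fun B => A :|: B)}.
  move=> B C; rewrite !inE => /andP[/U dB _] /andP[/U dC _] E.
  have K (X : {set V}) : [disjoint A & X] -> (A :|: X) :\: A = X.
    by move=> dX; rewrite setDUl setDv set0U; apply/setDidPl; rewrite disjoint_sym.
  by rewrite -(K B) // -(K C) // E.
rewrite -(card_in_imset inj); apply: eq_card => G; rewrite inE.
apply/and3P/imsetP => [[AG GF /eqP Gs]|[B]].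
  exists (G :\: A); last by rewrite -{1}(setID G A) (setIidPr AG).
  by rewrite inE setSD //= cardsDS // Gs.
rewrite inE => /andP[BF /eqP cB] ->; split; first exact: subsetUl.
  by rewrite subUset AF; apply: subset_trans BF (subsetDl _ _).
by rewrite cardsU (disjoint_setI0 (U _ BF)) cards0 subn0 cB subnKC.
Qed.

Lemma card_faces_hvec R W s : partitions_faces R ->
  #|[set G : {set V} | [&& W \subset G, [exists F in Fs, G \subset F] & #|G| == s]]| =
  \sum_(a < s.+1) hvec R W a * 'C(d - a, s - a).
Proof.
move=> [RF part].
pose P F G := [&& W \subset G, R F \subset G, G \subset F & #|G| == s].
transitivity (\sum_(F in Fs) #|[set G | P F G]|).
  rewrite card_set_sum [RHS]big_mkcond.
  transitivity (\sum_(G : {set V}) \sum_(F : {set V}) ((F \in Fs) && P F G : nat)).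
    apply: eq_bigr => G _; rewrite -card_set_sum.
    case: (boolP (W \subset G)) => WG /=; last first.
      by rewrite (_ : [set _ | _] = set0) ?cards0 //; apply/setP=> F; rewrite !inE /P (negPf WG) andbF.
    rewrite andbC; case: (boolP (#|G| == s)) => Gs /=; last first.
      by rewrite (_ : [set _ | _] = set0) ?cards0 //; apply/setP=> F; rewrite !inE /P (negPf Gs) !andbF.
    by rewrite -part; apply: eq_card => F; rewrite !inE /P WG Gs andbT.
  rewrite exchange_big /=; apply: eq_bigr => F _; case: (F \in Fs) => /=.
    by rewrite card_set_sum.
  by rewrite big1.
transitivity (\sum_(F in Fs | W \subset F)
   (if #|R F :|: W| <= s then 'C(d - #|R F :|: W|, s - #|R F :|: W|) else 0)).
  rewrite big_mkcondr; apply: eq_bigr => F FF.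
  case: ifP => WF.
    rewrite -(Fs_card FF) -card_between; last by rewrite subUset RF.
    apply: eq_card => G; rewrite !inE /P subUset.
    by case: (W \subset G); rewrite ?andbT ?andbF.
  apply: eq_card0 => G; rewrite inE /P; apply/negP=> /and4P[WG _ GF _].
  by rewrite (subset_trans WG GF) in WF.
transitivity (\sum_(F in Fs | W \subset F) \sum_(a < s.+1 | #|R F :|: W| == a) 'C(d - a, s - a)).
  apply: eq_bigr => F _; case: leqP => h.
    rewrite -ltnS in h; rewrite (big_pred1 (Ordinal h)) //.
  rewrite big_pred0 // => a; apply/negbTE/eqP=> e; have := ltn_ord a; rewrite -e; lia.
rewrite (exchange_big_dep predT) //=; apply: eq_bigr => a _.
rewrite sum_nat_const; congr (_ * _); apply: eq_card => F; rewrite !inE unfold_in.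
by rewrite andbA.
Qed.

(** The face numbers of [card_faces_hvec] do not mention [R], and they depend on [hvec] through a
    unitriangular system. *)
Lemma hvec_indep R R' W a : partitions_faces R -> partitions_faces R' ->
  hvec R W a = hvec R' W a.
Proof.
move=> pR pR'; elim/ltn_ind: a => a IH.
have := card_faces_hvec W a pR; rewrite (card_faces_hvec W a pR').
rewrite !big_ord_recr /= subnn !bin0 !muln1.
rewrite (eq_bigr (fun i : 'I_a => hvec R W i * 'C(d - i, a - i))); last first.
  by move=> i _; rewrite IH.
by move/eqP; rewrite eqn_add2l => /eqP.
Qed.

Variable R0 : {set V} -> {set V}.
Hypothesis R0_part : partitions_faces R0.
Hypothesis R0C_part : partitions_faces (fun F => F :\: R0 F).
Hypothesis rot_part : forall v : V, exists2 R, partitions_faces R &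
  forall F, F \in Fs -> v \notin R F.

Let h a := hvec R0 set0 a.

Let hE a : h a = #|[set F in Fs | #|R0 F| == a]|.
Proof. by apply: eq_card => F; rewrite !inE sub0set setU0. Qed.

(** Compare [R0] with the opposite partition by [F :\: R0 F]: the two restriction sets have
    complementary sizes. *)
Lemma hvec_sym a : a <= d -> h a = h (d - a).
Proof.
move=> ad; rewrite [h a](hvec_indep _ _ R0_part R0C_part) hE.
apply: eq_card => F; rewrite !inE sub0set setU0 /=; case: (boolP (F \in Fs)) => //= FF.
have RF := R0_part.1 _ FF; have := subset_leq_card RF.
by rewrite cardsDS // (Fs_card FF) => h1; apply/eqP/eqP; lia.
Qed.

(** With a partition for which [v] is in no [R F], adjoining [v] raises the size of each [R F] by
    exactly one. *)
Lemma hvec_link_le v a : hvec R0 [set v] a.+1 <= h a.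
Proof.
have [R pR vR] := rot_part v.
rewrite (hvec_indep _ _ R0_part pR) /h (hvec_indep _ _ R0_part pR).
apply: subset_leq_card; apply/subsetP=> F; rewrite !inE => /andP[FF /andP[_]].
by rewrite FF sub0set setU0 setUC cardsU1 vR //= add1n eqSS.
Qed.

(** Count the pairs of a facet F and a vertex v of F: v inside [R0 F] needs #|R0 F| = a + 1, v
    outside needs #|R0 F| = a. *)
Lemma sum_hvec_link a : a <= d ->
  \sum_(v : V) hvec R0 [set v] a.+1 = a.+1 * h a.+1 + (d - a) * h a.
Proof.
move=> ad.
transitivity (\sum_(F in Fs) \sum_(v in F | #|R0 F :|: [set v]| == a.+1) 1).
  rewrite (exchange_big_dep predT) //=; apply: eq_bigr => v _.
  rewrite /hvec -sum1_card; apply: eq_bigl => F.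
  by rewrite !inE sub1set.
transitivity (\sum_(F in Fs) ((#|R0 F| == a.+1) * a.+1 + (#|R0 F| == a) * (d - a))).
  apply: eq_bigr => F FF; have RF := R0_part.1 _ FF.
  have <- : (\sum_(v in R0 F) (#|R0 F| == a.+1) = (#|R0 F| == a.+1) * a.+1)%N.
    by rewrite sum_nat_const mulnC; case: eqP => [->|].
  have <- : (\sum_(v in F :\: R0 F) (#|R0 F| == a) = (#|R0 F| == a) * (d - a))%N.
    by rewrite sum_nat_const mulnC cardsDS // (Fs_card FF); case: eqP => [->|].
  rewrite big_mkcondr [LHS](big_setID (R0 F)) /= (setIidPr RF); congr addn.
    apply: eq_bigr => v vR; rewrite (setUidPl _) ?sub1set //; by case: ifP.
  by apply: eq_bigr => v; rewrite inE => /andP[vR _]; rewrite setUC cardsU1 vR add1n eqSS; case: ifP.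
rewrite big_split /= -!big_distrl /= mulnC [X in _ + X]mulnC !hE; congr (_ * _ + _ * _).
  by rewrite -sum1_card [LHS]big_mkcond [RHS]big_mkcond; apply: eq_bigr => F _; rewrite inE; case: (F \in Fs); case: eqP.
by rewrite -sum1_card [LHS]big_mkcond [RHS]big_mkcond; apply: eq_bigr => F _; rewrite inE; case: (F \in Fs); case: eqP.
Qed.

Variable D : nat.
Hypothesis cardV : #|V| = D.+1 + d.

Lemma hvec_le a : a <= d -> h a <= 'C(D + a, a).
Proof.
elim: a => [|a IH] ad.
  rewrite bin0 hE; have := R0_part.2 set0.
  suff -> : [set F in Fs | (R0 F \subset set0) && (set0 \subset F)] = [set F in Fs | #|R0 F| == 0].
    by move=> ->; apply: leq_b1.
  by apply/setP=> F; rewrite !inE subset0 sub0set andbT cards_eq0.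
have {IH}IH := IH (ltnW ad).
have le1 : a.+1 * h a.+1 + (d - a) * h a <= #|V| * h a.
  rewrite -sum_hvec_link ?(ltnW ad) // -sum_nat_const.
  by apply: leq_sum => v _; apply: hvec_link_le.
have le2 : a.+1 * h a.+1 <= (D + a).+1 * h a.
  rewrite cardV in le1; have e : D.+1 + d = (D + a).+1 + (d - a) by lia.
  by rewrite e mulnDl leq_add2r in le1.
rewrite -(leq_pmul2l (isT : 0 < a.+1)) (leq_trans le2) // addnS -mul_bin_diag.
by rewrite leq_mul2l IH orbT.
Qed.

Lemma sum_bin_diag e : \sum_(a < e.+1) 'C(D + a, a) = 'C(D.+1 + e, D.+1).
Proof.
elim: e => [|e IH]; first by rewrite big_ord1 bin0 addn0 binn.
rewrite big_ord_recr IH [in RHS]addnS binS; congr (_ + _); rewrite [LHS]/=.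
have -> : 'C(D + e.+1, e.+1) = 'C(D + e.+1, D) by rewrite -(@bin_sub (D + e.+1)) ?leq_addl // addnK.
by rewrite addSnnS.
Qed.

Lemma card_facets_le : 0 < d ->
  #|Fs| <= 'C(D.+1 + d./2, D.+1) + 'C(D.+1 + d.-1./2, D.+1).
Proof.
move=> d0.
have -> : #|Fs| = \sum_(a < d.+1) h a.
  transitivity (\sum_(F in Fs) \sum_(a < d.+1 | #|R0 F| == a) 1).
    rewrite -sum1_card; apply: eq_bigr => F FF.
    have lt : #|R0 F| < d.+1 by rewrite ltnS -(Fs_card FF) subset_leq_card // R0_part.1.
    by rewrite (big_pred1 (Ordinal lt)).
  rewrite (exchange_big_dep predT) //=; apply: eq_bigr => a _.
  by rewrite hE -sum1_card; apply: eq_bigl => F; rewrite !inE.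
rewrite -(big_mkord xpredT h).
rewrite (@big_cat_nat _ _ _ (d./2.+1)) //=; last by lia.
rewrite -!sum_bin_diag; apply: leq_add.
  by rewrite big_mkord; apply: leq_sum => a _; apply: hvec_le; have := ltn_ord a; lia.
(* Entries above d/2 are bounded through their mirror images [h (d - a)]. *)
rewrite big_nat_rev /= -{1}(add0n d./2.+1) big_addn big_mkord.
have -> : d.+1 - d./2.+1 = d.-1./2.+1 by lia.
apply: leq_sum => a _; have := ltn_ord a => alt.
rewrite (_ : d./2.+1 + d.+1 - (a + d./2.+1).+1 = d - a); last by lia.
by rewrite -hvec_sym ?hvec_le; lia.
Qed.

End UpperBound.

(** * Subword complexes of a central longest element *)

Section SubwordComplex.
Local Open Scope group_scope.
Variables (gT : finGroupType) (G : {group gT}) (V : finType) (s : V -> gT).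
Variables (len : gT -> nat) (w0 : gT).
Hypothesis sG : forall p, s p \in G.
Hypothesis len1 : len 1 = 0%N.
Hypothesis len_s : forall p w, w \in G ->
  len (s p * w) = (len w).+1 \/ len w = (len (s p * w)).+1.
Hypothesis w0G : w0 \in G.
Hypothesis w0C : forall w, w \in G -> w0 * w = w * w0.
Hypothesis w0V : w0^-1 = w0.
Hypothesis sV : forall p, (s p)^-1 = s p.
Hypothesis len_w0 : forall w, w \in G -> (len (w * w0) + len w)%N = len w0.

Definition ascent (w : gT) p : bool := len w < len (s p * w).
Definition wprod (w : gT) (x : seq V) : gT := foldl (fun w p => s p * w) w x.
Definition demazure (w : gT) (x : seq V) : gT :=
  foldl (fun w p => if ascent w p then s p * w else w) w x.

Hypothesis demazure_w0 : forall x y, subseq x y ->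
  wprod 1 x = w0 -> size x = len w0 -> demazure 1 y = w0.

Lemma wprod_in w x : w \in G -> wprod w x \in G.
Proof. by elim: x w => //= p x IH w wG; apply: IH; rewrite groupM. Qed.

Lemma wprod_rcons w x p : wprod w (rcons x p) = s p * wprod w x.
Proof. by rewrite /wprod -cats1 foldl_cat. Qed.

Lemma wprodE w x : wprod w x = wprod 1 x * w.
Proof. by elim/last_ind: x => [|x p IH]; rewrite ?mul1g // !wprod_rcons IH mulgA. Qed.

Lemma wprod_cat x y : wprod 1 (x ++ y) = wprod 1 y * wprod 1 x.
Proof. by rewrite {1}/wprod foldl_cat -/(wprod _ y) wprodE. Qed.

Lemma wprod_rev x : wprod 1 (rev x) = (wprod 1 x)^-1.
Proof.
elim/last_ind: x => [|x p IH]; first by rewrite invg1.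
rewrite rev_rcons -cat1s wprod_cat IH wprod_rcons invMg sV.
by rewrite /wprod /= mulg1.
Qed.

(** The rotated product is a conjugate of [w0], which is central. *)
Lemma wprod_rotate x y : wprod 1 (x ++ y) = w0 -> wprod 1 (y ++ x) = w0.
Proof.
have xG := wprod_in x (group1 G); rewrite !wprod_cat => e.
have -> : wprod 1 y = w0 * (wprod 1 x)^-1 by rewrite -e mulgK.
by rewrite w0C ?groupV // mulgA mulgV mul1g.
Qed.

Lemma len_wprod x w : w \in G -> len (wprod w x) <= len w + size x.
Proof.
elim: x w => [|p x IH] w wG /=; first by rewrite addn0.
apply: leq_trans (IH _ (groupM (sG p) wG)) _.
by case: (len_s p wG); lia.
Qed.

(** Each letter changes the length by one and there are only [len w0] letters, so a single descent
    would leave the product too short. *)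
Lemma ascent_reduced x p y : wprod 1 (x ++ p :: y) = w0 ->
  size (x ++ p :: y) = len w0 -> ascent (wprod 1 x) p.
Proof.
have xG := wprod_in x (group1 G); rewrite size_cat /= => e sz.
have := len_wprod x (group1 G); rewrite len1 => l1.
have h : len w0 <= len (s p * wprod 1 x) + size y.
  rewrite -e -cat1s catA wprod_cat -wprodE wprod_cat [wprod 1 [:: p]]/wprod /= mulg1.
  by apply: len_wprod; rewrite groupM.
move: (len_s p xG) l1 h sz; rewrite /ascent.
by set a := len (wprod _ _); set b := len (s p * _); lia.
Qed.

Lemma len_le_w0 w : w \in G -> len w <= len w0.
Proof. by move/len_w0; lia. Qed.

Section Order.
Variable o : seq V.
Hypothesis o_uniq : uniq o.
Hypothesis o_all : forall p, p \in o.
Implicit Types (I J F : {set V}).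

Definition word I := [seq p <- o | p \in I].
Definition state I p := wprod 1 [seq q <- take (index p o) o | q \in I].
Definition asc_set F := [set p in F | ascent (state (~: F) p) p].
Definition reduced_w0 I := (#|I| == len w0) && (wprod 1 (word I) == w0).

Let take_split x p y : o = x ++ p :: y -> take (index p o) o = x.
Proof.
move=> oE; have px : p \notin x.
  by move: o_uniq; rewrite oE cat_uniq => /and3P[_ /hasPn/(_ p)]; rewrite mem_head => /(_ isT).
by rewrite oE index_cat (negPf px) /= eqxx addn0 take_size_cat.
Qed.

Let split p : exists y, o = take (index p o) o ++ p :: y.
Proof.
exists (drop (index p o).+1 o).
rewrite -{2}(nth_index p (o_all p)) -drop_nth ?index_mem //.
by rewrite cat_take_drop.
Qed.

Let size_word I : size (word I) = #|I|.
Proof.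
rewrite /word cardE; apply: perm_size; apply: uniq_perm; rewrite ?(filter_uniq _ o_uniq) ?enum_uniq // => p.
by rewrite mem_filter mem_enum o_all andbT.
Qed.

(** [I] is the set of letters retained by the Demazure product of the word of [J]. The equation is
    not circular in effect: [state I p] only sees letters before [p]. *)
Definition greedy I J := forall p, (p \in I) = (p \in J) && ascent (state I p) p.

Lemma greedy_uniq I I' J : greedy I J -> greedy I' J -> I = I'.
Proof.
move=> gI gI'; suff H x y : o = x ++ y -> {in x, I =i I'}.
  by apply/setP=> p; apply: (H o [::]); rewrite ?cats0.
elim/last_ind: x y => [|x p IH] y // oE q.
have {}IH := IH (p :: y); rewrite cat_rcons in oE; have {}IH := IH oE.
rewrite mem_rcons inE => /orP[/eqP ->|/IH //].
rewrite gI gI' /state (take_split oE); congr (_ && ascent (wprod 1 _) p).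
by apply: eq_in_filter.
Qed.

Lemma greedy_exists J : exists I, [/\ greedy I J,
   wprod 1 (word I) = demazure 1 (word J) & #|I| = len (wprod 1 (word I))].
Proof.
suff H x y : o = x ++ y -> exists I : {set V},
    [/\ {subset I <= x}, {in x, forall p, (p \in I) = (p \in J) && ascent (state I p) p},
     wprod 1 [seq p <- x | p \in I] = demazure 1 [seq p <- x | p \in J] &
     #|I| = len (wprod 1 [seq p <- x | p \in I])].
  have [|I [_ h1 h2 h3]] := H o [::]; first by rewrite cats0.
  by exists I; split=> // p; apply: h1.
elim/last_ind: x y => [|x p IH] y oE.
  by exists set0; split=> // [p|]; rewrite ?inE //= cards0 len1.
rewrite cat_rcons in oE; have [I [sub spec dem sz]] := IH _ oE.
have px : p \notin x.
  by move: o_uniq; rewrite oE cat_uniq => /and3P[_ /hasPn/(_ p)]; rewrite mem_head => /(_ isT).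
have pI : p \notin I by apply: contra px => /sub.
have xG := wprod_in [seq p <- x | p \in I] (group1 G).
pose c := (p \in J) && ascent (wprod 1 [seq p <- x | p \in I]) p.
pose I' := if c then p |: I else I.
have II' q : q \in x -> (q \in I') = (q \in I).
  move=> qx; rewrite /I'; case: ifP => // _; rewrite !inE.
  by case: eqP => // qp; rewrite -qp qx in px.
have fx z : {subset z <= x} -> [seq q <- z | q \in I'] = [seq q <- z | q \in I].
  by move=> zx; apply: eq_in_filter => q /zx /II'.
have pI' : (p \in I') = c.
  by rewrite /I'; case: ifP => _; rewrite ?inE ?eqxx // (negPf pI).
exists I'; split.
- move=> q; rewrite /I' mem_rcons inE; case: ifP => _; last by move/sub => ->; rewrite orbT.
  by rewrite !inE => /orP[->|/sub ->] //; rewrite orbT.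
- move=> q; rewrite mem_rcons inE => /orP[/eqP ->|qx].
    rewrite pI' /c /state (take_split oE) fx //.
  rewrite II' // spec // /state fx // => r.
  by rewrite oE index_cat qx take_cat index_mem qx => /mem_take.
- rewrite !filter_rcons fx // pI'; rewrite /c; case: (p \in J) => //=.
  rewrite [RHS]/demazure foldl_rcons -/(demazure _ _) -dem.
  by case: ifP => _; rewrite ?wprod_rcons.
rewrite filter_rcons fx // pI' /I'; case: ifP => // cT.
rewrite cardsU1 pI add1n wprod_rcons sz.
move: cT; rewrite /c /ascent => /andP[_].
by case: (len_s p xG) => -> // h; rewrite ltnNge leqnSn in h.
Qed.

(** Letters of [I] are ascents because its word is reduced; a letter of [J] outside [I] is no
    ascent, since those ascents avoid [J]. *)
Lemma greedy_reduced I J : I \subset J -> reduced_w0 I ->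
  asc_set (~: I) \subset ~: J -> greedy I J.
Proof.
move=> IJ /andP[/eqP sz /eqP e] sub p.
have [y oE] := split p.
case: (boolP (p \in I)) => pI.
  rewrite (subsetP IJ _ pI) /=; symmetry.
  have wE : word I = [seq q <- take (index p o) o | q \in I] ++ p :: [seq q <- y | q \in I].
    by rewrite /word {1}oE filter_cat /= pI.
  by apply: (@ascent_reduced _ p [seq q <- y | q \in I]); rewrite -wE // size_word.
symmetry; apply/negbTE; rewrite negb_and; apply/orP.
have := subsetP sub p; rewrite !inE setCK pI /= => h.
by case: (boolP (ascent _ _)) => a; [left; apply: h|right].
Qed.

(** The only facet F with [asc_set F] inside a face J and J inside F is the complement of the greedy
    selection from [~: J]. That selection spells [w0] by [demazure_w0]. *)
Lemma asc_set_partition :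
  partitions_faces [set F | reduced_w0 (~: F)] asc_set.
Proof.
split=> [F _|J]; first by apply/subsetP=> p; rewrite inE => /andP[].
have sub1 F : F \in [set F | reduced_w0 (~: F)] -> (asc_set F \subset J) && (J \subset F) ->
    greedy (~: F) (~: J).
  rewrite inE => rF /andP[aJ JF]; apply: greedy_reduced => //; first by rewrite setCS.
  by rewrite !setCK.
case: existsP => [[F /andP[]]|nF]; last first.
  apply: eq_card0 => F; rewrite inE; apply/negP=> /andP[FF /andP[_ JF]].
  by apply: nF; exists F; rewrite FF.
rewrite inE => /andP[/eqP szF /eqP eF] JF.
have [I [gI dI cI]] := greedy_exists (~: J).
have eI : wprod 1 (word I) = w0.
  rewrite dI; apply: demazure_w0 eF _; last by rewrite size_word.
  rewrite /word -(_ : [seq p <- [seq p <- o | p \in ~: J] | p \in ~: F] = [seq p <- o | p \in ~: F]).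
    exact: filter_subseq.
  rewrite -filter_predI; apply: eq_filter => p /=; rewrite !inE.
  by case: (boolP (p \in J)) => //= pJ; rewrite ?andbT // (subsetP JF).
have IJ : I \subset ~: J by apply/subsetP=> p; rewrite gI => /andP[].
rewrite (_ : [set F in _ | _] = [set ~: I]) ?cards1 //.
apply/setP=> F'; rewrite !inE; apply/andP/eqP => [[h1 h2]|->].
  by rewrite -[F']setCK; congr (~: _); apply: (greedy_uniq (sub1 F' _ h2) gI); rewrite inE.
rewrite setCK /reduced_w0 cI eI !eqxx /= subsetC IJ andbT; split=> //.
apply/subsetP=> p; rewrite !inE setCK => /andP[pI a]; move: pI; rewrite gI a andbT.
by rewrite inE negbK.
Qed.

(** Before a last letter outside the reduced word the product is already [w0], of maximal length. *)
Lemma last_not_asc v F : reduced_w0 (~: F) -> last v o = v -> v \notin asc_set F.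
Proof.
move=> /andP[/eqP szF /eqP eF] lv; rewrite inE; apply/negP=> /andP[vF].
have [y oE] := split v.
have y0 : y = [::].
  case/lastP: y oE => // y q oE; move: lv; rewrite oE -cat_rcons -rcons_cat last_rcons => qv.
  by move: o_uniq; rewrite oE cat_uniq /= mem_rcons inE qv eqxx !andbF.
suff -> : state (~: F) v = w0.
  by rewrite /ascent ltnNge len_le_w0 // groupM.
rewrite -eF /state /word [in RHS]oE y0 filter_cat /= inE vF cats0 //.
Qed.

End Order.

Lemma reduced_w0_rot o q I : reduced_w0 (rot q o) I = reduced_w0 o I.
Proof.
rewrite /reduced_w0 /word /rot; congr andb; rewrite -{3}(cat_take_drop q o) !filter_cat.
by apply/eqP/eqP => /wprod_rotate.
Qed.

Lemma reduced_w0_rev o I : reduced_w0 (rev o) I = reduced_w0 o I.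
Proof.
rewrite /reduced_w0 /word filter_rev wprod_rev; congr andb.
by rewrite -{1}w0V (inj_eq invg_inj).
Qed.

(** Let u and v be the products before and after [p], so that v u = w0. Reading backwards, the state
    is v^-1 = u w0, and multiplication by [w0] exchanges ascents and descents. *)
Lemma asc_set_rev o F : uniq o -> (forall p, p \in o) -> reduced_w0 o (~: F) ->
  asc_set (rev o) F = F :\: asc_set o F.
Proof.
move=> uo ao /andP[_ /eqP e]; apply/setP=> p; rewrite !inE; case: (boolP (p \in F)) => pF; rewrite ?andbF //= andbT.
pose x := take (index p o) o; pose y := drop (index p o).+1 o.
have oE : o = x ++ p :: y.
  by rewrite /x /y -{2}(nth_index p (ao p)) -drop_nth ?index_mem // cat_take_drop.
have px : p \notin x.
  by move: uo; rewrite oE cat_uniq => /and3P[_ /hasPn/(_ p)]; rewrite mem_head => /(_ isT).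
have py : p \notin y by move: uo; rewrite oE cat_uniq /= => /and4P[].
have sx : state o (~: F) p = wprod 1 [seq q <- x | q \in ~: F] by [].
have sy : state (rev o) (~: F) p = (wprod 1 [seq q <- y | q \in ~: F])^-1.
  rewrite /state oE rev_cat rev_cons -cats1 -catA /= index_cat mem_rev (negPf py) /= eqxx addn0.
  by rewrite take_size_cat // filter_rev wprod_rev.
have uG := wprod_in [seq q <- x | q \in ~: F] (group1 G).
have vG := wprod_in [seq q <- y | q \in ~: F] (group1 G).
have {}e : wprod 1 [seq q <- y | q \in ~: F] * wprod 1 [seq q <- x | q \in ~: F] = w0.
  by rewrite -wprod_cat -e /word [in RHS]oE filter_cat /= inE pF.
rewrite sx sy /ascent; move: uG vG e; set u := wprod _ _; set v := wprod _ _ => uG vG e.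
have -> : u = v^-1 * w0 by rewrite -e mulKg.
rewrite mulgA; have := len_w0 (groupVr vG); have := len_w0 (groupM (sG p) (groupVr vG)).
have := len_s p (groupVr vG).
set a := len v^-1; set b := len (s p * v^-1); set c := len (s p * v^-1 * w0).
by set c' := len (v^-1 * w0); lia.
Qed.

Lemma card_reduced_w0_le (o : seq V) D : uniq o -> (forall p, p \in o) ->
  #|V| = (D.+1 + (#|V| - len w0))%N -> (0 < #|V| - len w0)%N ->
  (#|[set F | reduced_w0 o (~: F)]| <=
    'C(D.+1 + (#|V| - len w0)./2, D.+1) + 'C(D.+1 + (#|V| - len w0).-1./2, D.+1))%N.
Proof.
move=> uo ao cV d0.
apply: (@card_facets_le V (#|V| - len w0) _ _ (asc_set o)) => //.
- by move=> F; rewrite inE => /andP[/eqP <- _]; have := cardsC F; lia.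
- exact: asc_set_partition.
- have part : partitions_faces [set F | reduced_w0 o (~: F)] (asc_set (rev o)).
    have -> : [set F | reduced_w0 o (~: F)] = [set F | reduced_w0 (rev o) (~: F)].
      by apply/setP=> F; rewrite !inE reduced_w0_rev.
    by apply: asc_set_partition => [|p]; rewrite ?rev_uniq ?mem_rev.
  have E F : F \in [set F | reduced_w0 o (~: F)] -> F :\: asc_set o F = asc_set (rev o) F.
    by rewrite inE => rF; rewrite asc_set_rev.
  split=> [F FF|J]; first exact: subsetDl.
  rewrite -part.2; apply: eq_card => F; rewrite [LHS]inE [RHS]inE.
  by case: (boolP (F \in _)) => //= FF; rewrite E.
(* Rotating just past [v] makes it the last letter, so [last_not_asc] applies. *)
move=> v; pose q := (index v o).+1; exists (asc_set (rot q o)).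
  have -> : [set F | reduced_w0 o (~: F)] = [set F | reduced_w0 (rot q o) (~: F)].
    by apply/setP=> F; rewrite !inE reduced_w0_rot.
  by apply: asc_set_partition => [|p]; rewrite ?rot_uniq ?mem_rot.
move=> F; rewrite inE => rF; apply: last_not_asc; rewrite ?rot_uniq ?reduced_w0_rot //.
  by move=> p; rewrite mem_rot.
rewrite /rot /q (take_nth v) ?index_mem // last_cat last_rcons nth_index //.
Qed.

End SubwordComplex.

(** * The hyperoctahedral group *)

Local Open Scope nat_scope.

Section DoubleSwap.
Variables c e : nat.
Hypothesis ce : c <= e.
Hypothesis ceS : e <> c.+1.

(** For [c = e] the last two tests never succeed and this is one transposition, so a single formula
    covers the middle generator and the mirrored pairs of transpositions. *)
Definition swap2 (z : nat) : nat :=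
  if z == c then c.+1 else if z == c.+1 then c
  else if z == e then e.+1 else if z == e.+1 then e else z.

Variant swap2_spec (z : nat) : nat -> Prop :=
| Swap1 of z = c : swap2_spec z c.+1
| Swap2 of z = c.+1 : swap2_spec z c
| Swap3 of z = e & z <> c : swap2_spec z e.+1
| Swap4 of z = e.+1 & z <> c.+1 : swap2_spec z e
| Swap0 of z <> c & z <> c.+1 & z <> e & z <> e.+1 : swap2_spec z z.

Lemma swap2P z : swap2_spec z (swap2 z).
Proof. by rewrite /swap2; do 4 (case: (z =P _) => ?; first by constructor); constructor. Qed.

Lemma swap2K : involutive swap2.
Proof.
move=> z; case: (swap2P z) => [->|->|-> ?|-> ?|????]; case: swap2P; move: ce ceS; lia.
Qed.

Lemma swap2_mono x y : ~ (x = c /\ y = c.+1) -> ~ (x = c.+1 /\ y = c) ->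
  ~ (x = e /\ y = e.+1) -> ~ (x = e.+1 /\ y = e) ->
  x < y -> swap2 x < swap2 y.
Proof.
move: ce ceS => ce' ceS'.
by case: (swap2P x) => *; case: (swap2P y) => *; lia.
Qed.

Lemma swap2_c : swap2 c = c.+1. Proof. by rewrite /swap2 eqxx. Qed.
Lemma swap2_cS : swap2 c.+1 = c.
Proof. by move: ce ceS => ? ?; case: swap2P; lia. Qed.
Lemma swap2_e : swap2 e = e.+1.
Proof. by move: ce ceS => ? ?; case: swap2P; lia. Qed.
Lemma swap2_eS : swap2 e.+1 = e.
Proof. by move: ce ceS => ? ?; case: swap2P; lia. Qed.

Lemma swap2_ltE x y : ~ (x = c /\ y = c.+1) -> ~ (x = c.+1 /\ y = c) ->
  ~ (x = e /\ y = e.+1) -> ~ (x = e.+1 /\ y = e) ->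
  (swap2 x < swap2 y) = (x < y).
Proof.
move=> h1 h2 h3 h4; apply/idP/idP; last exact: swap2_mono.
rewrite -{2}(swap2K x) -{2}(swap2K y); apply: swap2_mono.
- by case=> e1 e2; apply: h2; rewrite -(swap2K x) e1 -(swap2K y) e2 swap2_c swap2_cS.
- by case=> e1 e2; apply: h1; rewrite -(swap2K x) e1 -(swap2K y) e2 swap2_c swap2_cS.
- by case=> e1 e2; apply: h4; rewrite -(swap2K x) e1 -(swap2K y) e2 swap2_e swap2_eS.
- by case=> e1 e2; apply: h3; rewrite -(swap2K x) e1 -(swap2K y) e2 swap2_e swap2_eS.
Qed.

End DoubleSwap.

Section TypeB.
Variable m : nat.
Local Notation P := 'I_(2 * m).
Local Notation W := {perm P}.
Implicit Types (w : W) (x y : P).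

(** Positions x and 2m - 1 - x are opposite. Generator [i] exchanges the neighbours at the gaps m -
    i and m + i, which coincide for i = 0. *)
Definition gen_fun (i : nat) : nat -> nat := swap2 (m - i.+1) (m + i - 1).

Lemma gen_fun_cond i : i < m -> m - i.+1 <= m + i - 1 /\ m + i - 1 <> (m - i.+1).+1.
Proof. lia. Qed.

Lemma gen_fun_lt i (x : nat) : i < m -> x < 2 * m -> gen_fun i x < 2 * m.
Proof. by rewrite /gen_fun; case: swap2P; lia. Qed.

Lemma gen_funK i (x : nat) : i < m -> gen_fun i (gen_fun i x) = x.
Proof. by move=> im; have [? ?] := gen_fun_cond im; apply: swap2K. Qed.

Lemma gen_fun_rev i (x : nat) : i < m -> x < 2 * m ->
  gen_fun i (2 * m - x.+1) = 2 * m - (gen_fun i x).+1.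
Proof.
rewrite /gen_fun => im xm.
have [c [cm ->]] : exists c, m = c + i.+1 /\ m - i.+1 = c by exists (m - i.+1); lia.
have -> : m + i - 1 = c + 2 * i by lia.
by case: (swap2P _ _ x) => [->|->|-> ?|-> ?|????]; case: swap2P; lia.
Qed.

Definition gen_ord (i : 'I_m) (x : P) : P := Ordinal (gen_fun_lt (ltn_ord i) (ltn_ord x)).

Lemma gen_ordK i : involutive (gen_ord i).
Proof. by move=> x; apply: val_inj; apply: gen_funK. Qed.

Definition gen (i : 'I_m) : W := perm (inv_inj (gen_ordK i)).
Definition w0B : W := perm (@rev_ord_inj (2 * m)).
(** Commuting with the reversal is w(-x) = -w(x) in disguise: this is the hyperoctahedral group. *)
Definition signed : {group W} := 'C[w0B]%G.

Lemma genE i x : gen i x = gen_fun i x :> nat.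
Proof. by rewrite permE. Qed.

Lemma w0BE x : w0B x = 2 * m - x.+1 :> nat.
Proof. by rewrite permE. Qed.

Lemma signedP w : reflect (forall x, w (rev_ord x) = rev_ord (w x)) (w \in signed).
Proof.
apply: (iffP cent1P) => [/permP h x|h]; last by apply/permP=> x; rewrite !permM !permE h.
by have := h x; rewrite !permM !permE.
Qed.

Lemma gen_signed i : gen i \in signed.
Proof. by apply/signedP => x; apply: val_inj; rewrite /= !genE /= gen_fun_rev. Qed.

Lemma w0B_signed : w0B \in signed.
Proof. by rewrite cent1id. Qed.

Lemma w0B_central w : w \in signed -> (w0B * w = w * w0B)%g.
Proof. by move/cent1P. Qed.

Lemma w0BV : (w0B^-1)%g = w0B.
Proof.
apply/eqP; rewrite eq_invg_mul; apply/eqP/permP=> x.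
by rewrite permM !permE rev_ordK.
Qed.

Lemma genV i : ((gen i)^-1)%g = gen i.
Proof.
apply/eqP; rewrite eq_invg_mul; apply/eqP/permP=> x.
by rewrite permM !permE gen_ordK.
Qed.

(* A pair and its mirror image under x |-> 2m - 1 - x carry the same reflection
   of B_m; the self-mirrored pairs are counted twice, so that every reflection
   has total weight 2. *)
Definition pair_wt (p : P * P) : nat := (p.1 < p.2) + ((p.1 < p.2) && (p.1 + p.2 == (2 * m).-1)).
Definition inv2 w : nat := \sum_(p : P * P) (w p.2 < w p.1) * pair_wt p.
Definition lenB w : nat := (inv2 w)./2.

Definition mirror (p : P * P) : P * P := (rev_ord p.2, rev_ord p.1).

Lemma mirrorK : involutive mirror.
Proof. by case=> x y; rewrite /mirror /= !rev_ordK. Qed.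

Lemma pair_wt_mirror p : pair_wt (mirror p) = pair_wt p.
Proof.
case: p => x y; rewrite /pair_wt /=; have := ltn_ord x; have := ltn_ord y => hy hx.
lia.
Qed.

(** Pairs with sum below 2m - 1 are matched by [mirror] with those above, with equal contributions;
    the self-mirrored pairs have weight 2. *)
Lemma inv2_even w : w \in signed -> ~~ odd (inv2 w).
Proof.
move=> /signedP ws; pose F p := (w p.2 < w p.1) * pair_wt p.
have FM p : F (mirror p) = F p.
  rewrite /F pair_wt_mirror /mirror /= !ws /=; congr (nat_of_bool _ * _).
  by have := ltn_ord (w p.1); have := ltn_ord (w p.2); lia.
have -> : inv2 w = \sum_p F p by [].
rewrite (bigID (fun p : P * P => p.1 + p.2 < (2 * m).-1)) /=.
rewrite [X in odd (_ + X)](bigID (fun p : P * P => p.1 + p.2 == (2 * m).-1)) /=.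
set a := \sum_(p | _) F p.
have -> : \sum_(p : P * P | ~~ (p.1 + p.2 < (2 * m).-1) && (p.1 + p.2 != (2 * m).-1)) F p = a.
  rewrite (reindex_inj (inv_inj mirrorK)) /a; apply: eq_big => [p|p _]; last exact: FM.
  by have := ltn_ord p.1; have := ltn_ord p.2 => h1 h2 /=; lia.
rewrite addnC -addnA addnn oddD odd_double addbF.
rewrite (eq_bigr (fun p => 2 * ((w p.2 < w p.1) * (p.1 < p.2)))); last first.
  by move=> p /andP[_ /eqP e]; rewrite /F /pair_wt e eqxx andbT addnn -mul2n mulnCA.
by rewrite -big_distrr /= oddM.
Qed.

Section Step.
Variable i : 'I_m.
Let im : i < m := ltn_ord i.
Fact lo_proof : m - i.+1 < 2 * m. Proof. have := im; lia. Qed.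
Fact hi_proof : m - i < 2 * m. Proof. have := im; lia. Qed.
Definition lo : P := Ordinal lo_proof.
Definition hi : P := Ordinal hi_proof.

(** The order of a pair changes only when the generator exchanges its members. For i = 0 the pair
    [(lo, hi)] is its own mirror, and the two corrections add up to its weight 2. *)
Lemma pair_wt_gen (p : P * P) :
  pair_wt (gen i p.1, gen i p.2) + ((p == (lo, hi)) + (p == mirror (lo, hi))) =
  pair_wt p + ((p == (hi, lo)) + (p == mirror (hi, lo))).
Proof.
move: (im) => im'; case: p => x y.
have -> : pair_wt (gen i (x, y).1, gen i (x, y).2) =
    (gen_fun i x < gen_fun i y) + ((gen_fun i x < gen_fun i y) && (x + y == (2 * m).-1)).
  rewrite /pair_wt /= !genE; congr (_ + nat_of_bool (_ && _)).
  have -> : (x + y == (2 * m).-1) = (y == rev_ord x).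
    by rewrite -val_eqE /=; have := ltn_ord x; have := ltn_ord y; lia.
  rewrite -(inj_eq (@perm_inj _ (gen i))) (signedP _ (gen_signed i)) -val_eqE /= !genE.
  by have := gen_fun_lt im (ltn_ord x); have := gen_fun_lt im (ltn_ord y); lia.
rewrite /pair_wt /mirror /= !xpair_eqE -!val_eqE /=.
move: (x : nat) (y : nat) => {}x {}y.
have [] := gen_fun_cond im'; rewrite /gen_fun.
have -> : 2 * m - (m - i).+1 = m + i - 1 by lia.
have -> : 2 * m - (m - i.+1).+1 = (m + i - 1).+1 by lia.
have -> : m - i = (m - i.+1).+1 by lia.
have : (m + i - 1) + (m - i.+1).+1 = (2 * m).-1 by lia.
move: (m - i.+1) (m + i - 1) (2 * m).-1 => c e M eM ce ceS.
case: (boolP ((x == c) && (y == c.+1))) => [/andP[/eqP-> /eqP->]|h1].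
  by rewrite swap2_c swap2_cS //; lia.
case: (boolP ((x == c.+1) && (y == c))) => [/andP[/eqP-> /eqP->]|h2].
  by rewrite swap2_c swap2_cS //; lia.
case: (boolP ((x == e) && (y == e.+1))) => [/andP[/eqP ex /eqP ey]|h3].
  by subst x y; rewrite swap2_e // swap2_eS //; lia.
case: (boolP ((x == e.+1) && (y == e))) => [/andP[/eqP ex /eqP ey]|h4].
  by subst x y; rewrite swap2_e // swap2_eS //; lia.
rewrite swap2_ltE //.
- by case=> e1 e2; rewrite e1 e2 !eqxx in h1.
- by case=> e1 e2; rewrite e1 e2 !eqxx in h2.
- by case=> e1 e2; rewrite e1 e2 !eqxx in h3.
- by case=> e1 e2; rewrite e1 e2 !eqxx in h4.
Qed.

Lemma inv2_gen w : w \in signed ->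
  inv2 (gen i * w) + 2 * (w hi < w lo) = inv2 w + 2 * (w lo < w hi).
Proof.
move=> /signedP ws.
pose F (p : P * P) : nat := w p.2 < w p.1.
pose sp (p : P * P) := (gen i p.1, gen i p.2).
have spK : involutive sp.
  by move=> [x y]; rewrite /sp /= !permE !gen_ordK.
have FM p : F (mirror p) = F p.
  rewrite /F /mirror /= !ws /=; congr nat_of_bool.
  by have := ltn_ord (w p.1); have := ltn_ord (w p.2); lia.
have -> : inv2 (gen i * w) = \sum_p F p * pair_wt (sp p).
  rewrite /inv2 (reindex_inj (inv_inj spK)); apply: eq_bigr => -[x y] _ /=.
  by rewrite /F !permM !permE !gen_ordK.
have S q : \sum_p F p * (p == q) = F q.
  by rewrite (bigD1 q) //= eqxx muln1 big1 ?addn0 // => p /negPf ->; rewrite muln0.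
have e1 : \sum_p F p * ((p == (lo, hi)) + (p == mirror (lo, hi))) = 2 * (w hi < w lo).
  under eq_bigr => p _ do rewrite mulnDr.
  by rewrite big_split /= !S FM addnn -mul2n.
have e2 : \sum_p F p * ((p == (hi, lo)) + (p == mirror (hi, lo))) = 2 * (w lo < w hi).
  under eq_bigr => p _ do rewrite mulnDr.
  by rewrite big_split /= !S FM addnn -mul2n.
rewrite -e1 -e2 /inv2 -!big_split /=; apply: eq_bigr => p _.
by rewrite -!mulnDr pair_wt_gen.
Qed.

Lemma lo_neq_hi : lo != hi.
Proof. by rewrite -val_eqE /=; have := im; lia. Qed.

Lemma w_lo_hi w : (w lo < w hi) || (w hi < w lo).
Proof.
have : w lo != w hi by rewrite (inj_eq perm_inj) lo_neq_hi.
by rewrite -val_eqE /= neq_ltn.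
Qed.

Lemma lenB_gen w : w \in signed ->
  lenB (gen i * w) = (lenB w).+1 \/ lenB w = (lenB (gen i * w)).+1.
Proof.
move=> ws; have := inv2_gen ws; have := w_lo_hi w.
by case: (ltngtP (w lo) (w hi)) => //=; rewrite /lenB; lia.
Qed.

Lemma ascentB w : w \in signed -> (lenB w < lenB (gen i * w)) = (w lo < w hi).
Proof.
move=> ws; have := inv2_gen ws; have := w_lo_hi w.
case: (ltngtP (w lo) (w hi)) => //=; rewrite /lenB; lia.
Qed.
End Step.

Lemma inv2_w0 w : inv2 (w * w0B) + inv2 w = \sum_p pair_wt p.
Proof.
rewrite -big_split /=; apply: eq_bigr => -[x y] _; rewrite /= !permM -mulnDl /= !w0BE.
case: (ltnP x y) => [xy|yx]; last by rewrite /pair_wt /= (ltnNge x) yx muln0.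
have : w x != w y by rewrite (inj_eq perm_inj) -val_eqE neq_ltn xy.
rewrite -val_eqE /=; have := ltn_ord (w x); have := ltn_ord (w y) => h1 h2 h3.
by rewrite (_ : _ + _ = 1) ?mul1n //; lia.
Qed.

Lemma inv2_1 : inv2 1 = 0.
Proof.
rewrite /inv2 big1 // => -[x y] _; rewrite !perm1 /pair_wt /=.
by case: ltnP => //; case: ltnP; lia.
Qed.

Lemma inv2_max : inv2 w0B = \sum_p pair_wt p.
Proof. by have := inv2_w0 1; rewrite mul1g inv2_1 addn0. Qed.

Lemma lenB_w0 w : w \in signed -> lenB (w * w0B) + lenB w = lenB w0B.
Proof.
move=> ws; have := inv2_w0 w; rewrite -inv2_max /lenB.
by have := inv2_even ws; have := inv2_even w0B_signed; lia.
Qed.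

Lemma lenB_1 : lenB 1 = 0.
Proof. by rewrite /lenB inv2_1. Qed.

Lemma lenB_w0E : lenB w0B = m ^ 2.
Proof.
suff : inv2 w0B = (m ^ 2).*2 by rewrite /lenB => ->; rewrite doubleK.
rewrite inv2_max -(pair_big xpredT xpredT (fun x y : P => pair_wt (x, y))) /=.
rewrite exchange_big /=.
(* There are y elements below [y], and the mirror of [y] is among them precisely when m <= y. *)
have E (y : P) : \sum_(x : P) pair_wt (x, y) = y + (m <= y).
  rewrite /pair_wt big_split /=; congr addn.
    rewrite -(big_mkord xpredT (fun x : nat => (x < y) : nat)) (@big_cat_nat _ _ _ y) //=; last by rewrite ltnW.
    rewrite (eq_big_nat _ _ (F2 := fun=> 1)) ?sum_nat_const_nat; last by move=> x /andP[_ ->].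
    rewrite (eq_big_nat _ _ (F2 := fun=> 0)) ?sum_nat_const_nat ?muln0; first by lia.
    by move=> x /andP[h _]; rewrite ltnNge h.
  case: leqP => my.
    rewrite (bigD1 (rev_ord y)) //= big1 => [|x].
      by have := ltn_ord y; lia.
    by rewrite -val_eqE /=; have := ltn_ord x; have := ltn_ord y; lia.
  by rewrite big1 // => x _; have := ltn_ord x; lia.
rewrite (eq_bigr _ (fun y _ => E y)) -(big_mkord xpredT (fun y : nat => y + (m <= y))) big_split /=.
rewrite bin2_sum bin2 (@big_cat_nat _ _ _ m 0 (2 * m)) //=; last by lia.
rewrite (eq_big_nat _ _ (F2 := fun=> 0)) ?sum_nat_const_nat ?muln0; last first.
  by move=> y /andP[_ h]; rewrite leqNgt h.
rewrite (eq_big_nat _ _ (F2 := fun=> 1)) ?sum_nat_const_nat; last first.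
  by move=> y /andP[-> _].
rewrite -mulnn; case: m => // p.
have -> : 2 * p.+1 * (2 * p.+1).-1 = (p.+1 * (2 * p.+1).-1).*2 by rewrite -mul2n mulnA.
by rewrite doubleK; nia.
Qed.

(** The rank function of Bruhat order at value [j] and gap [g]. It decreases along Demazure steps,
    from min(j, g) at the identity to 0 on the antidiagonal at [w0B]. *)
Definition prof w (j g : nat) : nat := \sum_(x : P) ((x < g) && (w x < j)).

Lemma prof_S w j x : prof w j x.+1 = prof w j x + (w x < j).
Proof.
rewrite /prof (bigD1 x) //= ltnSn [in RHS](bigD1 x) //= ltnn add0n addnC; congr addn.
by apply: eq_bigr => y; rewrite -val_eqE /= => yx; congr (nat_of_bool (_ && _)); lia.
Qed.

Lemma prof_0 w j : prof w j 0 = 0.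
Proof. by rewrite /prof big1. Qed.

Lemma prof_gen (i : 'I_m) w j g : g <> m - i -> g <> m + i -> prof (gen i * w) j g = prof w j g.
Proof.
move=> g1 g2; rewrite /prof (reindex_inj (@perm_inj _ (gen i))) /=.
apply: eq_bigr => x _; rewrite permM !permE gen_ordK; congr (nat_of_bool (_ && _)).
rewrite /= /gen_fun; have := ltn_ord i; case: swap2P; lia.
Qed.

Lemma w_lo_hi_mirror i w : w \in signed ->
  (w (rev_ord (hi i)) < w (rev_ord (lo i))) = (w (lo i) < w (hi i)).
Proof.
move/signedP=> ws; rewrite !ws /=.
by have := ltn_ord (w (lo i)); have := ltn_ord (w (hi i)); lia.
Qed.

Definition demB w (i : 'I_m) : W := if lenB w < lenB (gen i * w) then (gen i * w)%g else w.

Lemma demB_signed w i : w \in signed -> demB w i \in signed.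
Proof. by rewrite /demB; case: ifP => // _ ws; rewrite groupM ?gen_signed. Qed.

(** Whether or not the step is an ascent, the larger of the two values ends at [x]. So the count up
    to the gap exceeds [prof w j x] by one exactly when both values are below [j], which is what the
    maximum expresses. *)
Lemma prof_demB_gap i w j x y : w \in signed -> y = x.+1 :> nat ->
  gen i x = y -> gen i y = x -> (w x < w y) = (w (lo i) < w (hi i)) ->
  y = m - i :> nat \/ y = m + i :> nat ->
  prof (demB w i) j y = maxn (prof w j x) (prof w j y.+1).-1.
Proof.
move=> ws yx gx gy asc spec.
have wxy : w x != w y :> nat by rewrite val_eqE (inj_eq perm_inj) -val_eqE /= yx neq_ltn ltnSn.
rewrite !prof_S yx !prof_S /demB ascentB // -asc; case: ltnP => h.
  rewrite permM gx prof_gen; last 2 first.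
  - by case: spec; have := ltn_ord i; lia.
  - by case: spec; have := ltn_ord i; lia.
  lia.
lia.
Qed.

(** The gap m + i is treated through the mirror image of [lo] and [hi]; for i = 0 both tests name
    the same gap. *)
Lemma prof_demB i w j g : w \in signed ->
  prof (demB w i) j g =
  if (g == m - i) || (g == m + i) then maxn (prof w j g.-1) (prof w j g.+1).-1
  else prof w j g.
Proof.
move=> ws; have im := ltn_ord i; case: ifP => [/orP[]/eqP ->|/negbT].
- have e1 : (m - i).-1 = lo i :> nat by rewrite /=; lia.
  rewrite e1 (_ : m - i = hi i :> nat) //; apply: prof_demB_gap => //=; try lia.
    by apply: ord_inj; rewrite genE /= /gen_fun swap2_c; lia.
  apply: ord_inj; rewrite genE /= /gen_fun; have [] := gen_fun_cond im.
  have -> : m - i = (m - i.+1).+1 by lia.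
  by move=> ? ?; rewrite swap2_cS.
- have e1 : (m + i).-1 = rev_ord (hi i) :> nat by rewrite /=; lia.
  have e2 : m + i = rev_ord (lo i) :> nat by rewrite /=; lia.
  have [c1 c2] := gen_fun_cond im.
  rewrite e1 {1 2}e2; apply: prof_demB_gap => //=.
  + lia.
  + apply: ord_inj; rewrite genE /= /gen_fun.
    have -> : 2 * m - (m - i).+1 = m + i - 1 by lia.
    by rewrite swap2_e //; lia.
  + apply: ord_inj; rewrite genE /= /gen_fun.
    have -> : 2 * m - (m - i.+1).+1 = (m + i - 1).+1 by lia.
    by rewrite swap2_eS //; lia.
  + exact: w_lo_hi_mirror.
  + by right; lia.
- rewrite negb_or /demB => /andP[/eqP h1 /eqP h2].
  by case: ifP => // _; rewrite prof_gen.
Qed.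

Definition prof_le w w' := forall j g, g <= 2 * m -> prof w j g <= prof w' j g.

(** The max-plus rule is monotone in both arguments; this plays the part of the lifting property of
    Bruhat order. *)
Lemma prof_demB_mono w w' i : w \in signed -> w' \in signed ->
  prof_le w w' -> prof_le (demB w i) (demB w' i).
Proof.
move=> ws ws' h j g gm; have im := ltn_ord i; rewrite !prof_demB //; case: ifP => [sp|_]; last exact: h.
have := h j g.-1; have := h j g.+1; move/orP: sp => [] /eqP; lia.
Qed.

Lemma prof_demB_le w i : w \in signed -> prof_le (demB w i) w.
Proof.
move=> ws j g gm; have im := ltn_ord i; rewrite prof_demB //; case: ifP => // sp.
have g0 : 0 < g by move/orP: sp => [] /eqP; lia.
have g2 : g < 2 * m by move/orP: sp => [] /eqP; lia.
have g1 : g.-1 < 2 * m by lia.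
have := prof_S w j (Ordinal g2); have := prof_S w j (Ordinal g1); rewrite /= prednK //; lia.
Qed.

Lemma prof1 j g : j <= 2 * m -> g <= 2 * m -> prof 1 j g = minn j g.
Proof.
move=> jm; elim: g => [|g IH] gm; first by rewrite prof_0 minn0.
have := prof_S 1 j (Ordinal gm); rewrite /= perm1 => ->; rewrite IH ?(ltnW gm) //=; lia.
Qed.

Lemma prof_top w j : j <= 2 * m -> prof w j (2 * m) = j.
Proof.
move=> jm; rewrite -[RHS](minn_idPl jm) -(prof1 jm (leqnn (2 * m))).
rewrite /prof [RHS](reindex_inj (@perm_inj _ w)) /=; apply: eq_bigr => x _.
by rewrite perm1 !ltn_ord.
Qed.

(** The hypothesis confines the values below [j] to the last [j] positions. Two consecutive [j]
    locate each value below [m]; commuting with the reversal gives the others. *)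
Lemma eq_w0B w : w \in signed -> (forall j, 0 < j <= m -> prof w j (2 * m - j) = 0) -> w = w0B.
Proof.
move=> /signedP ws h.
have sub j : j <= m -> [set x | w x < j] = [set x : P | 2 * m - j <= x].
  move=> jm; apply/eqP; rewrite eqEcard; apply/andP; split.
    apply/subsetP=> x; rewrite !inE => wx; rewrite leqNgt; apply/negP=> xj.
    have := h j; rewrite jm andbT => /(_ (leq_ltn_trans (leq0n _) wx)) /eqP.
    by rewrite sum_nat_eq0 => /forallP/(_ x); rewrite xj wx.
  have c1 : #|[set x | w x < j]| = #|[set x : P | x < j]|.
    rewrite -(card_imset _ (@perm_inj _ w)); apply: eq_card => y.
    apply/imsetP/idP => [[x]|]; rewrite !inE; first by move=> hx ->.
    by move=> yj; exists ((w^-1)%g y); rewrite ?inE permKV.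
  have c2 : #|[set x : P | 2 * m - j <= x]| = #|[set x : P | x < j]|.
    rewrite -(card_imset _ (@rev_ord_inj (2 * m))); apply: eq_card => y.
    apply/imsetP/idP => [[x]|]; rewrite !inE; first by move=> hx -> /=; have := ltn_ord x; lia.
    by move=> yj; exists (rev_ord y); rewrite ?inE ?rev_ordK //=; have := ltn_ord y; lia.
  by rewrite c1 c2.
have low x : w x < m -> w x = rev_ord x.
  move=> wm; apply: val_inj => /=; have xm := ltn_ord x.
  have := sub _ wm => /setP/(_ x); rewrite !inE ltnSn => /esym h1.
  have := sub _ (ltnW wm) => /setP/(_ x); rewrite !inE ltnn => /esym h2; lia.
apply/permP=> x; rewrite permE; case: (ltnP (w x) m) => wm; first exact: low.
rewrite -[LHS]rev_ordK; congr rev_ord.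
have := low (rev_ord x); rewrite ws rev_ordK; apply => /=.
by have := ltn_ord (w x); lia.
Qed.

Lemma prof_w0B j : prof w0B j (2 * m - j) = 0.
Proof. by rewrite /prof big1 // => x _; rewrite w0BE; have := ltn_ord x; lia. Qed.

Section Words.
Variables (V : finType) (idx : V -> 'I_m).
Let s v := gen (idx v).

Lemma demazure_signed w (x : seq V) : w \in signed -> demazure s lenB w x \in signed.
Proof. by elim: x w => //= p x IH w ws; apply: IH; apply: demB_signed. Qed.

(** A letter of [y] skipped by [x] only lowers [prof] on the left; a common letter preserves the
    comparison. *)
Lemma prof_demazure_subseq (x y : seq V) w w' : w \in signed -> w' \in signed ->
  subseq x y -> prof_le w w' -> prof_le (demazure s lenB w y) (demazure s lenB w' x).
Proof.
elim: y x w w' => [|p y IH] x w w' ws ws'; first by move/eqP=> ->.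
case: x => [|q x] /=.
  move=> _ h; apply: (IH [::]) => //; [exact: demB_signed|exact: sub0seq|].
  by move=> j g gm; apply: leq_trans (h j g gm); apply: prof_demB_le.
case: eqP => [->|_] sub h.
  by apply: IH => //; [apply: demB_signed|apply: demB_signed|apply: prof_demB_mono].
apply: (IH (q :: x)) => //; first exact: demB_signed.
by move=> j g gm; apply: leq_trans (h j g gm); apply: prof_demB_le.
Qed.

Lemma demazure_reduced (x : seq V) : wprod s 1 x = w0B -> size x = lenB w0B ->
  demazure s lenB 1 x = w0B.
Proof.
move=> e sz; rewrite -e.
suff H (y z : seq V) : x = y ++ z -> demazure s lenB 1 y = wprod s 1 y by rewrite (H x [::]) ?cats0.
elim/last_ind: y z => // y p IH z; rewrite cat_rcons => xE.
rewrite /demazure /wprod !foldl_rcons -/(demazure s lenB 1 y) -/(wprod s 1 y) (IH _ xE).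
have -> // : ascent s lenB (wprod s 1 y) p.
rewrite xE in e sz.
have sS q : s q \in signed by apply: gen_signed.
have sL q w : w \in signed -> lenB (s q * w)%g = (lenB w).+1 \/ lenB w = (lenB (s q * w)%g).+1.
  exact: lenB_gen.
exact: (ascent_reduced sS lenB_1 sL w0B_signed e sz).
Qed.

Lemma demazure_w0B (x y : seq V) : subseq x y -> wprod s 1 x = w0B -> size x = lenB w0B ->
  demazure s lenB 1 y = w0B.
Proof.
move=> sub e sz; apply: eq_w0B; first by rewrite demazure_signed ?group1.
move=> j /andP[j0 jm].
suff : prof (demazure s lenB 1 y) j (2 * m - j) <= prof w0B j (2 * m - j).
  by rewrite (prof_w0B j); lia.
rewrite -(demazure_reduced e sz).
by apply: prof_demazure_subseq; rewrite ?group1 //; lia.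
Qed.

Lemma card_reducedB_le (o : seq V) : uniq o -> (forall p, p \in o) ->
  0 < m -> m ^ 2 < #|V| ->
  #|[set F : {set V} | reduced_w0 s lenB w0B o (~: F)]| <=
    'C(m ^ 2 + (#|V| - m ^ 2)./2, m ^ 2) + 'C(m ^ 2 + (#|V| - m ^ 2).-1./2, m ^ 2).
Proof.
move=> uo ao m0 mV.
have DE : m ^ 2 = ((m ^ 2).-1).+1 by rewrite prednK // expn_gt0 m0.
rewrite -{2 5}lenB_w0E DE.
apply: (@card_reduced_w0_le _ signed V s lenB w0B) => //.
- by move=> p; apply: gen_signed.
- exact: lenB_1.
- by move=> p w; apply: lenB_gen.
- exact: w0B_signed.
- exact: w0B_central.
- exact: w0BV.
- by move=> p; apply: genV.
- exact: lenB_w0.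
- exact: demazure_w0B.
- by rewrite lenB_w0E -DE; lia.
- by rewrite lenB_w0E; lia.
Qed.
End Words.
End TypeB.

(** * Sorting networks and longest chains *)

Local Open Scope nat_scope.

Section LongestChain.
Variable b : nat -> nat -> bool.

(** The recurrence for longest common subsequences: the maximal length of a chain of cells of [b],
    increasing in both coordinates, in a [u] by [v] rectangle. The inner fixpoint is there because
    either argument may decrease alone. *)
Fixpoint lchain (u : nat) : nat -> nat :=
  match u with
  | 0 => fun=> 0
  | u'.+1 => fix lchainS (v : nat) : nat :=
      match v with
      | 0 => 0
      | v'.+1 => if b u' v' then (lchain u' v').+1 else maxn (lchain u' v'.+1) (lchainS v')
      end
  end.

Arguments lchain : simpl never.

Lemma lchain0l v : lchain 0 v = 0. Proof. by []. Qed.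
Lemma lchain0r u : lchain u 0 = 0. Proof. by case: u. Qed.
Lemma lchainSS u v : lchain u.+1 v.+1 =
  if b u v then (lchain u v).+1 else maxn (lchain u v.+1) (lchain u.+1 v).
Proof. by []. Qed.

(** A new row or column adds at most one, so taking a cell of [b] whenever there is one is
    optimal. *)
Lemma lchain_step u v :
  (lchain u v <= lchain u v.+1 <= (lchain u v).+1) && (lchain u v <= lchain u.+1 v <= (lchain u v).+1).
Proof.
have L1 w : lchain 1 w <= 1.
  by elim: w => // w IH; rewrite lchainSS !lchain0l max0n; case: ifP.
elim: u v => [|u IH] v; first by rewrite !lchain0l L1.
have V w : lchain u.+1 w <= lchain u.+1 w.+1 <= (lchain u.+1 w).+1.
  elim: w => [|w IHw]; first by rewrite lchainSS !lchain0r; have := IH 0; rewrite lchain0r; case: ifP; lia.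
  rewrite [lchain u.+1 w.+2]lchainSS; have := IH w; have := IH w.+1.
  by case: ifP => ?; lia.
rewrite V andTb; elim: v => [|v IHv]; first by rewrite !lchain0r.
by rewrite [lchain u.+2 v.+1]lchainSS; have := V v; case: ifP => ?; lia.
Qed.

Lemma lchain_min u v : lchain u v <= minn u v.
Proof.
elim: u v => [|u IH] v; first by rewrite min0n.
elim: v => [|v IHv]; first by rewrite lchain0r.
by rewrite lchainSS; have := IH v; have := IH v.+1; case: ifP => ?; lia.
Qed.

Lemma lchain_mono u u' v v' : u <= u' -> v <= v' -> lchain u v <= lchain u' v'.
Proof.
move=> uu vv; apply: (@leq_trans (lchain u' v)).
  elim: u' uu => [|w IH]; first by rewrite leqn0 => /eqP ->.
  rewrite leq_eqVlt => /orP[/eqP -> //|]; rewrite ltnS => /IH; have := lchain_step w v; lia.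
elim: v' vv => [|w IH]; first by rewrite leqn0 => /eqP ->.
rewrite leq_eqVlt => /orP[/eqP -> //|]; rewrite ltnS => /IH; have := lchain_step u' w; lia.
Qed.

Definition ltpair (p q : nat * nat) : bool := (p.1 < q.1) && (p.2 < q.2).

Lemma ltpair_trans : transitive ltpair.
Proof. by move=> y x z /andP[h1 h2] /andP[h3 h4]; rewrite /ltpair (ltn_trans h1) // (ltn_trans h2). Qed.

Definition chain_in (u v : nat) (s : seq (nat * nat)) : bool :=
  sorted ltpair s && all (fun p => [&& b p.1 p.2, p.1 < u & p.2 < v]) s.

Lemma chain_in_rcons u v s p : chain_in u v (rcons s p) =
  [&& chain_in p.1 p.2 s, b p.1 p.2, p.1 < u & p.2 < v].
Proof.
rewrite /chain_in all_rcons; apply/idP/idP => [/and3P[ss pb sb]|/andP[/andP[ss sb] pb]].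
  rewrite pb andbT; move: ss; rewrite -cats1 sorted_pairwise ?pairwise_cat; last exact: ltpair_trans.
  rewrite sorted_pairwise; last exact: ltpair_trans.
  move=> /and3P[/allrelP h1 -> _] /=; apply/allP=> q qs.
  have /andP[h3 h4] := h1 q p qs (mem_head _ _).
  by have /andP[-> _] := allP sb q qs; rewrite h3.
have /and3P[pb1 pb2 pb3] := pb; rewrite pb1 pb2 pb3 /=; apply/andP; split; last first.
  apply/allP=> q qs; have /and3P[-> h1 h2] := allP sb q qs.
  by rewrite (ltn_trans h1 pb2) (ltn_trans h2 pb3).
rewrite -cats1 sorted_pairwise ?pairwise_cat; last exact: ltpair_trans.
rewrite -(sorted_pairwise ltpair_trans) ss /= andbT; apply/allrelP => q r qs; rewrite inE => /eqP ->.
by have /and3P[_ h1 h2] := allP sb q qs; rewrite /ltpair h1.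
Qed.

Lemma chain_in_mono u u' v v' s : u <= u' -> v <= v' -> chain_in u v s -> chain_in u' v' s.
Proof.
move=> uu vv /andP[ss /allP sb]; rewrite /chain_in ss; apply/allP=> p /sb /and3P[-> h1 h2].
by rewrite (leq_trans h1) // (leq_trans h2).
Qed.

Lemma lchain_exists u v : exists2 s, chain_in u v s & size s = lchain u v.
Proof.
elim: u v => [|u IH] v; first by exists [::].
elim: v => [|v IHv]; first by exists [::].
rewrite lchainSS; case: ifP => [buv|_].
  have [s cs sz] := IH v; exists (rcons s (u, v)); last by rewrite size_rcons sz.
  by rewrite chain_in_rcons /= cs buv !ltnSn.
case: (leqP (lchain u.+1 v) (lchain u v.+1)) => _.
  by have [s cs sz] := IH v.+1; exists s => //; apply: chain_in_mono cs.
by have [s cs sz] := IHv; exists s => //; apply: chain_in_mono cs.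
Qed.

Lemma chain_in_le u v s : chain_in u v s -> size s <= lchain u v.
Proof.
elim/last_ind: s u v => [|s p IH] u v //; rewrite chain_in_rcons size_rcons.
case/and4P=> /IH h bp pu pv; apply: leq_trans (lchain_mono pu pv).
by rewrite lchainSS bp ltnS.
Qed.
End LongestChain.

Section Network.
Variables n k m : nat.
Hypothesis nE : n = m + k.
Hypothesis m0 : 0 < m.
Local Notation V := ('I_n * 'I_m)%type.
Variable A : nat -> nat -> bool.

(* The cell (x, y) of the strip stands for the segment {x, y}; short segments are
   treated as always present. *)
Definition inA (x y : nat) : bool :=
  if y - x <= n then A (x %% n) (y - x - k.+1) else A (y %% n) (2 * n - (y - x) - k.+1).

(** Window with cut j + k: cell (u, v) is the segment from u to v + j + k. In the rectangle [j + k]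
    by [2 * m + k - j] all left ends lie below the cut and all right ends between it and 2n. *)
Definition blocked (j u v : nat) : bool :=
  let L := v + j + k - u in [|| L <= k, 2 * n - k <= L | inA u (v + j + k)].

Definition letter (p : V) : 'I_m := rev_ord p.2.
(** Within a row [letter] runs from generator m - 1 down to 0, so this order spells the n-th power
    of a Coxeter element. *)
Definition rows : seq V := [seq (a, r) | a <- enum 'I_n, r <- enum 'I_m].
Definition gB (p : V) := gen (letter p).

Lemma rows_uniq : uniq rows.
Proof. by apply: allpairs_uniq; rewrite ?enum_uniq // => -[a r] [a' r']. Qed.

Lemma rows_all p : p \in rows.
Proof. by case: p => a r; apply/allpairsP; exists (a, r); rewrite !mem_enum. Qed.

Definition jumps j u v : nat := minn u v - lchain (blocked j) u v.

(* [cell a r g] : the last cell processed at gap [g] when rows [< a] and the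
   first [r] letters of row [a] are done. *)
Definition cell_u a r g := if g <= m then a + (g <= r) else a + (2 * m - g <= r) + m - g.
Definition cell_v j a r g := if g <= m then a + (g <= r) + g - j else a + (2 * m - g <= r) + m - j.

(** The loss of [prof] from its initial value min(j, g) is the amount by which the longest chain
    falls short of the trivial bound min(u, v). *)
Definition network_inv a r (w : {perm 'I_(2 * m)}) : Prop :=
  forall j g, 0 < j <= m -> 0 < g < 2 * m ->
    prof w j g + jumps j (cell_u a r g) (cell_v j a r g) = minn j g.

Lemma jumps0l j v : jumps j 0 v = 0. Proof. by rewrite /jumps min0n. Qed.
Lemma jumps0r j u : jumps j u 0 = 0. Proof. by rewrite /jumps minn0. Qed.

Lemma jumps_blocked j u v : blocked j u v -> jumps j u.+1 v.+1 = jumps j u v.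
Proof. by move=> h; rewrite /jumps lchainSS h minnSS subSS. Qed.

(** The cells on this diagonal have length k and are always blocked, so the chain along it is full.
    [jumps_high] is the opposite border, of length 2n - k. *)
Lemma jumps_low j q : jumps j q (q - j) = 0.
Proof.
elim: q => [|q IH]; first by rewrite jumps0l.
case: (ltnP q j) => qj; first by rewrite (_ : q.+1 - j = 0) ?jumps0r //; lia.
by rewrite subSn // jumps_blocked // /blocked; apply/orP; left; lia.
Qed.

Lemma jumps_high j q : j <= m -> jumps j (q - m) (q + m - j) = 0.
Proof.
move=> jm; elim: q => [|q IH]; first by rewrite jumps0l.
case: (ltnP q m) => qm; first by rewrite (_ : q.+1 - m = 0) ?jumps0l //; lia.
rewrite subSn // addSn subSn; last lia.
by rewrite jumps_blocked // /blocked; apply/orP; right; apply/orP; left; lia.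
Qed.

(** At a free cell the rule for [prof] and the recurrence of [lchain] take the same maximum over the
    neighbours at gaps g - 1 and g + 1. As v - u = g - j, comparing g with j tells which coordinate
    is the smaller. *)
Lemma jumps_free j u v g c1 c2 : ~~ blocked j u v -> v + j = u + g -> 0 < g ->
  c1 + jumps j u.+1 v = minn j g.-1 -> c2 + jumps j u v.+1 = minn j g.+1 ->
  maxn c1 c2.-1 + jumps j u.+1 v.+1 = minn j g.
Proof.
rewrite /jumps lchainSS => /negPf -> e g0.
have := lchain_min (blocked j) u.+1 v; have := lchain_min (blocked j) u v.+1.
move: (lchain _ _ _) (lchain _ _ _) => l1 l2 h1 h2.
have := subnK h1; have := subnK h2.
have h3 : maxn l1 l2 <= minn u.+1 v.+1 by lia.
have := subnK h3.
move: (minn u.+1 v.+1 - _) (minn u.+1 v - _) (minn u v.+1 - _) => d1 d2 d3.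
by case: (ltngtP g j) => gj; lia.
Qed.

Lemma network_inv_ext a r w j g : network_inv a r w -> 0 < j <= m -> g <= 2 * m ->
  prof w j g + jumps j (cell_u a r g) (cell_v j a r g) = minn j g.
Proof.
move=> inv jm gm; case: (posnP g) => [->|g0].
  rewrite prof_0 minn0 /cell_u /cell_v /= addn0 jumps_low //.
case: (ltngtP g (2 * m)) gm => // [gm _|-> _]; first by apply: inv; rewrite // g0.
rewrite prof_top ?(minn_idPl _); try lia.
rewrite /cell_u /cell_v (_ : (2 * m <= m) = false); last lia.
rewrite subnn leq0n (_ : a + true + m - 2 * m = a.+1 - m); last lia.
by rewrite (_ : a + true + m - j = a.+1 + m - j) ?jumps_high; lia.
Qed.

Lemma cell_unchanged a r j g : g <> r.+1 -> g <> 2 * m - r.+1 -> g < 2 * m ->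
  cell_u a r.+1 g = cell_u a r g /\ cell_v j a r.+1 g = cell_v j a r g.
Proof.
move=> h1 h2 h3; rewrite /cell_u /cell_v; case: ifP => _.
  by rewrite (_ : (g <= r.+1) = (g <= r)) //; lia.
by rewrite (_ : (2 * m - g <= r.+1) = (2 * m - g <= r)) //; lia.
Qed.

(** The cells around the gap r + 1; [cell_right] does the same for 2m - r - 1. When the two gaps
    coincide at m, this form is the one used. *)
Lemma cell_left a r j : r < m ->
  [/\ cell_u a r r = a.+1, cell_v j a r r = a.+1 + r - j,
      cell_u a r r.+1 = a, cell_v j a r r.+1 = a + r.+1 - j &
      [/\ cell_u a r.+1 r.+1 = a.+1, cell_v j a r.+1 r.+1 = a.+1 + r.+1 - j,
      cell_u a r r.+2 = a & cell_v j a r r.+2 = a + r.+2 - j]].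
Proof.
move=> rm; rewrite /cell_u /cell_v (ltnW rm) rm leqnn ltnn !addn0 !addn1 leqnn; split=> //; split; rewrite ?addn1 //.
  case: ifP => h; first by rewrite (_ : (r.+1 < r) = false) ?addn0 //; lia.
  rewrite (_ : 2 * m - r.+2 <= r = true); lia.
case: ifP => h; first by rewrite (_ : (r.+1 < r) = false) ?addn0 //; lia.
rewrite (_ : 2 * m - r.+2 <= r = true); lia.
Qed.

Lemma cell_right a r j g : r < m -> g = 2 * m - r.+1 -> m < g ->
  [/\ cell_u a r g.-1 = a + m.+1 - g, cell_v j a r g.-1 = a + m - j,
      cell_u a r g = a + m - g, cell_v j a r g = a + m - j &
      [/\ cell_u a r.+1 g = a + m.+1 - g, cell_v j a r.+1 g = a + m.+1 - j,
      cell_u a r g.+1 = a + m - g & cell_v j a r g.+1 = a + m.+1 - j]].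
Proof.
move=> rm gE gm; have e5 : (g < m) = false by lia.
rewrite /cell_u /cell_v (leqNgt g) gm /= e5.
have e1 : (2 * m - g <= r) = false by lia.
have e2 : (2 * m - g <= r.+1) = true by lia.
have e3 : (2 * m - g.+1 <= r) = true by lia.
have e4 : (2 * m - g.-1 <= r) = false by lia.
rewrite e1 e2 e3 e4; split; try (split); try lia.
  case: ifP => h; last lia.
  by rewrite (_ : (g.-1 <= r) = false); lia.
case: ifP => h; last lia.
by rewrite (_ : (g.-1 <= r) = false); lia.
Qed.

Lemma blocked_left j (a : nat) r : a < n -> r < m -> j <= a + r.+1 ->
  blocked j a (a + r.+1 - j) = A a r.
Proof.
move=> an rm tr.
rewrite /blocked /inA (_ : a + r.+1 - j + j + k = a + (r.+1 + k)); last lia.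
have e1 : (r.+1 + k <= k) = false by lia.
have e2 : (2 * n - k <= r.+1 + k) = false by lia.
have e3 : r.+1 + k <= n by lia.
have e4 : r.+1 + k - k.+1 = r by lia.
by rewrite addKn e1 e2 e3 e4 modn_small.
Qed.

(** The segment ends at a + n and is longer than n; it is the half turn of the segment of strip cell
    (a, r). *)
Lemma blocked_right j (a : nat) r g : a < n -> r < m -> j <= m -> g = 2 * m - r.+1 ->
  m < g -> g <= a + m -> blocked j (a + m - g) (a + m - j) = A a r.
Proof.
move=> an rm jm gE gm tr.
rewrite /blocked /inA (_ : a + m - j + j + k = a + n); last lia.
rewrite (_ : a + n - (a + m - g) = g + k); last lia.
have e1 : (g + k <= k) = false by lia.
have e2 : (2 * n - k <= g + k) = false by lia.
have e3 : (g + k <= n) = false by lia.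
have e4 : 2 * n - (g + k) - k.+1 = r by lia.
by rewrite e1 e2 e3 e4 modnDr modn_small.
Qed.

Lemma network_step (a : 'I_n) (r : 'I_m) w : w \in signed m -> network_inv a r w ->
  network_inv a r.+1 (if A a r then w else demB w (rev_ord r)).
Proof.
move=> ws inv j g jm gm.
have rm := ltn_ord r; have an := ltn_ord a; have [j0 jm'] := andP jm; have [g0 g2] := andP gm.
have ext g' := network_inv_ext inv jm (g := g').
have pE : prof (if A a r then w else demB w (rev_ord r)) j g =
   if ~~ A a r && ((g == r.+1) || (g == 2 * m - r.+1)) then maxn (prof w j g.-1) (prof w j g.+1).-1
   else prof w j g.
  case: (A a r) => //=; rewrite prof_demB //=.
  have -> : m - (m - r.+1) = r.+1 by clear -rm; lia.
  by have -> : m + (m - r.+1) = 2 * m - r.+1 by clear -rm; lia.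
rewrite {}pE; case: (boolP ((g == r.+1) || (g == 2 * m - r.+1))) => [sp|]; last first.
  rewrite negb_or andbF => /andP[/eqP h1 /eqP h2].
  by have [-> ->] := cell_unchanged a j h1 h2 g2; apply: inv.
rewrite andbT.
have := ext g.+1 g2; have := ext g (ltnW g2); have := ext g.-1 (leq_trans (leq_pred _) (ltnW g2)).
case: (leqP g m) => gm'.
  have gE : g = r.+1 by clear -sp gm' rm; lia.
  rewrite {}gE /=; have [-> -> -> -> [-> -> -> ->]] := cell_left a j rm.
  (* To the left of the window truncated subtraction sets every column coordinate to 0, and nothing
     has jumped yet. *)
  case: (ltnP (a + r.+1) j) => tr.
    have -> : a.+1 + r - j = 0 by clear -tr; lia.
    have -> : a + r.+1 - j = 0 by clear -tr; lia.
    have -> : a.+1 + r.+1 - j = 0 by clear -tr; lia.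
    have -> : a + r.+2 - j = 0 by clear -tr; lia.
    rewrite !jumps0r !addn0 => -> -> ->; case: (A a r) => //=.
    by clear -tr; lia.
  have <- := blocked_left an rm tr.
  rewrite (_ : a.+1 + r.+1 - j = (a + r.+1 - j).+1); last by clear -tr; lia.
  rewrite (_ : a.+1 + r - j = a + r.+1 - j); last by rewrite addSnnS.
  rewrite (_ : a + r.+2 - j = (a + r.+1 - j).+1); last by clear -tr; lia.
  case: (boolP (blocked _ _ _)) => /= [b1|nb] E1 E0 E2; first by rewrite jumps_blocked.
  apply: (@jumps_free j a _ r.+1 _ _ nb _ _ E1 E2) => //; clear -tr; lia.
have gE : g = 2 * m - r.+1 by clear -sp gm' rm; lia.
have [-> -> -> -> [-> -> -> ->]] := cell_right a j rm gE gm'.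
case: (ltnP (a + m) g) => tr.
  have -> : a + m.+1 - g = 0 by clear -tr; lia.
  have -> : a + m - g = 0 by clear -tr; lia.
  rewrite !jumps0l !addn0 => -> -> ->; case: (A a r) => //=.
  by clear -gm' jm'; lia.
have <- := blocked_right an rm jm' gE gm' tr.
rewrite (_ : a + m.+1 - j = (a + m - j).+1); last by clear -jm'; lia.
rewrite (_ : a + m.+1 - g = (a + m - g).+1); last by clear -tr; lia.
case: (boolP (blocked _ _ _)) => /= [b1|nb] E1 E0 E2; first by rewrite jumps_blocked.
apply: (@jumps_free j _ _ g _ _ nb _ _ E1 E2) => //; clear -tr jm'; lia.
Qed.

Lemma foldl_ord_ind (T : Type) N (f : T -> 'I_N -> T) (Q : nat -> T -> Prop) w :
  Q 0 w -> (forall (i : 'I_N) x, Q i x -> Q i.+1 (f x i)) -> Q N (foldl f w (enum 'I_N)).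
Proof.
move=> Q0 QS.
suff H s q x : map val s = iota q (size s) -> q + size s = N -> Q q x -> Q N (foldl f x s).
  by apply: (H _ 0) => //; rewrite ?val_enum_ord ?size_enum_ord.
elim: s q x => [|i s IH] q x /=; first by rewrite addn0 => _ ->.
case=> iq se qN Qx; apply: (IH q.+1) => //; first by rewrite addSnnS.
by rewrite -iq; apply: QS; rewrite iq.
Qed.

Definition keep : {set V} := [set p : V | ~~ A p.1 p.2].

Lemma demazure_filter (w : {perm 'I_(2 * m)}) (x : seq V) :
  demazure gB (@lenB m) w [seq p <- x | p \in keep] =
  foldl (fun w p => if A (val p.1) (val p.2) then w else demB w (letter p)) w x.
Proof.
elim: x w => //= p x IH w; rewrite inE; case: (boolP (A _ _)) => //= h; exact: IH.
Qed.

Lemma network_final :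
  network_inv n 0 (demazure gB (@lenB m) 1 [seq p <- rows | p \in keep]).
Proof.
rewrite demazure_filter.
pose f (w : {perm 'I_(2 * m)}) (p : V) := if A (val p.1) (val p.2) then w else demB w (letter p).
have -> : foldl f 1%g rows =
    foldl (fun w a => foldl (fun w r => f w (a, r)) w (enum 'I_m)) 1%g (enum 'I_n).
  rewrite /rows; elim: (enum 'I_n) (1%g : {perm 'I_(2 * m)}) => //= a s IH w.
  by rewrite foldl_cat IH; congr foldl; elim: (enum 'I_m) w => //= r t IHt w.
apply: (@proj2 (_ \in signed m)).
pose Q a w := w \in signed m /\ network_inv a 0 w.
apply: (@foldl_ord_ind _ n _ Q) => [|a w [ws inv]].
  split; first exact: group1.
  move=> j g /andP[j0 jm] /andP[g0 gm]; rewrite prof1; [|lia|exact: ltnW].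
  rewrite /cell_u /cell_v; case: (leqP g m) => gm'.
    by rewrite leqn0 (gtn_eqF g0) jumps0l addn0.
  have e1 : (2 * m - g <= 0) = false by clear -gm; lia.
  have e2 : 0 + false + m - g = 0 by clear -gm'; lia.
  by rewrite e1 e2 jumps0l addn0.
have [h1 h2] : (foldl (fun w r => f w (a, r)) w (enum 'I_m)) \in signed m /\
    network_inv a m (foldl (fun w r => f w (a, r)) w (enum 'I_m)).
  apply: (@foldl_ord_ind _ m _ (fun r w => w \in signed m /\ network_inv a r w)) => // r x [xs ix].
  split; last exact: network_step.
  by rewrite /f; case: ifP => // _; apply: demB_signed.
split=> // j g jm gm; rewrite -(h2 j g jm gm); have [g0 gm'] := andP gm.
have e1 : (g <= 0) = false by rewrite leqn0 (gtn_eqF g0).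
have e2 : (2 * m - g <= 0) = false by clear -gm'; lia.
rewrite /cell_u /cell_v e1 e2; case: (leqP g m) => gm1; first by rewrite addn0 addn1.
have -> : 2 * m - g <= m by clear -gm1; lia.
by rewrite addn0 addn1.
Qed.

(** After n rows the cell at gap 2m - j is the far corner of window j, where [network_inv] makes
    [prof] the longest chain minus k. By [eq_w0B] these values decide. *)
Lemma demazure_w0_iff :
  demazure gB (@lenB m) 1 [seq p <- rows | p \in keep] = w0B m <->
  forall j, 0 < j <= m -> lchain (blocked j) (j + k) (2 * m + k - j) <= k.
Proof.
have fin := network_final.
set w := demazure _ _ _ _ in fin *.
have ws : w \in signed m by apply: demazure_signed; apply: group1.
have P j : 0 < j <= m -> prof w j (2 * m - j) = lchain (blocked j) (j + k) (2 * m + k - j) - k.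
  move=> jm; have := fin j (2 * m - j) jm ltac:(lia).
  have -> : cell_u n 0 (2 * m - j) = j + k by rewrite /cell_u; case: ifP => ?; lia.
  have -> : cell_v j n 0 (2 * m - j) = 2 * m + k - j by rewrite /cell_v; case: ifP => ?; lia.
  by rewrite /jumps; have := lchain_min (blocked j) (j + k) (2 * m + k - j); lia.
split=> [e j jm|h]; first by have := P j jm; rewrite e prof_w0B; lia.
by apply: eq_w0B => // j jm; rewrite P //; have := h j jm; lia.
Qed.
End Network.

(** * Orbits of segments as cells of a strip *)

Local Open Scope nat_scope.

Section Polygon.
Variables n k m : nat.
Hypothesis nE : n = m + k.
Hypothesis m0 : 0 < m.
Hypothesis k0 : 0 < k.
Local Notation V := ('I_n * 'I_m)%type.
Local Notation W := 'I_(2 * n).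

Fact n2_gt0 : 0 < 2 * n. Proof. by rewrite muln_gt0 /= nE addn_gt0 m0. Qed.
Let n0 : 0 < n. Proof. by rewrite nE addn_gt0 m0. Qed.

Definition vtx (x : nat) : W := Ordinal (ltn_pmod x n2_gt0).
Definition seg (x y : nat) : {set W} := [set vtx x; vtx y].

Lemma vtx_val (a : W) : vtx a = a.
Proof. by apply: ord_inj; rewrite /= modn_small. Qed.

Lemma vtxE x : x < 2 * n -> vtx x = x :> nat.
Proof. by move=> h; rewrite /= modn_small. Qed.

Lemma vtx_eq x y : x < 2 * n -> y < 2 * n -> (vtx x == vtx y) = (x == y).
Proof. by move=> xn yn; rewrite -val_eqE /= !modn_small. Qed.

Lemma half_turn_vtx x : half_turn (vtx x) = vtx (x + n).
Proof.
apply: ord_inj; rewrite /half_turn /=.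
have H j (a : W) : iter j (@ordS (2 * n)) a = (a + j) %% (2 * n) :> nat.
  elim: j => [|j IH]; first by rewrite addn0 modn_small.
  by rewrite iterS [LHS]/= IH -addn1 modnDml addn1 addnS.
by rewrite H /= modnDml.
Qed.

Lemma half_turnK : involutive (@half_turn n).
Proof.
move=> a; rewrite -(vtx_val a) !half_turn_vtx; apply: ord_inj => /=.
by rewrite -addnA addnn -mul2n modnDr.
Qed.

Lemma half_turn_seg x y : @half_turn n @: seg x y = seg (x + n) (y + n).
Proof. by rewrite /seg imsetU1 imset_set1 !half_turn_vtx. Qed.

Lemma seg_inj x y x' y' : x < y -> y < 2 * n -> x' < y' -> y' < 2 * n ->
  seg x y = seg x' y' -> x = x' /\ y = y'.
Proof.
move=> xy yn xy' yn' /setP e.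
have := e (vtx x); have := e (vtx y); rewrite !inE !eqxx orbT /=.
rewrite !vtx_eq ?(ltn_trans xy) ?(ltn_trans xy') // => /esym h1 /esym h2.
by clear -xy xy' h1 h2; lia.
Qed.

Lemma seg_exists (s : {set W}) : segment s ->
  exists p : nat * nat, [/\ p.1 < p.2, p.2 < 2 * n & s = seg p.1 p.2].
Proof.
rewrite /segment => /cards2P[a [b [ab ->]]].
have : a != b :> nat by [].
rewrite neq_ltn => /orP[] h.
  by exists (val a, val b); rewrite /= /seg !vtx_val h ltn_ord.
by exists (val b, val a); rewrite /= /seg !vtx_val h ltn_ord setUC.
Qed.

Lemma seg_segment x y : x < y -> y < 2 * n -> segment (seg x y).
Proof.
move=> xy yn; rewrite /segment cards2 vtx_eq ?(ltn_trans xy) //.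
by rewrite neq_ltn xy.
Qed.

(** The representative of an orbit that starts in the first half of the polygon and has length
    between k + 1 and n. *)
Definition pseg (p : V) : {set W} := seg p.1 (p.1 + (k.+1 + p.2)).
Definition orb (p : V) : {set {set W}} := rotation_orbit (pseg p).

Lemma pseg_bounds (p : V) : p.1 < p.1 + (k.+1 + p.2) /\ p.1 + (k.+1 + p.2) < 2 * n.
Proof. by case: p => a r /=; have := ltn_ord a; have := ltn_ord r; move: nE; clear; lia. Qed.

Lemma mem_orb x y (p : V) : x < y -> y < 2 * n ->
  (seg x y \in orb p) = (k < y - x < 2 * n - k) && inA n k (fun a r => (a == p.1) && (r == p.2)) x y.
Proof.
move=> xy yn; case: p => a r; have [b1 b2] := pseg_bounds (a, r); rewrite /= in b1 b2.
have an := ltn_ord a; have rm := ltn_ord r.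
have mB z : n <= z -> z < 2 * n -> z %% n = z - n.
  by move=> h1 h2; rewrite -{1}(subnK h1) modnDr modn_small //; clear -h1 h2; lia.
(* The image with its ends in increasing order: the right end wraps around when it was already in
   the second half. *)
have rot : @half_turn n @: pseg (a, r) =
    if a + (k.+1 + r) < n then seg (a + n) (a + (k.+1 + r) + n) else seg (a + (k.+1 + r) - n) (a + n).
  rewrite half_turn_seg /=; case: ltnP => h //.
  rewrite /seg setUC; congr [set _; _]; apply: ord_inj => /=.
  rewrite -[in RHS](modnDr (a + (k.+1 + r) - n)); congr (_ %% _); clear -h; lia.
rewrite !inE rot.
apply/orP/andP => [[/eqP e|/eqP e]|[/andP[L1 L2]]].
- have [-> ->] := seg_inj xy yn b1 b2 e; rewrite /inA addKn.
  have -> : k.+1 + r <= n by clear -nE rm; lia.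
  by rewrite modn_small // eqxx addKn eqxx; split=> //; clear -nE rm; lia.
- move: e; case: ltnP => h e.
    have [||-> ->] := seg_inj xy yn _ _ e; try (clear -nE b1 b2 an h; lia).
    have -> : a + (k.+1 + r) + n - (a + n) = k.+1 + r by clear; lia.
    rewrite /inA; have -> : a + (k.+1 + r) + n - (a + n) = k.+1 + r by clear; lia.
    have -> : k.+1 + r <= n by clear -nE rm; lia.
    by rewrite modnDr modn_small // eqxx addKn eqxx; split=> //; clear -nE rm; lia.
  have [||-> ->] := seg_inj xy yn _ _ e; try (clear -nE b1 b2 an rm h; lia).
  rewrite /inA; have -> : a + n - (a + (k.+1 + r) - n) = 2 * n - (k.+1 + r) by clear -h; lia.
  split; first by clear -nE rm k0; lia.
  case: ifP => h2.
    have rE : k.+1 + r = n by clear -h2 nE rm; lia.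
    rewrite rE addnK modn_small // eqxx /=; apply/eqP; clear -rE; lia.
  rewrite modnDr modn_small // eqxx /=; apply/eqP; clear -rm nE; lia.
rewrite /inA; case: ifP => hL /andP[/eqP /= ea /eqP /= er].
  have E : y = x + (k.+1 + r) by clear -er L1 xy; lia.
  case: (ltnP x n) => xn.
    rewrite modn_small // in ea; left; rewrite /pseg /= -ea E //.
  right; have xE : x = a + n.
    by rewrite -ea mB ?subnK // (ltn_trans xy).
  case: ltnP => h; first by rewrite E xE; apply/eqP; congr seg; clear; lia.
  by clear -E xE h yn; lia.
right; have yE : y = a + n.
  have yn' : n <= y by clear -hL; lia.
  by rewrite -ea mB ?subnK.
case: ltnP => h; first by clear -er yE h hL xy yn L2 nE k0; lia.
by apply/eqP; congr seg; [clear -er yE h hL L2 L1 xy yn; lia|].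
Qed.

Lemma mem_cover_orb x y (S : {set V}) : x < y -> y < 2 * n ->
  (seg x y \in cover (orb @: S)) = (k < y - x < 2 * n - k) &&
  inA n k (fun a r => [exists p in S, (a == p.1) && (r == p.2)]) x y.
Proof.
move=> xy yn; apply/bigcupP/andP => [[_ /imsetP[p pS ->]]|[L]].
  rewrite mem_orb // => /andP[-> h]; split=> //; move: h; rewrite /inA.
  by case: ifP => _ h; apply/existsP; exists p; rewrite pS.
rewrite /inA => h.
have [p pS hp] : exists2 p, p \in S & inA n k (fun a r => (a == p.1) && (r == p.2)) x y.
  by move: h; rewrite /inA; case: ifP => _ /existsP[p /andP[pS h]]; exists p.
by exists (orb p); [apply: imset_f|rewrite mem_orb // L].
Qed.

Lemma inA_pseg (A : nat -> nat -> bool) (p : V) : inA n k A p.1 (p.1 + (k.+1 + p.2)) = A p.1 p.2.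
Proof.
rewrite /inA addKn; have -> : k.+1 + p.2 <= n by have := ltn_ord p.2; clear -nE; lia.
by rewrite modn_small // addKn.
Qed.

Lemma orb_inj : injective orb.
Proof.
move=> p q e; have [b1 b2] := pseg_bounds p.
have : pseg p \in orb q by rewrite -e !inE eqxx.
rewrite mem_orb // inA_pseg => /andP[_ /andP[/eqP e1 /eqP e2]].
by rewrite [p]surjective_pairing [q]surjective_pairing; congr pair; apply: ord_inj.
Qed.

Lemma orbitsE : orbits n k = orb @: setT.
Proof.
apply/setP=> O; apply/imsetP/imsetP => [[s]|[p _ ->]].
  rewrite inE => /andP[/seg_exists[[x y] /= [xy yn ->]] /existsP[a /existsP[b /andP[/eqP sE kl]]]] ->.
  have L : k < y - x < 2 * n - k.
    move: kl; rewrite /cyclic_length.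
    have : a != b :> nat.
      by apply/negP=> /eqP/ord_inj ab; have := seg_segment xy yn; rewrite sE ab /segment cards2 eqxx.
    have ab (a' b' : W) : a' < b' -> seg x y = [set a'; b'] -> x = a' /\ y = b'.
      move=> h e; apply: (seg_inj xy yn h); rewrite ?ltn_ord //.
      by rewrite e /seg !vtx_val.
    rewrite neq_ltn => /orP[] h.
      by have [-> ->] := ab a b h sE; clear -h; lia.
    by have [|-> ->] := ab b a h; rewrite 1?setUC //; clear -h; lia.
  have [p hp] : exists p : V, inA n k (fun a r => (a == p.1) && (r == p.2)) x y.
    case: (leqP (y - x) n) => hL.
      have h1 : y - x - k.+1 < m by clear -hL nE L; lia.
      by exists (Ordinal (ltn_pmod x n0), Ordinal h1); rewrite /inA hL /= !eqxx.
    have h1 : 2 * n - (y - x) - k.+1 < m by clear -hL nE L; lia.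
    by exists (Ordinal (ltn_pmod y n0), Ordinal h1); rewrite /inA leqNgt hL /= !eqxx.
  exists p => //; have : seg x y \in orb p by rewrite mem_orb // L.
  rewrite !inE => /orP[] /eqP ->; first by [].
  have K : @half_turn n @: (@half_turn n @: pseg p) = pseg p.
    by rewrite -imset_comp -[RHS]imset_id; apply: eq_imset => z /=; rewrite half_turnK.
  by rewrite /orb /rotation_orbit K setUC.
have [b1 b2] := pseg_bounds p; exists (pseg p) => //.
rewrite inE seg_segment //=; apply/existsP; exists (vtx p.1); apply/existsP.
exists (vtx (p.1 + (k.+1 + p.2))); rewrite eqxx /= /cyclic_length !vtxE ?(ltn_trans b1) //.
by case: p b1 b2 => a r /= b1 b2; have := ltn_ord r; clear -nE k0 b1 b2; lia.
Qed.

(* k+1 pairwise crossing segments {x_i, y_i}: x_0 < ... < x_k < y_0 < ... < y_k. *)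
Definition crossing_chain (P : nat -> nat -> bool) (s : seq (nat * nat)) : Prop :=
  [/\ size s = k.+1, sorted ltpair s, {in s, forall p : nat * nat, p.2 < 2 * n},
      {in s &, forall p q : nat * nat, p.1 < q.2} & {in s, forall p : nat * nat, P p.1 p.2}].

(** Interleaving orders left and right ends alike, so sorting pairwise crossing segments by left end
    gives a chain. *)
Lemma crossing_chainP (U : {set {set W}}) :
  reflect (exists s, crossing_chain (fun x y => seg x y \in U) s)
    [exists C : {set {set W}}, is_crossing k.+1 C && (C \subset U)].
Proof.
apply: (iffP existsP) => [[C /andP[/and3P[/eqP cC /forallP segC /forallP crC] CU]]|[s [sz ss s2 sx sU]]].
  have segC' t : t \in C -> segment t by move=> tC; have := segC t; rewrite tC.
  pose good (t : {set W}) (p : W * W) := (p.1 < p.2) && (t == seg p.1 p.2).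
  pose pr t : nat * nat := if [pick p | good t p] is Some p then (val p.1, val p.2) else (0, 0).
  have prP t : t \in C -> [/\ (pr t).1 < (pr t).2, (pr t).2 < 2 * n & t = seg (pr t).1 (pr t).2].
    move=> /segC' /seg_exists[[x y] [/= xy yn tE]]; rewrite /pr; case: pickP => [[a b] /andP[/= h /eqP ->]|h].
      by rewrite ltn_ord.
    have g : good t (vtx x, vtx y).
      apply/andP; split; first by change (vtx x < vtx y); rewrite !vtxE // (ltn_trans xy).
      by change (t == seg (vtx x) (vtx y)); rewrite !vtxE ?(ltn_trans xy) // tE.
    by rewrite h in g.
  have crP t u : t \in C -> u \in C -> t != u ->
     (ltpair (pr t) (pr u) \/ ltpair (pr u) (pr t)) /\ ((pr t).1 < (pr u).2) /\ ((pr u).1 < (pr t).2).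
    move=> tC uC tu; have := crC t; rewrite tC => /forallP/(_ u); rewrite uC tu /=.
    have [p1 p2 p3] := prP t tC; have [q1 q2 q3] := prP u uC.
    have intl (a b c d : W) (t' u' : {set W}) (p q : nat * nat) : a < b -> b < c -> c < d -> t' = [set a; c] -> u' = [set b; d] ->
       p.1 < p.2 -> p.2 < 2 * n -> q.1 < q.2 -> q.2 < 2 * n -> t' = seg p.1 p.2 -> u' = seg q.1 q.2 ->
       [/\ ltpair p q, p.1 < q.2 & q.1 < p.2].
      move=> ab bc cd e1 e2 p1' p2' q1' q2' e3 e4.
      have s1 : seg a c = seg p.1 p.2 by rewrite -e3 e1 /seg !vtx_val.
      have s2 : seg b d = seg q.1 q.2 by rewrite -e4 e2 /seg !vtx_val.
      rewrite /ltpair; have [<- <-] := seg_inj (ltn_trans ab bc) (ltn_ord c) p1' p2' s1.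
      have [<- <-] := seg_inj (ltn_trans bc cd) (ltn_ord d) q1' q2' s2.
      by rewrite ab cd bc (ltn_trans ab) // (ltn_trans bc).
    case/orP=> /existsP[a /existsP[b /existsP[c /existsP[d /and5P[ab bc cd /eqP e1 /eqP e2]]]]].
      by have [] := intl _ _ _ _ _ _ _ _ ab bc cd e1 e2 p1 p2 q1 q2 p3 q3; split; [left|].
    by have [] := intl _ _ _ _ _ _ _ _ ab bc cd e1 e2 q1 q2 p1 p2 q3 p3; split; [right|].
  pose le1 (p q : nat * nat) := p.1 <= q.1.
  pose s := sort le1 [seq pr t | t <- enum C].
  have mem p : p \in s -> exists2 t, t \in C & p = pr t.
    by rewrite mem_sort => /mapP[t]; rewrite mem_enum; exists t.
  have us : uniq s.
    rewrite sort_uniq map_inj_in_uniq ?enum_uniq // => t u; rewrite !mem_enum => tC uC e.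
    by have [_ _ ->] := prP t tC; have [_ _ ->] := prP u uC; rewrite e.
  exists s; split.
  - by rewrite size_sort size_map -cardE.
  - rewrite sorted_pairwise; last exact: ltpair_trans.
    have : pairwise le1 s.
      rewrite -sorted_pairwise; last by move=> x y z; apply: leq_trans.
      by apply: sort_sorted => x y; apply: leq_total.
    move=> /(pairwiseP (0, 0)) h; apply/(pairwiseP (0, 0)) => i j i1 j1 ij; have := h i j i1 j1 ij.
    have := nth_uniq (0, 0) i1 j1 us; rewrite (ltn_eqF ij).
    have [t tC ->] := mem _ (mem_nth (0, 0) i1); have [u uC ->] := mem _ (mem_nth (0, 0) j1).
    move=> /negbT tu; have {}tu : t != u by apply: contraNneq tu => ->.
    by have [[//|/andP[h1 _]] _] := crP t u tC uC tu; rewrite /le1 leqNgt h1.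
  - by move=> p /mem[t tC ->]; have [] := prP t tC.
  - move=> p q /mem[t tC ->] /mem[u uC ->]; case: (eqVneq t u) => [<-|tu].
      by have [] := prP t tC.
    by have [_ []] := crP t u tC uC tu.
  - move=> p /mem[t tC ->]; have [_ _ <-] := prP t tC; exact: (subsetP CU).
have tri p q : p \in s -> q \in s -> p != q -> ltpair p q \/ ltpair q p.
  move=> /(nthP (0, 0))[i i1 <-] /(nthP (0, 0))[j j1 <-] ij.
  have H := sorted_ltn_nth ltpair_trans (0, 0) ss.
  case: (ltngtP i j) => h; [by left; apply: H|by right; apply: H|by rewrite h eqxx in ij].
have us : uniq s.
  by apply: (sorted_uniq ltpair_trans) => // p; rewrite /ltpair ltnn.
have inj : {in s &, injective (fun p => seg p.1 p.2)}.
  move=> p q ps qs /(seg_inj (sx _ _ ps ps) (s2 _ ps) (sx _ _ qs qs) (s2 _ qs)) [].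
  by case: p {ps} => a b; case: q {qs} => c d /= -> ->.
exists [set t in [seq seg p.1 p.2 | p <- s]]; apply/andP; split; last first.
  by apply/subsetP=> t; rewrite inE => /mapP[p ps ->]; apply: sU.
apply/and3P; split.
- rewrite cardsE (card_uniqP _) ?size_map ?sz //.
  by rewrite map_inj_in_uniq.
- apply/forallP=> t; rewrite inE; apply/implyP=> /mapP[p ps ->].
  by apply: seg_segment; [apply: sx|apply: s2].
apply/forallP=> t; rewrite inE; apply/implyP=> /mapP[p ps ->].
apply/forallP=> u; rewrite inE; apply/implyP=> /mapP[q qs ->]; apply/implyP=> pq.
have {}pq : p != q by apply: contraNneq pq => ->.
have intl p' q' : p' \in s -> q' \in s -> ltpair p' q' ->
    interleave (seg p'.1 p'.2) (seg q'.1 q'.2).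
  move=> ps' qs' /andP[h1 h2]; apply/existsP; exists (vtx p'.1); apply/existsP; exists (vtx q'.1).
  apply/existsP; exists (vtx p'.2); apply/existsP; exists (vtx q'.2).
  have h3 := sx _ _ qs' ps'; have h4 := s2 _ qs'; have h5 := s2 _ ps'.
  have b2 := ltn_trans h3 h5; have b1 := ltn_trans h1 b2.
  by apply/and5P; rewrite (vtxE b1) (vtxE b2) (vtxE h4) (vtxE h5).
rewrite /cross; apply/orP.
by case: (tri p q ps qs pq) => h; [left|right]; apply: intl.
Qed.

Definition stripP (S : {set V}) (a r : nat) : bool := [exists p in S, (a == p.1) && (r == p.2)].

Lemma stripPE (S : {set V}) (p : V) : stripP S p.1 p.2 = (p \in S).
Proof.
apply/existsP/idP => [[q /andP[qS /andP[/eqP h1 /eqP h2]]]|pS]; last by exists p; rewrite pS !eqxx.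
by rewrite [p]surjective_pairing (ord_inj h1) (ord_inj h2) -surjective_pairing.
Qed.

(** Each of the k other segments has one end on either side of a given one. Hence the short segments
    that [blocked] adds never occur in a crossing. *)
Lemma crossing_chain_len P s (p : nat * nat) : crossing_chain P s -> p \in s -> k < p.2 - p.1 < 2 * n - k.
Proof.
move=> [sz ss s2 sx _] ps.
have H := sorted_ltn_nth ltpair_trans (0, 0) ss.
have [i i1 pE] := nthP (0, 0) ps.
have lo j : j < size s -> j <= (nth (0, 0) s j).1 /\ (nth (0, 0) s 0).2 + j <= (nth (0, 0) s j).2.
  elim: j => [|j IH] j1; first by rewrite addn0.
  have [h1 h2] := IH (ltnW j1); have /andP[h3 h4] := H j j.+1 (ltnW j1) j1 (ltnSn j).
  by clear -h1 h2 h3 h4; lia.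
have up j : j < size s -> (nth (0, 0) s j).1 + (size s - j.+1) <= (nth (0, 0) s (size s).-1).1 /\
    (nth (0, 0) s j).2 + (size s - j.+1) <= (nth (0, 0) s (size s).-1).2.
  move e : (size s - j.+1) => q; elim: q j e => [|q IH] j e j1.
    by have -> : j = (size s).-1 by [clear -e j1; lia]; rewrite !addn0.
  have j2 : j.+1 < size s by clear -e; lia.
  have [|h1 h2] := IH j.+1 _ j2; first by clear -e; lia.
  have /andP[h3 h4] := H j j.+1 j1 j2 (ltnSn j).
  by clear -h1 h2 h3 h4; lia.
have [l1 l2] := lo i i1; have [u1 u2] := up i i1; rewrite pE in l1 l2 u1 u2.
have s0 : 0 < size s by rewrite sz.
have sl : (size s).-1 < size s by rewrite sz.
have c := sx _ _ (mem_nth (0, 0) sl) (mem_nth (0, 0) s0).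
have b := s2 _ (mem_nth (0, 0) sl).
by move: (nth _ _ _) (nth _ _ _) l1 l2 u1 u2 c b => [? ?] [? ?] /=; rewrite sz in i1 *; clear -i1; lia.
Qed.

Lemma inA_rot A x y : x < y -> y < 2 * n ->
  (n <= x -> inA n k A (x - n) (y - n) = inA n k A x y) /\
  (x < n -> n <= y -> inA n k A (y - n) (x + n) = inA n k A x y).
Proof.
have mB z : n <= z -> (z - n) %% n = z %% n by move=> h; rewrite -{2}(subnK h) modnDr.
move=> xy yn; split=> [nx|xn ny]; rewrite /inA.
  have -> : y - n - (x - n) = y - x by clear -nx xy; lia.
  by rewrite !mB // (leq_trans nx) // ltnW.
have -> : x + n - (y - n) = 2 * n - (y - x) by clear -ny xn xy; lia.
rewrite modnDr mB //; case: (ltngtP (y - x) n) => h.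
- have -> : (2 * n - (y - x) <= n) = false by clear -h; lia.
  by congr (A _ _); clear -h; lia.
- have -> : (2 * n - (y - x) <= n) = true by clear -h; lia.
  by congr (A _ _); clear -h; lia.
have -> : (2 * n - (y - x) <= n) = true by clear -h; lia.
have -> : y = x + n by clear -h xy; lia.
by rewrite modnDr; congr (A _ _); clear; lia.
Qed.

Lemma crossing_chain_ltpair P s (p q : nat * nat) : crossing_chain P s -> p \in s -> q \in s ->
  p.1 < q.1 -> ltpair p q.
Proof.
move=> [_ ss _ _ _] /(nthP (0, 0))[i i1 <-] /(nthP (0, 0))[j j1 <-] ij.
have H := sorted_ltn_nth ltpair_trans (0, 0) ss.
case: (ltngtP i j) => h; first exact: H.
  by have /andP[h1 _] := H j i j1 i1 h; rewrite ltnNge (ltnW h1) in ij.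
by rewrite h ltnn in ij.
Qed.

(** If some left end is at least n, so is every right end. After a half turn the segments beyond n
    come first, by [f], and those straddling n follow with their ends exchanged, by [g]. *)
Lemma crossing_chain_rot A s : crossing_chain (inA n k A) s ->
  exists2 s', crossing_chain (inA n k A) s' & {in s', forall p : nat * nat, p.1 < n}.
Proof.
move=> cs; have [sz ss s2 sx sA] := cs.
case: (boolP (all (fun p => p.1 < n) s)) => [/allP h|/allPn[p0 p0s p0n]]; first by exists s.
rewrite -leqNgt in p0n.
pose f (p : nat * nat) := (p.1 - n, p.2 - n); pose g (p : nat * nat) := (p.2 - n, p.1 + n).
pose s1 := [seq p <- s | p.1 < n]; pose s3 := [seq p <- s | ~~ (p.1 < n)].
have m1 (p : nat * nat) : p \in s1 -> [/\ p \in s, p.1 < n & n <= p.2].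
  by rewrite mem_filter => /andP[h ps]; split=> //; apply: leq_trans p0n (ltnW (sx _ _ p0s ps)).
have m3 (p : nat * nat) : p \in s3 -> [/\ p \in s, n <= p.1 & n <= p.2].
  rewrite mem_filter -leqNgt => /andP[h ps]; split=> //.
  by apply: leq_trans p0n (ltnW (sx _ _ p0s ps)).
have mm (p : nat * nat) : p \in map f s3 ++ map g s1 ->
   (exists2 q : nat * nat, q \in s3 & p = f q) \/ (exists2 q : nat * nat, q \in s1 & p = g q).
  by rewrite mem_cat => /orP[] /mapP[q qs ->]; [left|right]; exists q.
exists (map f s3 ++ map g s1); last first.
  move=> p /mm[[q /m3[qs h1 h2] ->]|[q /m1[qs h1 h2] ->]] /=; have := s2 q qs; have := sx q q qs qs;
  clear -h1 h2; lia.
split.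
- by rewrite size_cat !size_map !size_filter -sz addnC -(count_predC (fun p => p.1 < n)).
- rewrite sorted_pairwise ?pairwise_cat; last exact: ltpair_trans.
  rewrite -!(sorted_pairwise ltpair_trans); apply/and3P; split.
  + apply/allrelP => _ _ /mapP[p /m3[ps p1 p2] ->] /mapP[q /m1[qs q1 q2] ->].
    have := sx p q ps qs; have := s2 p ps; rewrite /ltpair /=; clear -p1 p2 q1 q2; lia.
  + apply: (homo_sorted_in (P := mem s3) (e := ltpair)); last 2 first.
    * by apply/allP.
    * exact: sorted_filter ltpair_trans _ _ ss.
    move=> p q /m3[_ p1 p2] /m3[_ q1 q2] /andP[h1 h2]; rewrite /ltpair /=; clear -p1 p2 h1 h2; lia.
  + apply: (homo_sorted_in (P := mem s1) (e := ltpair)); last 2 first.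
    * by apply/allP.
    * exact: sorted_filter ltpair_trans _ _ ss.
    move=> p q /m1[_ p1 p2] /m1[_ q1 q2] /andP[h1 h2]; rewrite /ltpair /=; clear -p1 p2 h1 h2; lia.
- move=> p /mm[[q /m3[qs h1 h2] ->]|[q /m1[qs h1 h2] ->]] /=; have := s2 q qs; clear -h1 h2; lia.
- move=> p q /mm[[p' /m3[ps h1 h2] ->]|[p' /m1[ps h1 h2] ->]] /mm[[q' /m3[qs h3 h4] ->]|[q' /m1[qs h3 h4] ->]] /=.
  + by have := sx _ _ ps qs; clear -h1 h3; lia.
  + by have := sx _ _ ps ps; have := s2 _ ps; clear -h1; lia.
  + have /andP[_ h5] := crossing_chain_ltpair cs ps qs (leq_trans h1 h3).
    by clear -h5 h2; lia.
  + by have := s2 _ ps; clear -h1; lia.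
- move=> p /mm[[q /m3[qs h1 h2] ->]|[q /m1[qs h1 h2] ->]] /=.
    by rewrite (proj1 (inA_rot A (sx _ _ qs qs) (s2 _ qs))) //; apply: sA.
  by rewrite (proj2 (inA_rot A (sx _ _ qs qs) (s2 _ qs))) //; apply: sA.
Qed.

Lemma chain_lchain A s : crossing_chain (inA n k A) s ->
  exists2 j, 0 < j <= m & k < lchain (blocked n k A j) (j + k) (2 * m + k - j).
Proof.
move=> /crossing_chain_rot[{}s cs sn]; have [sz ss s2 sx sA] := cs.
case: s sz => // p0 s' sz in cs sn ss s2 sx sA *; set s := p0 :: s' in sz cs sn ss s2 sx sA *.
have p0s : p0 \in s by apply: mem_head.
have /andP[L1 L2] := crossing_chain_len cs p0s.
(* The cut: every right end is at least c and every left end, being below n and below [p0.2], is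
   less than c. The length bound gives k < c, so c - k is an admissible [j]. *)
pose c := minn n p0.2.
have cmin (p : nat * nat) : p \in s -> c <= p.2.
  rewrite inE => /orP[/eqP ->|ps]; first exact: geq_minr.
  have : ltpair p0 p.
    by move: ss; rewrite /= (path_sortedE ltpair_trans) => /andP[/allP/(_ _ ps)].
  by case/andP=> _ h; apply: leq_trans (geq_minr _ _) (ltnW h).
have jE : c - k + k = c by apply: subnK; rewrite /c; clear -nE m0 L1; lia.
exists (c - k); first by rewrite /c; clear -nE m0 L1; lia.
have -> : 2 * m + k - (c - k) = 2 * n - c by rewrite /c; clear -nE m0 L1; lia.
rewrite jE -sz -(size_map (fun p : nat * nat => (p.1, p.2 - c))); apply: chain_in_le.
apply/andP; split.
  apply: (homo_sorted_in (P := mem s) (e := ltpair)) ss; last by apply/allP.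
  by move=> p q ps qs /andP[h1 h2]; rewrite /ltpair /= h1 ltn_sub2r // (leq_ltn_trans (cmin p ps)).
apply/allP=> _ /mapP[p ps ->] /=; apply/and3P; split.
- rewrite /blocked -addnA jE subnK ?cmin // sA // !orbT //.
- by rewrite /c ltn_min sn // sx.
- by rewrite ltn_sub2r ?s2 // (leq_ltn_trans (cmin p ps)) // s2.
Qed.

(** Any k + 1 cells of the long chain already satisfy the length bound, which excludes those blocked
    only for being short. *)
Lemma lchain_chain A j : 0 < j <= m -> k < lchain (blocked n k A j) (j + k) (2 * m + k - j) ->
  exists s, crossing_chain (inA n k A) s.
Proof.
move=> /andP[j0 jm]; have [s0 /andP[ss0 /allP sb] <-] := lchain_exists (blocked n k A j) (j + k) (2 * m + k - j).
move=> ks; pose f (p : nat * nat) := (p.1, p.2 + (j + k)); pose s := [seq f p | p <- take k.+1 s0].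
have sm p : p \in s -> exists2 q, p = f q & [&& blocked n k A j q.1 q.2, q.1 < j + k & q.2 < 2 * m + k - j].
  by move=> /mapP[q /mem_take/sb h ->]; exists q.
pose P x y := [|| y - x <= k, 2 * n - k <= y - x | inA n k A x y].
have cs : crossing_chain P s.
  split.
  - by rewrite size_map size_takel.
  - rewrite sorted_map; apply: sub_sorted (take_sorted _ ss0) => p q /andP[h1 h2].
    by rewrite /relpre /= /ltpair /= h1 ltn_add2r.
  - by move=> p /sm[q -> /and3P[_ _ h]] /=; clear -h nE jm; lia.
  - by move=> p q /sm[p' -> /and3P[_ h _]] /sm[q' -> _] /=; clear -h; lia.
  - by move=> p /sm[q -> /and3P[h _ _]]; rewrite /P /=; move: h; rewrite /blocked -addnA.
exists s; have [c1 c2 c3 c4 c5] := cs; split=> // p ps.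
have := c5 p ps; have := crossing_chain_len cs ps; rewrite /P => /andP[h1 h2].
by rewrite leqNgt h1 leqNgt h2.
Qed.

Lemma Dstar_faceE (S : {set V}) : Dstar_face k (orb @: S) =
  (demazure (@gB n m) (@lenB m) 1 [seq p <- rows n m | p \in ~: S] == w0B m).
Proof.
rewrite /Dstar_face orbitsE imsetS ?subsetT //=.
have keepE : keep n m (stripP S) = ~: S by apply/setP=> p; rewrite !inE stripPE.
have := demazure_w0_iff nE m0 (stripP S); rewrite keepE => iff.
apply/idP/eqP => [/crossing_chainP nc|/iff h].
  apply/iff => j jm; rewrite leqNgt; apply/negP=> /(lchain_chain jm)[s cs]; apply: nc; exists s.
  have [c1 c2 c3 c4 c5] := cs; split=> // p ps.
  by rewrite mem_cover_orb ?c3 ?c4 // (crossing_chain_len cs ps); apply: c5.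
apply/crossing_chainP=> -[s cs].
have cs' : crossing_chain (inA n k (stripP S)) s.
  have [c1 c2 c3 c4 c5] := cs; split=> // p ps.
  by have := c5 p ps; rewrite mem_cover_orb ?c3 ?c4 // => /andP[].
have [j jm] := chain_lchain cs'.
by rewrite ltnNge h.
Qed.

Definition facetsB : {set {set V}} :=
  [set F : {set V} | reduced_w0 (@gB n m) (@lenB m) (w0B m) (rows n m) (~: F)].

Lemma facetB_face F : F \in facetsB -> Dstar_face k (orb @: F).
Proof.
rewrite inE Dstar_faceE => /andP[/eqP c /eqP e]; apply/eqP; apply: demazure_reduced => //.
rewrite -c cardE; apply: perm_size; apply: uniq_perm;
  rewrite ?(filter_uniq _ (rows_uniq n m)) ?enum_uniq // => p.
by rewrite mem_filter mem_enum rows_all andbT.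
Qed.

Lemma face_facetB (F : {set V}) : Dstar_face k (orb @: F) ->
  exists2 F', F' \in facetsB & F \subset F'.
Proof.
rewrite Dstar_faceE => /eqP e.
have sS (p : V) : gB p \in signed m by apply: gen_signed.
have sL (p : V) w : w \in signed m -> lenB (gB p * w)%g = (lenB w).+1 \/ lenB w = (lenB (gB p * w)%g).+1.
  exact: lenB_gen.
have [I [gI dI cI]] := greedy_exists sS (lenB_1 m) sL (rows_uniq n m) (@rows_all n m) (~: F).
exists (~: I).
  by rewrite inE setCK /reduced_w0 cI dI; apply/andP; split; apply/eqP; rewrite -1?e // dI.
by rewrite subsetC; apply/subsetP=> p; rewrite gI => /andP[].
Qed.

(** Every face lies in a member of [facetsB], and these all have the same cardinal, so none contains
    another. *)
Lemma Dstar_facetE (S : {set V}) : maxset (Dstar_face k) (orb @: S) = (S \in facetsB).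
Proof.
have red_face := facetB_face; have face_red := face_facetB.
apply/maxsetP/idP => [[fS mS]|SB].
  have [F FB SF] := face_red S fS.
  have := mS (orb @: F) (red_face F FB) (imsetS _ SF) => /(imset_inj orb_inj) <-.
  by [].
split; first exact: red_face.
move=> B fB SB'; have : B \subset orbits n k by case/andP: fB.
rewrite orbitsE => /subsetP BO.
have BE : B = orb @: (orb @^-1: B).
  apply/setP=> O; apply/idP/imsetP => [OB|[p]]; last by rewrite inE => h ->.
  by have /imsetP[p _ OE] := BO O OB; exists p; rewrite // inE -OE.
move: fB SB'; rewrite BE => /face_red[F FB BF] SB'.
have SF : S \subset F.
  apply: subset_trans BF; apply/subsetP=> p pS.
  by have := subsetP SB' _ (imset_f orb pS); rewrite mem_imset //; apply: orb_inj.
have cF F' : F' \in facetsB -> #|F'| = #|{: V}| - lenB (w0B m).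
  by rewrite inE => /andP[/eqP <- _]; rewrite -(cardsC F') addnK.
have SFE : S = F by apply/eqP; rewrite eqEcard SF (cF S) // (cF F) // leqnn.
by apply/eqP; rewrite eqEsubset SB' {1}SFE imsetS.
Qed.

Lemma T_facetsB : T n k = #|facetsB|.
Proof.
have ii : injective (fun S : {set V} => orb @: S) by apply: imset_inj; apply: orb_inj.
rewrite /T -(card_imset _ ii); apply: eq_card => A; rewrite inE; apply/idP/imsetP => [mA|[S SB ->]].
  have : A \subset orbits n k by case/maxsetP: mA => /andP[].
  rewrite orbitsE => /subsetP AO.
  have AE : A = orb @: (orb @^-1: A).
    apply/setP=> O; apply/idP/imsetP => [OA|[p]]; last by rewrite inE => h ->.
    by have /imsetP[p _ OE] := AO O OA; exists p; rewrite // inE -OE.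
  by exists (orb @^-1: A); rewrite // -Dstar_facetE -AE.
by rewrite Dstar_facetE.
Qed.

Lemma facetsB_card F : F \in facetsB -> #|F| = k * m.
Proof.
rewrite inE => /andP[/eqP c _]; have := cardsC F.
rewrite c lenB_w0E card_prod !card_ord.
have -> : n * m = k * m + m ^ 2 by rewrite nE mulnDl mulnn addnC.
by move/eqP; rewrite eqn_add2r => /eqP.
Qed.

Lemma T_upper : T n k <= 'C(m ^ 2 + (k * m)./2, m ^ 2) + 'C(m ^ 2 + (k * m).-1./2, m ^ 2).
Proof.
have cV : #|{: V}| = m ^ 2 + k * m by rewrite card_prod !card_ord nE mulnDl mulnn.
have -> : k * m = #|{: V}| - m ^ 2 by rewrite cV addKn.
rewrite T_facetsB; apply: card_reducedB_le => //; [exact: rows_uniq|exact: rows_all|].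
by rewrite cV -{1}(addn0 (m ^ 2)) ltn_add2l muln_gt0 k0.
Qed.

End Polygon.

(** * Straightening monomials of matrices of rank at most k *)

Local Open Scope nat_scope.

Lemma perm_mono_id (T : finType) (A : T -> nat) (s : {perm T}) : injective A ->
  (forall p q, A p < A q -> A (s p) < A (s q)) -> s = 1%g.
Proof.
move=> Ai mono; apply/permP=> p; rewrite perm1; apply: (Ai).
have mono' q r : (A (s q) < A (s r)) = (A q < A r).
  case: (ltngtP (A q) (A r)) => h; first exact: mono.
    by apply/negbTE; rewrite -leqNgt ltnW // mono.
  by rewrite (Ai _ _ h) ltnn.
pose rk p := #|[set q | A q < A p]|.
have rks q : rk (s q) = rk q.
  rewrite /rk -[RHS](card_imset _ (@perm_inj _ s)); apply: eq_card => r.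
  rewrite inE; apply/idP/imsetP => [h|[z]]; last by rewrite inE -mono' => h ->.
  by exists ((s^-1)%g r); rewrite ?permKV // inE -mono' permKV.
have rkmono q r : A q < A r -> rk q < rk r.
  move=> h; apply: proper_card; apply/properP; split.
    by apply/subsetP=> z; rewrite !inE => /ltn_trans; apply.
  by exists q; rewrite inE ?ltnn.
case: (ltngtP (A (s p)) (A p)) => // h; have := rkmono _ _ h; rewrite rks ltnn //.
Qed.

Lemma rearrangement_strict (T : finType) (A B : T -> nat) (s : {perm T}) :
  injective A -> (forall p q, A p < A q -> B p < B q) -> s != 1%g ->
  \sum_p A p * B (s p) < \sum_p A p * B p.
Proof.
move=> Ai AB s1.
have Bi : injective B.
  move=> p q e; apply: (Ai); case: (ltngtP (A p) (A q)) => // /AB; rewrite e ltnn //.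
have BA p q : B p < B q -> A p < A q.
  move=> h; case: (ltngtP (A p) (A q)) => // [/AB h2|/Ai e].
    by have := ltn_trans h h2; rewrite ltnn.
  by rewrite e ltnn in h.
pose F (s : {perm T}) := \sum_p A p * B (s p).
(* A maximiser of F has no inversion, since undoing one would increase F. *)
have maxid u : (forall v, F v <= F u) -> u = 1%g.
  move=> um; apply: (perm_mono_id Ai) => p q pq; rewrite ltnNge; apply/negP=> h.
  have pq' : p != q by apply: contraTneq pq => ->; rewrite ltnn.
  have {}h : B (u q) < B (u p).
    apply: AB; rewrite ltn_neqAle h andbT (inj_eq Ai) (inj_eq perm_inj) eq_sym //.
  have := um (tperm p q * u)%g; rewrite leqNgt => /negP; apply.
  have Fsplit v : F v = A p * B (v p) + A q * B (v q) + \sum_(i | (i != p) && (i != q)) A i * B (v i).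
    by rewrite /F (bigD1 p) //= (bigD1 q) 1?eq_sym //= addnA.
  rewrite !Fsplit !permM tpermL tpermR.
  rewrite [X in _ < _ + X](eq_bigr (fun i => A i * B (u i))) ?ltn_add2r.
    by clear -h pq; nia.
  move=> i /andP[ip iq]; rewrite permM tpermD // eq_sym //.
have [/= u _ um] := @arg_maxnP _ 1%g xpredT F isT.
have u1 : u = 1%g by apply: maxid => v; apply: um.
have F1 : F 1%g = \sum_p A p * B p by apply: eq_bigr => p _; rewrite perm1.
rewrite -F1 -u1 ltn_neqAle um // andbT; apply: contraNneq s1 => e.
by apply/eqP; apply: maxid => v; rewrite [F s]e; apply: um.
Qed.

Section ChainWeight.
Variables n k : nat.
Hypothesis k0 : 0 < k.
Hypothesis kn : k < n.

(** The forward distance from i to j modulo n, taken in 1..n: diagonal cells are the diameters. *)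
Definition ell (i j : nat) : nat := if i < j then j - i else j + n - i.
(* Strict concavity in the length makes the diagonal term of the minor of a
   crossing its unique heaviest term, by the rearrangement inequality. *)
Definition cell_wt (i j : nat) : nat := ell i j * (4 * n - ell i j).

Variables x y : 'I_k.+1 -> nat.
Hypothesis x_inc : forall p q : 'I_k.+1, p < q -> x p < x q.
Hypothesis y_inc : forall p q : 'I_k.+1, p < q -> y p < y q.
Hypothesis xy : forall p q, x p < y q.
Hypothesis xn : forall p, x p < n.
Hypothesis yn : forall p, y p < 2 * n.

(** [crow] and [ccol] are the ends of the segment or of its half turn, whichever has length at most
    n. *)
Definition crow p := maxn (x p) (y p - n).
Definition ccol p := minn (y p) (x p + n).

Lemma crow_lt p : crow p < n.
Proof. by rewrite /crow; have := xn p; have := yn p; lia. Qed.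

(** Moving the first [t] cells n further puts every row before every column, so the lengths of all
    terms of the minor become differences, up to n. *)
Lemma chain_window : exists t : nat,
  forall p q : 'I_k.+1, crow p + (p < t) * n < ccol q + (q < t) * n.
Proof.
have x_inc' (p q : 'I_k.+1) : p <= q -> x p <= x q.
  by rewrite leq_eqVlt => /orP[/eqP/ord_inj -> //|/x_inc/ltnW].
have y_inc' (p q : 'I_k.+1) : p <= q -> y p <= y q.
  by rewrite leq_eqVlt => /orP[/eqP/ord_inj -> //|/y_inc/ltnW].
have crow_inc (p q : 'I_k.+1) : p <= q -> crow p <= crow q.
  by move=> pq; have := x_inc' p q pq; have := y_inc' p q pq; rewrite /crow; clear; lia.
have ccol_inc (p q : 'I_k.+1) : p <= q -> ccol p <= ccol q.
  by move=> pq; have := x_inc' p q pq; have := y_inc' p q pq; rewrite /ccol; clear; lia.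
case: (ltnP (crow ord_max) (ccol ord0)) => C0.
  exists 0 => p q; rewrite !ltn0 !addn0.
  have := crow_inc p ord_max (leq_ord p); have := ccol_inc ord0 q (leq0n q); clear -C0; lia.
case: (boolP [exists t : 'I_k.+1, exists s : 'I_k.+1, (t == s.+1 :> nat) && (crow s + n < ccol t)]).
  move=> /existsP[t /existsP[s /andP[/eqP ts C]]]; exists t => p q.
  have := crow_lt p; case: (ltnP p t) => pt; case: (ltnP q t) => qt.
  - have h1 : p <= s by rewrite -ltnS -ts.
    have := xy p q; have := xy t q; have := yn p; have := xn p; have := y_inc' _ _ h1.
    by move: C; rewrite /crow /ccol; clear; lia.
  - have h1 : p <= s by rewrite -ltnS -ts.
    by have := crow_inc _ _ h1; have := ccol_inc _ _ qt; clear -C; lia.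
  - by have := xn q; have := xy q q; rewrite /ccol; clear; lia.
  - by have := ccol_inc _ _ qt; clear -C; lia.
rewrite negb_exists => /forallP nC.
have {}nC (s t : 'I_k.+1) : t = s.+1 :> nat -> ccol t <= crow s + n.
  by move=> ts; have := nC t; rewrite negb_exists => /forallP/(_ s); rewrite ts eqxx /= -leqNgt.
(* What the failure of t = 0 means. *)
have y0 : y ord0 + n <= y ord_max.
  have := xy ord_max ord0; have := xn ord_max; have := yn ord_max; move: C0; rewrite /crow /ccol; clear; lia.
(* Failure at every later break keeps each right end within n of the preceding left end; at the last
   index this contradicts [y0]. *)
have step (s t : 'I_k.+1) : t = s.+1 :> nat -> y t <= x s + n.
  move: s t => [s sk] [t tk] /= ts; subst t.
  elim: s sk tk => [|s IH] sk tk.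
    have := nC (Ordinal sk) (Ordinal tk) erefl; have -> : Ordinal sk = ord0 by apply: ord_inj.
    have := x_inc (p := ord0) (q := Ordinal tk) isT; have := y_inc (p := ord0) (q := Ordinal tk) isT.
    by have := yn ord_max; move: y0; rewrite /crow /ccol; clear; lia.
  have h := IH (ltnW sk) sk.
  have := nC (Ordinal sk) (Ordinal tk) erefl.
  have h1 : Ordinal (ltnW sk) < Ordinal sk by [].
  have h2 : Ordinal sk < Ordinal tk by [].
  have := x_inc h1; have := x_inc h2; have := y_inc h2.
  by move: h; rewrite /crow /ccol; clear; lia.
have kk : k.-1 < k.+1 by lia.
have := step (Ordinal kk) ord_max (esym (prednK k0)).
have h3 : Ordinal kk < (ord_max : 'I_k.+1) by clear -k0; rewrite /=; lia.
have := x_inc h3; have := xy ord_max ord0; clear -y0; lia.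
Qed.

Lemma cell_wt_chain (s : {perm 'I_k.+1}) : s != 1%g ->
  \sum_p cell_wt (crow p) (ccol (s p) %% n) < \sum_p cell_wt (crow p) (ccol p %% n).
Proof.
move=> s1; have [t tP] := chain_window.
pose A p := crow p + (p < t) * n; pose B p := ccol p + (p < t) * n.
have crow_inc (p q : 'I_k.+1) : p < q -> crow p < crow q.
  by move=> pq; have := x_inc pq; have := y_inc pq; rewrite /crow; clear; lia.
have ccol_inc (p q : 'I_k.+1) : p < q -> ccol p < ccol q.
  by move=> pq; have := x_inc pq; have := y_inc pq; rewrite /ccol; clear; lia.
have AB p q : A p < B q by apply: tP.
have Aw p q : A p < A q + n.
  have := crow_lt p; have := crow_lt q; rewrite /A; case: (ltnP p t) => pt; case: (ltnP q t) => qt; try (clear; lia).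
  by have := crow_inc _ _ (leq_trans pt qt); clear; lia.
have BA p : B p <= A p + n.
  by rewrite /A /B /crow /ccol; have := xy p p; have := xn p; have := yn p; clear; lia.
have BAlt p q : B q - A p < 2 * n by have := BA q; have := Aw q p; clear -kn; lia.
have ellE p q : ell (crow p) (ccol q %% n) = if B q - A p <= n then B q - A p else B q - A p - n.
  have cq : ccol q < 2 * n by rewrite /ccol; have := yn q; clear; lia.
  have mE : ccol q %% n = if ccol q < n then ccol q else ccol q - n.
    case: ltnP => h; first by rewrite modn_small.
    by rewrite -{1}(subnK h) modnDr modn_small //; clear -cq h; lia.
  have := AB p q; have := BAlt p q; have := crow_lt p; rewrite mE /A /B /ell.
  move: (crow p) (ccol q) cq => c d; case: (p < t); case: (q < t); rewrite ?mul1n ?mul0n ?addn0 => H1 H2 H3 H4;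
  case: (ltnP d n) => h1; case: ltnP => h2; case: leqP => h3; clear -H1 H2 H3 H4 h1 h2 h3; lia.
(* Off the diagonal the difference w = B q - A p may exceed n, and the true length is then w - n.
   The constant 4n makes w (4n - w) increasing up to 2n, so it still bounds the weight; on the
   diagonal there is equality. *)
have wle p q : cell_wt (crow p) (ccol q %% n) <= (B q - A p) * (4 * n - (B q - A p)).
  rewrite /cell_wt ellE; have H := BAlt p q; case: (leqP (B q - A p) n) => // h.
  move: (B q - A p) h H => w h H; have [u wE] : exists u, w = n + u by exists (w - n); clear -h; lia.
  rewrite wE addKn; have un : u <= n by clear -H wE; lia.
  by clear -un; nia.
have wid p : cell_wt (crow p) (ccol p %% n) = (B p - A p) * (4 * n - (B p - A p)).
  by rewrite /cell_wt ellE; have H := BA p; case: (leqP (B p - A p) n) => h //; clear -h H; lia.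
have L : \sum_p cell_wt (crow p) (ccol (s p) %% n) <=
    \sum_p (B (s p) - A p) * (4 * n - (B (s p) - A p)) by apply: leq_sum => p _; apply: wle.
apply: leq_ltn_trans L _.
rewrite (eq_bigr _ (fun p _ => wid p)).
have Ai : injective A.
  move=> p q e; apply: ord_inj; case: (ltngtP p q) => // h; have := crow_inc _ _ h; move: e; rewrite /A;
  have := crow_lt p; have := crow_lt q; case: (ltnP p t); case: (ltnP q t); clear -h; lia.
have ABm p q : A p < A q -> B p < B q.
  case: (ltngtP p q) => [h|h|/ord_inj -> ]; last by rewrite ltnn.
    have := ccol_inc _ _ h; have := crow_inc _ _ h; have := crow_lt p; have := crow_lt q; rewrite /A /B.
    by case: (ltnP p t); case: (ltnP q t) => h1 h2; clear -h h1 h2; lia.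
  have := ccol_inc _ _ h; have := crow_inc _ _ h; have := crow_lt p; have := crow_lt q; rewrite /A /B.
  case: (ltnP p t) => h1; case: (ltnP q t) => h2; try (clear -h h1 h2; lia).
  have := xy p q; have := yn p; rewrite /ccol; clear; lia.
have R := rearrangement_strict Ai ABm s1.
have E q p : (((B q - A p) * (4 * n - (B q - A p)))%:Z + (A p * A p)%:Z + (B q * B q)%:Z + (4 * n * A p)%:Z =
   (4 * n * B q)%:Z + 2 * (A p * B q)%:Z)%R.
  have := AB p q; have := BAlt p q; move: (A p) (B q) => a b h1 h2.
  by rewrite !PoszM -!subzn; clear -h1 h2; lia.
(* After expanding the quadratic, only the cross term depends on [u], and the rearrangement
   inequality applies to it. *)
have S (u : {perm 'I_k.+1}) :
   ((\sum_p (B (u p) - A p) * (4 * n - (B (u p) - A p)))%:Z =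
    \sum_p ((4 * n * B p)%:Z - (B p * B p)%:Z) - \sum_p ((A p * A p)%:Z + (4 * n * A p)%:Z) +
    2 * (\sum_p A p * B (u p))%:Z)%R.
  rewrite !(big_morph Posz PoszD (erefl : Posz 0 = 0%R)) mulr_sumr.
  rewrite [X in (_ = X - _ + _)%R](reindex_inj (@perm_inj _ u)) /=.
  rewrite -sumrB -big_split /=.
  apply: eq_bigr => p _; have := E (u p) p; clear; lia.
have := S s; have := S 1%g; under eq_bigr => p _ do rewrite perm1.
under [X in (_ + 2 * X%:Z)%R]eq_bigr => p _ do rewrite perm1.
by move=> h1 h2; rewrite -ltz_nat h1 h2 ltrD2l ltr_pM2l // ltz_nat.
Qed.

End ChainWeight.

(** A zero column and a zero row make both factors square, the second one singular. *)
Lemma det_mulmx_small (R : comNzRingType) k (A : 'M[R]_(k.+1, k)) (B : 'M[R]_(k, k.+1)) :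
  (\det (A *m B) = 0)%R.
Proof.
pose A' : 'M[R]_k.+1 := row_mx (0 : 'M_(k.+1, 1)) A.
pose B' : 'M[R]_k.+1 := col_mx (0 : 'M_(1, k.+1)) B.
have -> : (A *m B = A' *m B')%R by rewrite (mul_row_col (0 : 'M_(k.+1, 1)) A) mul0mx add0r.
rewrite det_mulmx (expand_det_row B' ord0) big1 ?mulr0 // => j _.
have -> : (ord0 : 'I_k.+1) = lshift k (ord0 : 'I_1) by apply: ord_inj.
by rewrite /B' (col_mxEu (0 : 'M_(1, k.+1)) B) mxE mul0r.
Qed.

Section Straightening.
Variables n k m : nat.
Hypothesis nE : n = m + k.
Hypothesis m0 : 0 < m.
Hypothesis k0 : 0 < k.
Local Notation V := ('I_n * 'I_m)%type.
Local Notation C := ('I_n * 'I_n)%type.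

Lemma n_gt0 : 0 < n. Proof. by rewrite nE addn_gt0 m0. Qed.

(** The strip covers the matrix cells of length above k; [good] constrains the support there and
    leaves the shorter cells free. *)
Definition strip_cell (p : V) : C := (p.1, Ordinal (ltn_pmod (p.1 + (k.+1 + p.2)) n_gt0)).
Definition strip_supp (e : C -> nat) : {set V} := [set p | 0 < e (strip_cell p)].
Definition good (e : C -> nat) : bool := Dstar_face k (orb nE m0 @: strip_supp e).

Lemma not_good_chain e : ~~ good e ->
  exists f g : 'I_k.+1 -> 'I_n,
  [/\ injective f, forall p, 0 < e (f p, g p)
    & forall s : {perm 'I_k.+1}, s != 1%g ->
      \sum_p cell_wt n (f p) (g (s p)) < \sum_p cell_wt n (f p) (g p)].
Proof.
rewrite /good (Dstar_faceE nE m0 k0) => ne.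
set S := strip_supp e in ne.
have keepE : keep n m (stripP S) = ~: S by apply/setP=> p; rewrite in_set stripPE in_setC.
have iff := demazure_w0_iff nE m0 (stripP S); rewrite keepE in iff.
have [s0 cs0] : exists s, crossing_chain n k (inA n k (stripP S)) s.
  case: (boolP [exists j : 'I_m.+1, (0 < j) && (k < lchain (blocked n k (stripP S) j) (j + k) (2 * m + k - j))]).
    move=> /existsP[j /andP[j0]]; apply: (lchain_chain nE); rewrite j0 -ltnS ltn_ord //.
  move=> /existsPn h; case/negP: ne; apply/eqP; apply/iff => j /andP[j0 jm].
  by have := h (Ordinal (jm : j < m.+1)); rewrite j0 /= -leqNgt.
have [s cs sn] := crossing_chain_rot cs0.
have [sz ss s2 sx sA] := cs.
pose P (i : 'I_k.+1) : nat * nat := nth (0, 0) s i.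
have Ps i : P i \in s by apply: mem_nth; rewrite sz.
pose x i := (P i).1; pose y i := (P i).2.
have lt (p q : 'I_k.+1) : p < q -> ltpair (P p) (P q).
  by move=> pq; apply: (sorted_ltn_nth ltpair_trans (0, 0) ss) => //; rewrite inE sz.
have x_inc (p q : 'I_k.+1) : p < q -> x p < x q by move=> /lt/andP[].
have y_inc (p q : 'I_k.+1) : p < q -> y p < y q by move=> /lt/andP[].
have xy p q : x p < y q by apply: sx.
have xn p : x p < n by apply: sn.
have yn p : y p < 2 * n by apply: s2.
have kn : k < n by rewrite nE; clear -m0; lia.
have rl p : crow n x y p < n by apply: crow_lt.
pose f p := Ordinal (rl p); pose g p := Ordinal (ltn_pmod (ccol n x y p) n_gt0).
exists f, g; split; last by move=> u u1; apply: cell_wt_chain.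
- move=> p q /(congr1 val) /= e'; apply: ord_inj; case: (ltngtP p q) => // h; move: e';
  have := x_inc _ _ h; have := y_inc _ _ h; rewrite /crow; clear; lia.
move=> p; have len := crossing_chain_len cs (Ps p); rewrite -/(x p) -/(y p) in len.
have [q] : exists q : V, [/\ q \in S, q.1 = crow n x y p :> nat & crow n x y p + (k.+1 + q.2) = ccol n x y p].
  have := sA _ (Ps p); rewrite /inA -/(x p) -/(y p) modn_small //.
  case: leqP => h /existsP[q /andP[qS /andP[/eqP q1 /eqP q2]]]; exists q; split=> //; rewrite -?q1 -?q2.
  - by rewrite /crow; clear -h; lia.
  - by rewrite /crow /ccol; clear -h len; lia.
  - have ny : n <= y p by clear -h; lia.
    rewrite -{1}(subnK ny) modnDr modn_small; last by have := yn p; clear -ny; lia.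
    by rewrite /crow; clear -h; lia.
  - by rewrite /crow /ccol; have := yn p; have := xn p; clear -h len; lia.
case; rewrite inE => eq q1 q2; congr (0 < e _): eq.
rewrite /strip_cell; congr pair; apply: ord_inj => //=.
by rewrite q1 q2.
Qed.

Section Span.
Variables (R : comNzRingType) (X : 'M[R]_n).
Hypothesis minor0 : forall f g : 'I_k.+1 -> 'I_n, (\det (\matrix_(i, j) X (f i) (g j)) = 0)%R.

Definition mono (e : C -> nat) : R := (\prod_c X c.1 c.2 ^+ e c)%R.
Definition edeg (e : C -> nat) : nat := \sum_c e c.
Definition ewt (e : C -> nat) : nat := \sum_c e c * cell_wt n c.1 c.2.

(** A monomial that is not good contains the diagonal term of a vanishing minor; exchanging it for
    the other terms lowers [ewt] and keeps the degree. [P] stands for any additive subgroup, such as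
    a linear span. *)
Lemma straighten (P : R -> Prop) r : P 0%R -> (forall u v, P u -> P v -> P (u - v)%R) ->
  (forall e, good e -> edeg e = r -> P (mono e)) -> forall e, edeg e = r -> P (mono e).
Proof.
move=> P0 PB Pg.
have PN u : P u -> P (- u)%R by move=> h; rewrite -sub0r; apply: PB.
have PD u v : P u -> P v -> P (u + v)%R by move=> h1 h2; rewrite -[v]opprK; apply: PB => //; apply: PN.
suff H w : forall e, ewt e < w -> edeg e = r -> P (mono e) by move=> e; apply: (H (ewt e).+1).
elim: w => [//|w IH] e ew er.
case: (boolP (good e)) => [ge|]; first exact: Pg.
move=> /not_good_chain[f [g [fi ep wl]]].
(* [d s] is the exponent vector of the term of the minor indexed by [s], and [es s] is [e] with the
   diagonal term exchanged for it. *)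
pose d (s : {perm 'I_k.+1}) (c : C) := \sum_p ((f p, g (s p)) == c).
pose e0 c := e c - d 1%g c.
pose es s c := e0 c + d s c.
have d1 c : d 1%g c <= e c.
  rewrite /d; case: (boolP [exists p, (f p, g p) == c]) => [/existsP[p /eqP pc]|/existsPn h].
    rewrite (bigD1 p) //= big1 ?addn0 => [|q qp]; first by rewrite perm1 pc eqxx -pc.
    apply/eqP; rewrite eqb0; apply: contraNneq qp => h; apply/eqP; apply: fi.
    by move: h; rewrite -pc => -[].
  by rewrite big1 // => p _; rewrite perm1 (negbTE (h p)).
have esE c : es 1%g c = e c by rewrite /es /e0 subnK.
have sumd s (F : C -> nat) : \sum_c d s c * F c = \sum_p F (f p, g (s p)).
  rewrite /d; under eq_bigr do rewrite big_distrl /=.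
  rewrite exchange_big /=; apply: eq_bigr => p _.
  rewrite (bigD1 (f p, g (s p))) //= eqxx mul1n big1 ?addn0 // => c cp.
  by rewrite eq_sym (negbTE cp).
have edegE s : edeg (es s) = edeg e0 + k.+1.
  rewrite /edeg /es big_split /=; congr (_ + _).
  have := sumd s (fun=> 1); under eq_bigr do rewrite muln1.
  by rewrite sum_nat_const muln1 card_ord.
have ewtE s : ewt (es s) = ewt e0 + \sum_p cell_wt n (f p) (g (s p)).
  rewrite /ewt /es; under eq_bigr do rewrite mulnDl.
  by rewrite big_split /= (sumd s (fun c => cell_wt n c.1 c.2)).
have monoE s : (mono (es s) = mono e0 * \prod_p X (f p) (g (s p)))%R.
  rewrite /mono /es; under eq_bigr do rewrite exprD.
  rewrite big_split /=; congr (_ * _)%R; rewrite /d.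
  under eq_bigr do rewrite expr_sum.
  rewrite exchange_big /=; apply: eq_bigr => p _.
  rewrite (bigD1 (f p, g (s p))) //= eqxx expr1 big1 ?mulr1 // => c cp.
  by rewrite eq_sym (negbTE cp).
have ext1 : [/\ mono (es 1%g) = mono e, edeg (es 1%g) = edeg e & ewt (es 1%g) = ewt e].
  by split; apply: eq_bigr => c _; rewrite esE.
have [E1 E2 E3] := ext1.
have D := minor0 f g; rewrite /determinant (bigD1 1%g) //= odd_perm1 expr0 mul1r in D.
have -> : (mono e = - \sum_(s : {perm 'I_k.+1} | s != 1%g) (-1) ^+ s * mono (es s))%R.
  rewrite -E1 monoE; move/eqP: D; rewrite addr_eq0 => /eqP D.
  transitivity (mono e0 * \prod_i (\matrix_(i, j) X (f i) (g j)) i ((1%g : {perm 'I_k.+1}) i))%R.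
    by congr (_ * _)%R; apply: eq_bigr => i _; rewrite !mxE.
  rewrite D mulrN mulr_sumr; congr (- _)%R; apply: eq_bigr => s _.
  rewrite monoE mulrCA; congr (_ * (_ * _))%R; apply: eq_bigr => i _; rewrite !mxE //.
apply: (PN); apply: (big_ind P) => // s s1.
have : P (mono (es s)).
  apply: IH; last by rewrite edegE -er -E2 edegE.
  rewrite ewtE; have := wl s s1; move: ew; rewrite -E3 ewtE ltnS.
  by under eq_bigr do rewrite perm1; clear; lia.
by case: (odd_perm s) => h; rewrite ?expr1 ?expr0 ?mul1r ?mulN1r //; apply: PN.
Qed.

End Span.
End Straightening.

(** * Leading terms of minors *)

Local Open Scope ring_scope.

(** Multilinearity in the rows. It serves for minors of a product, for the transfer step on chains
    and for Andreief's identity. *)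
Lemma det_sum_rows (R : comNzRingType) s (U : finType) (w : 'I_s -> U -> R) (g : U -> 'I_s -> R) :
  \det (\matrix_(i, j) \sum_y w i y * g y j) =
  \sum_(f : {ffun 'I_s -> U}) (\prod_i w i (f i)) * \det (\matrix_(i, j) g (f i) j).
Proof.
rewrite /determinant.
transitivity (\sum_(u : {perm 'I_s}) \sum_(f : {ffun 'I_s -> U})
    (-1) ^+ u * ((\prod_i w i (f i)) * \prod_i g (f i) (u i))).
  apply: eq_bigr => u _; rewrite -mulr_sumr; congr (_ * _).
  rewrite (eq_bigr (fun i => \sum_y w i y * g y (u i))) => [|i _]; last by rewrite mxE.
  by rewrite bigA_distr_bigA; apply: eq_bigr => f _; rewrite big_split.
rewrite exchange_big /=; apply: eq_bigr => f _; rewrite mulr_sumr; apply: eq_bigr => u _.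
rewrite mulrCA; congr (_ * (_ * _)); apply: eq_bigr => i _; rewrite mxE //.
Qed.

(** More than [#|A|] combinations satisfy a linear relation, in which the term of largest degree
    cannot cancel. *)
Lemma size_free_span (F : fieldType) N (J : finType) (A : pred J) (V : J -> {poly F}) (u : 'I_N -> {poly F}) :
  (forall i, u i != 0) -> injective (fun i => size (u i)) ->
  (forall i, exists c : J -> F, u i = \sum_(j | A j) c j *: V j) -> (N <= #|A|)%N.
Proof.
move=> u0 us uA.
have uA' i : exists c : {ffun J -> F}, u i == \sum_(j | A j) c j *: V j.
  have [c ->] := uA i; exists [ffun j => c j]; apply/eqP; apply: eq_bigr => j _; rewrite ffunE //.
pose c i := xchoose (uA' i).
have cE i : u i = \sum_(j | A j) c i j *: V j by apply/eqP; apply: (xchooseP (uA' i)).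
pose M := \matrix_(i < N, j < #|A|) c i (enum_val j).
rewrite leqNgt; apply/negP=> lt.
have rk : (\rank M < N)%N by apply: leq_ltn_trans (rank_leq_col _) lt.
have kM : kermx M != 0 by rewrite kermx_eq0 /row_free; apply: contraTneq rk => ->; rewrite ltnn.
have [r /rV0Pn[i ri] rM] : exists2 r : 'rV_N, r != 0 & r *m M = 0.
  have [i ri] : exists i, row i (kermx M) != 0.
    apply/existsP; apply: contraNT kM => /existsPn h; apply/eqP/row_matrixP=> i.
    by rewrite row0; apply/eqP; have := h i; rewrite negbK.
  by exists (row i (kermx M)); rewrite // -row_mul mulmx_ker row0.
have S0 : \sum_i r 0 i *: u i = 0.
  under eq_bigr do rewrite cE scaler_sumr.
  rewrite exchange_big /= big1 // => j Aj.
  under eq_bigr do rewrite scalerA.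
  rewrite -scaler_suml; suff -> : \sum_i r 0 i * c i j = 0 by rewrite scale0r.
  have /matrixP/(_ 0 (enum_rank_in Aj j)) := rM; rewrite !mxE => e; rewrite -[RHS]e.
  by apply: eq_bigr => i0 _; rewrite mxE enum_rankK_in.
have [p rp pm] := @arg_maxnP _ i (fun i => r 0 i != 0) (fun i => size (u i)) ri.
have /(congr1 (fun q : {poly F} => q`_(size (u p)).-1)) := S0.
rewrite coef0 coef_sum (bigD1 p) //= big1 => [|q qp].
  rewrite addr0 coefZ -lead_coefE => /eqP; rewrite mulf_eq0 lead_coef_eq0 (negbTE (u0 p)) orbF => rp0.
  by rewrite rp0 in rp.
rewrite coefZ; case: (eqVneq (r 0 q) 0) => [->|rq]; first by rewrite mul0r.
rewrite nth_default ?mulr0 // -ltnS prednK ?size_poly_gt0 ?u0 //.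
by rewrite ltn_neqAle (inj_eq us) qp; apply: pm.
Qed.

Local Open Scope nat_scope.

Lemma digits_inj B M (d d' : nat -> nat) : (forall t, d t < B) -> (forall t, d' t < B) ->
  \sum_(t < M) d t * B ^ t = \sum_(t < M) d' t * B ^ t -> forall t, t < M -> d t = d' t.
Proof.
elim: M d d' => [//|M IH] d d' dB d'B.
have E (e : nat -> nat) : \sum_(t < M.+1) e t * B ^ t = (\sum_(t < M) e t.+1 * B ^ t) * B + e 0.
  rewrite big_ord_recl muln1 addnC big_distrl /=; congr (_ + _).
  by apply: eq_bigr => t _; rewrite /bump /= add1n expnSr mulnA.
rewrite !E => e.
have e0 : d 0 = d' 0.
  by have := congr1 (modn^~ B) e; rewrite !modnMDl !modn_small.
have B0 : 0 < B by apply: leq_ltn_trans (leq0n _) (dB 0).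
move: e; rewrite e0 => /addIn/eqP; rewrite eqn_pmul2r // => /eqP/(IH (fun t => d t.+1) (fun t => d' t.+1)) h.
by case=> [//|t]; rewrite ltnS; apply: h.
Qed.

Lemma fin_digits_inj (J : finType) (pos : J -> nat) B (d d' : J -> nat) : injective pos ->
  (forall j, d j < B) -> (forall j, d' j < B) ->
  \sum_j d j * B ^ pos j = \sum_j d' j * B ^ pos j -> d =1 d'.
Proof.
move=> pi dB d'B e j.
have B0 : 0 < B by apply: leq_ltn_trans (leq0n _) (dB j).
pose M := (\max_i pos i).+1; have posM i : pos i < M by rewrite ltnS (leq_bigmax i).
pose D (f : J -> nat) t := if [pick i | pos i == t] is Some i then f i else 0.
have DE f i : D f (pos i) = f i.
  by rewrite /D; case: pickP => [i' /eqP/pi -> //|/(_ i)]; rewrite eqxx.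
have DB f : (forall i, f i < B) -> forall t, D f t < B.
  by move=> h t; rewrite /D; case: pickP.
have S f : \sum_(t < M) D f t * B ^ t = \sum_i f i * B ^ pos i.
  rewrite [RHS](partition_big (fun i => Ordinal (posM i)) xpredT) //=; apply: eq_bigr => t _.
  rewrite /D; case: pickP => [i /eqP it|h].
    rewrite (big_pred1 i) ?it // => i'; rewrite -(inj_eq val_inj) /= -it.
    by apply/eqP/eqP => [/pi|->].
  by rewrite big_pred0 // => i; rewrite -(inj_eq val_inj) /= h.
rewrite -DE -(DE d'); apply: (digits_inj (B := B) (M := M)) => //; rewrite ?S //; exact: DB.
Qed.

(** Comparison by the leading base-B digit: off [D] there are fewer than B terms, each at most B^(P0
    q0 - 1). *)
Lemma sum_exp_lt (Q : finType) B (D : pred Q) (P P0 : Q -> nat) q0 : #|Q| < B -> ~~ D q0 ->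
  (forall q, D q -> P q = P0 q) -> (forall q, ~~ D q -> P q < P0 q0) ->
  \sum_q B ^ P q < \sum_q B ^ P0 q.
Proof.
move=> QB Dq0 PD PN; rewrite (bigID D) [X in _ < X](bigID D) /=.
rewrite (eq_bigr (fun q => B ^ P0 q)) => [|q /PD -> //]; rewrite ltn_add2l.
rewrite [X in _ < X](bigD1 q0) //=; apply: leq_trans (leq_addr _ _).
have B0 : 0 < B by apply: leq_ltn_trans (leq0n _) QB.
have Pq := PN q0 Dq0; have : \sum_(q | ~~ D q) B ^ P q <= \sum_(q | ~~ D q) B ^ (P0 q0).-1.
  by apply: leq_sum => q /PN h; rewrite leq_pexp2l // -ltnS prednK // (leq_ltn_trans _ Pq).
move=> /leq_ltn_trans; apply; rewrite sum_nat_const -[in X in _ < X](prednK (leq_ltn_trans (leq0n _) Pq)) expnS.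
by rewrite ltn_pmul2r ?expn_gt0 ?B0 //; apply: leq_ltn_trans (max_card _) QB.
Qed.

Section Minors.
Variables (n k B : nat).
Hypothesis kB : 2 * k < B.
Hypothesis n0 : 0 < n.

(* A lexicographic order on the entries of Y and Z in base B: column 0 of Y is
   the largest, and within a column larger row indices are larger. *)
Definition ypos (a i : nat) : nat := n * k + (k - i.+1) * n + a.
Definition zpos (i b : nat) : nat := (k - i.+1) * n + b.
(** Kronecker substitution: with exponents below B, a monomial in the entries of Y and Z is
    recovered from its degree. *)
Definition Ymx : 'M[{poly rat}]_(n, k) := (\matrix_(a, i) 'X^(B ^ ypos a i))%R.
Definition Zmx : 'M[{poly rat}]_(k, n) := (\matrix_(i, b) 'X^(B ^ zpos i b))%R.
Definition Xmx : 'M[{poly rat}]_n := (Ymx *m Zmx)%R.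

Section Minor.
Variables (s : nat) (sk : s <= k) (a b : 'I_s -> 'I_n).
Hypothesis a_dec : forall p q : 'I_s, p < q -> a q < a p.
Hypothesis b_dec : forall p q : 'I_s, p < q -> b q < b p.

Definition lead_exp := \sum_p (B ^ ypos (a p) p + B ^ zpos p (b p)).

Definition term_exp (f : {ffun 'I_s -> 'I_k}) (u : {perm 'I_s}) :=
  \sum_p (B ^ ypos (a p) (f p) + B ^ zpos (f p) (b (u p))).

Let f0 : {ffun 'I_s -> 'I_k} := [ffun p => widen_ord sk p].

Lemma zpos_lt i b1 j b2 : j < k -> b1 < n -> b2 < n -> i < j \/ i = j /\ b2 < b1 -> zpos j b2 < zpos i b1.
Proof.
rewrite /zpos => jk b1n b2n [ij|[<- h]]; last by rewrite ltn_add2l.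
have -> : k - i.+1 = (k - i.+1).-1.+1 by clear -jk ij; lia.
have : k - j.+1 <= (k - i.+1).-1 by clear -ij; lia.
by move=> h; rewrite mulSn; have := leq_mul h (leqnn n); move: (_ * n) (_ * n) => A1 A2; clear -b2n; lia.
Qed.

Lemma zpos_lt_ypos i b1 a1 j : i < k -> j < k -> b1 < n -> zpos i b1 < ypos a1 j.
Proof.
rewrite /zpos /ypos => ik jk bn.
have : k - i.+1 <= k.-1 by clear; lia.
move=> /leq_mul/(_ (leqnn n)) h; have : n * k = k.-1 * n + n by rewrite -{1}(prednK (leq_ltn_trans (leq0n _) ik)) mulnS mulnC addnC.
move: ((k - i.+1) * n) ((k - j.+1) * n) (k.-1 * n) (n * k) h => A1 A2 A3 A4; clear -bn; lia.
Qed.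

(** At the first p with f p != p, injectivity forces f q >= p for all q >= p, so the entry of Y at
    (a p, p) exceeds all remaining entries. If f is the identity, the first p moved by [u] plays
    this part in Z. *)
Lemma term_exp_lt (f : {ffun 'I_s -> 'I_k}) (u : {perm 'I_s}) : injective f -> (f != f0) || (u != 1%g) -> term_exp f u < lead_exp.
Proof.
move=> fi; rewrite /term_exp /lead_exp !big_split /= => fu.
have E (P : 'I_s + 'I_s -> nat) : \sum_q B ^ P q = \sum_p B ^ P (inl p) + \sum_p B ^ P (inr p).
  exact: big_sumType.
pose P (q : 'I_s + 'I_s) := match q with inl p => ypos (a p) (f p) | inr p => zpos (f p) (b (u p)) end.
pose P0 (q : 'I_s + 'I_s) := match q with inl p => ypos (a p) p | inr p => zpos p (b p) end.
rewrite -(E P) -(E P0).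
have QB : #|{: 'I_s + 'I_s}| < B by rewrite card_sum card_ord; clear -kB sk; lia.
have ltk (p : 'I_s) : p < k by apply: leq_trans (ltn_ord p) sk.
case: (boolP (f == f0)) => [/eqP ff|ff].
  have u1 : u != 1%g by move: fu; rewrite ff eqxx.
  have [p1 up1] : exists p, u p != p.
    apply/existsP; apply: contraNT u1 => /existsPn h; apply/eqP/permP=> p; rewrite perm1.
    by apply/eqP; have := h p; rewrite negbK.
  have [p up pm] := @arg_minnP _ p1 (fun p => u p != p) val up1.
  have fix_lt (q : 'I_s) : q < p -> u q = q.
    by move=> qp; apply/eqP; apply: contraTT qp => /pm; rewrite -leqNgt.
  have upp (q : 'I_s) : p <= q -> p <= u q.
    move=> pq; rewrite leqNgt; apply/negP=> h; have := fix_lt _ h => /perm_inj e.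
    by rewrite e ltnNge pq in h.
  have fE q : f q = q :> nat by rewrite ff ffunE.
  apply: (@sum_exp_lt ('I_s + 'I_s)%type B (fun q => match q with inl _ => true | inr q => q < p end) P P0 (inr p)) => //=.
  - by rewrite ltnn.
  - by case=> q /= h; rewrite fE // fix_lt.
  case=> //= q; rewrite -leqNgt fE => pq; apply: zpos_lt => //.
  move: (pq); rewrite leq_eqVlt => /orP[/eqP pqE|]; [right|by left]; split=> //.
  have {pqE} -> : q = p by apply: ord_inj.
  by apply: b_dec; rewrite ltn_neqAle upp // andbT eq_sym.
have [p1 fp1] : exists p : 'I_s, (f p != p :> nat).
  apply/existsP; apply: contraNT ff => /existsPn h; apply/eqP/ffunP=> p; rewrite ffunE; apply: ord_inj.
  by apply/eqP; have := h p; rewrite negbK.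
have [p fp pm] := @arg_minnP _ p1 (fun p => f p != p :> nat) val fp1.
have fix_lt (q : 'I_s) : q < p -> f q = q :> nat.
  by move=> qp; apply/eqP; apply: contraTT qp => /pm; rewrite -leqNgt.
have fpp (q : 'I_s) : p <= q -> p <= f q.
  move=> pq; rewrite leqNgt; apply/negP=> h.
  have h' : f q < s by apply: ltn_trans h (ltn_ord p).
  have := fix_lt (Ordinal h') h => /= e; have /fi e2 : f (Ordinal h') = f q by apply: ord_inj.
  by rewrite -e2 /= leqNgt h in pq.
have Bk q b' : zpos (f q) (b b') < ypos (a p) p by apply: zpos_lt_ypos.
apply: (@sum_exp_lt ('I_s + 'I_s)%type B (fun q => match q with inl q => q < p | inr _ => false end) P P0 (inl p)) => //=.
- by rewrite ltnn.
- by case=> q //= h; rewrite fix_lt.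
case=> //= q; rewrite -leqNgt => pq; rewrite /ypos -!addnA ltn_add2l; apply: zpos_lt => //.
have := fpp q pq; rewrite leq_eqVlt => /orP[/eqP e|]; [right|by left]; split=> //.
apply: a_dec; rewrite ltn_neqAle pq andbT; apply: contraNneq fp => pqE.
by have -> : f p = f q by [congr (f _); apply: ord_inj]; rewrite -e.
Qed.

Lemma minor_lead : (size (\det (\matrix_(p, q) Xmx (a p) (b q))) = lead_exp.+1)%R.
Proof.
have -> : (\det (\matrix_(p, q) Xmx (a p) (b q)) =
   \sum_(f : {ffun 'I_s -> 'I_k}) (\prod_p 'X^(B ^ ypos (a p) (f p))) *
     \det (\matrix_(p, q) 'X^(B ^ zpos (f p) (b q))))%R.
  rewrite -(det_sum_rows (fun p (i : 'I_k) => 'X^(B ^ ypos (a p) i))%R (fun i q => 'X^(B ^ zpos i (b q)))%R).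
  congr (\det _)%R; apply/matrixP=> p q; rewrite !mxE; apply: eq_bigr => i _; rewrite !mxE //.
have XS (I : finType) (F : I -> nat) : (\prod_i 'X^(F i) = 'X^(\sum_i F i) :> {poly rat})%R.
  by rewrite (big_morph _ (exprD _) (expr0 _)).
have T (f : {ffun 'I_s -> 'I_k}) : ((\prod_p 'X^(B ^ ypos (a p) (f p))) * \det (\matrix_(p, q) 'X^(B ^ zpos (f p) (b q))) =
   \sum_(u : {perm 'I_s}) (-1) ^+ u * 'X^(term_exp f u) :> {poly rat})%R.
  rewrite /determinant mulr_sumr; apply: eq_bigr => u _; rewrite mulrCA; congr (_ * _)%R.
  rewrite /term_exp big_split /= exprD -!XS; congr (_ * _)%R; apply: eq_bigr => p _; rewrite mxE //.
have szT (v : bool) d : size ((-1) ^+ v * 'X^d : {poly rat})%R = d.+1.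
  by case: v; rewrite ?expr1 ?expr0 ?mul1r ?mulN1r ?size_polyN size_polyXn.
rewrite (bigD1 f0) //= T (bigD1 1%g) //= odd_perm1 expr0 mul1r -addrA.
have -> : term_exp f0 1%g = lead_exp.
  by apply: eq_bigr => p _; rewrite ffunE perm1.
rewrite size_polyDl size_polyXn // ltnS; apply: leq_trans (size_polyD _ _) _; rewrite geq_max; apply/andP; split.
  apply: leq_trans (size_sum _ _ _) _; apply/bigmax_leqP=> u u1; rewrite szT; apply: term_exp_lt.
    by move=> p q; rewrite !ffunE => /(congr1 val) /= /ord_inj.
  by rewrite u1 orbT.
apply: leq_trans (size_sum _ _ _) _; apply/bigmax_leqP=> f ff.
(* A repeated value of [f] gives a determinant with two equal rows. *)
case: (boolP (injectiveb f)) => [/injectiveP fi|/injectivePn[p [q pq fpq]]]; last first.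
  by rewrite (determinant_alternate pq) ?mulr0 ?size_poly0 // => r; rewrite !mxE fpq.
rewrite T; apply: leq_trans (size_sum _ _ _) _; apply/bigmax_leqP=> u _; rewrite szT; apply: term_exp_lt => //.
by rewrite ff.
Qed.

End Minor.
End Minors.

(** * Gelfand-Tsetlin patterns and products of minors *)

Local Open Scope nat_scope.

Section MonomialSpan.
Variables (n : nat) (R : comNzRingType) (X : 'M[R]_n).

(** Membership in the additive span of the degree-r monomials, in the impredicative form that
    matches the conclusion of [straighten]. *)
Definition mono_span r (v : R) : Prop := forall P : R -> Prop,
  P 0%R -> (forall u v, P u -> P v -> P (u - v)%R) ->
  (forall e, edeg e = r -> P (mono X e)) -> P v.

Lemma mono_span_sum (I : Type) (s : seq I) (Q : pred I) r (F : I -> R) :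
  (forall i, Q i -> mono_span r (F i)) -> mono_span r (\sum_(i <- s | Q i) F i)%R.
Proof.
move=> h P P0 PB Pm; apply: (big_ind P) => // [u v Pu Pv|i Qi]; last exact: h.
by rewrite -[v]opprK; apply: (PB) => //; rewrite -sub0r; apply: PB.
Qed.

Lemma mono_spanN r u : mono_span r u -> mono_span r (- u)%R.
Proof. by move=> h P P0 PB Pm; rewrite -sub0r; apply: (PB) => //; apply: (h P P0 PB Pm). Qed.

Lemma mono_spanM r s u v : mono_span r u -> mono_span s v -> mono_span (r + s) (u * v)%R.
Proof.
move=> hu hv P P0 PB Pm.
apply: (hu (fun u => P (u * v)%R)) => [|u1 u2 h1 h2|e er]; rewrite ?mul0r ?mulrBl //; first exact: PB.
apply: (hv (fun v => P (mono X e * v)%R)) => [|u1 u2 h1 h2|e' es]; rewrite ?mulr0 ?mulrBr //; first exact: PB.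
have -> : (mono X e * mono X e' = mono X (fun c => e c + e' c)%N)%R.
  by rewrite -big_split /=; apply: eq_bigr => c _; rewrite exprD.
by apply: Pm; rewrite /edeg big_split /= -er -es.
Qed.

Lemma mono_span1 : mono_span 0 1%R.
Proof.
move=> P P0 PB Pm; have -> : (1 = mono X (fun=> 0%N))%R by rewrite /mono big1.
by apply: Pm; rewrite /edeg big1.
Qed.

Lemma mono_span_entry a b : mono_span 1 (X a b).
Proof.
move=> P P0 PB Pm; have -> : (X a b = mono X (fun c => c == (a, b) : nat))%R.
  by rewrite /mono (bigD1 (a, b)) //= eqxx expr1 big1 ?mulr1 // => c /negbTE ->.
by apply: Pm; rewrite /edeg (bigD1 (a, b)) //= eqxx big1 // => c /negbTE ->.
Qed.

Lemma mono_span_prod N (r : 'I_N -> nat) (F : 'I_N -> R) :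
  (forall i, mono_span (r i) (F i)) -> mono_span (\sum_i r i) (\prod_i F i)%R.
Proof.
elim: N r F => [|N IH] r F h; first by rewrite !big_ord0; apply: mono_span1.
by rewrite !big_ord_recl; apply: mono_spanM => //; apply: IH.
Qed.

Lemma mono_span_det s (a b : 'I_s -> 'I_n) : mono_span s (\det (\matrix_(p, q) X (a p) (b q)))%R.
Proof.
apply: mono_span_sum => u _.
have h : mono_span s (\prod_i (\matrix_(p, q) X (a p) (b q)) i (u i))%R.
  have {1}-> : s = \sum_(i < s) 1 by rewrite sum_nat_const card_ord muln1.
  by apply: mono_span_prod => i; rewrite mxE; apply: mono_span_entry.
by case: (odd_perm u); rewrite ?expr1 ?expr0 ?mul1r ?mulN1r //; apply: mono_spanN.
Qed.

End MonomialSpan.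

Lemma sum_interval L a b : \sum_(c < L) ((a <= c) && (c < b) : nat) = minn b L - a.
Proof.
elim: L => [|L IH]; first by rewrite big_ord0 minn0.
by rewrite big_ord_recr /= IH; case: (leqP a L); case: (ltnP L b) => /= h1 h2; clear -h1 h2; lia.
Qed.

Section Patterns.
Variables (n k L B : nat).
Hypothesis n0 : 0 < n.
Hypothesis kB : 2 * k < B.
Hypothesis LB : L < B.

(* A Gelfand-Tsetlin pattern read from its top row lam 0 down to lam n = 0. *)
Definition pattern (lam : nat -> nat -> nat) : Prop :=
  [/\ forall i, i < k -> lam n i = 0,
      forall j i, j < n -> i < k -> lam j.+1 i <= lam j i,
      forall j i, j < n -> i.+1 < k -> lam j i.+1 <= lam j.+1 i
    & forall i, i < k -> lam 0 i <= L].

(* The semistandard tableau of the pattern: the entry in row i and column c. *)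
Definition jump (lam : nat -> nat -> nat) c i := find (fun j => lam j.+1 i <= c) (iota 0 n).
Definition height (top : nat -> nat) c := find (fun i => top i <= c) (iota 0 k).

Lemma pattern_mono lam i j j' : pattern lam -> i < k -> j <= j' -> j' <= n -> lam j' i <= lam j i.
Proof.
move=> [_ p2 _ _] ik; elim: j' => [|j' IH]; first by rewrite leqn0 => /eqP ->.
rewrite leq_eqVlt => /orP[/eqP -> //|jj' j'n]; apply: leq_trans (p2 j' i j'n ik) (IH jj' (ltnW j'n)).
Qed.

Lemma jumpP lam c i : pattern lam -> i < k -> c < lam 0 i ->
  [/\ jump lam c i < n, lam (jump lam c i).+1 i <= c & c < lam (jump lam c i) i].
Proof.
move=> plam ik ci; have [p1 p2 _ _] := plam.
have hs : has (fun j => lam j.+1 i <= c) (iota 0 n).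
  by apply/hasP; exists n.-1; rewrite ?mem_iota ?add0n /= ?ltn_predL // prednK // p1.
have lt : jump lam c i < n by rewrite -[n in _ < n](size_iota 0) -has_find.
split=> //; first by have := nth_find 0 hs; rewrite nth_iota.
case E : (jump lam c i) => [//|j]; have := @before_find _ 0 (fun j => lam j.+1 i <= c) (iota 0 n) j.
rewrite -/(jump lam c i) E ltnSn nth_iota ?add0n; last by rewrite -ltnS -E ltnW.
by move=> /(_ isT)/negbT; rewrite -ltnNge.
Qed.

Lemma jump_eq lam c i j : pattern lam -> i < k -> c < lam 0 i -> j < n ->
  (jump lam c i == j) = (lam j.+1 i <= c) && (c < lam j i).
Proof.
move=> plam ik ci jn; have [h1 h2 h3] := jumpP plam ik ci.
apply/eqP/andP => [<- //|[h4 h5]]; case: (ltngtP (jump lam c i) j) => // h.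
  by have := leq_trans (pattern_mono plam ik h (ltnW jn)) h2; rewrite leqNgt h5.
by have := leq_trans (pattern_mono plam ik h (ltnW h1)) h4; rewrite leqNgt h3.
Qed.

Lemma jump_dec lam c i : pattern lam -> i.+1 < k -> c < lam 0 i.+1 -> jump lam c i.+1 < jump lam c i.
Proof.
move=> plam ik ci; have [p1 p2 p3 _] := plam; have ik' := ltnW ik.
have ci' : c < lam 0 i by apply: leq_trans ci (leq_trans (p3 0 i n0 ik) (p2 0 i n0 ik')).
have [h1 h2 h3] := jumpP plam ik' ci'; have [h4 h5 h6] := jumpP plam ik ci.
rewrite ltnNge; apply/negP=> h; have := leq_trans h6 (p3 _ _ h4 ik).
by rewrite ltnNge (leq_trans _ h2) //; apply: pattern_mono.
Qed.

Lemma heightP lam c i : pattern lam -> i < k -> (i < height (lam 0) c) = (c < lam 0 i).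
Proof.
move=> plam ik; have [p1 p2 p3 _] := plam.
have mono0 i' i1 : i' <= i1 -> i1 < k -> lam 0 i1 <= lam 0 i'.
  elim: i1 => [|i1 IH]; first by rewrite leqn0 => /eqP ->.
  rewrite leq_eqVlt => /orP[/eqP -> //|h hk]; apply: leq_trans (p3 0 i1 n0 hk) _.
  by apply: leq_trans (p2 0 i1 n0 (ltnW hk)) (IH h (ltnW hk)).
apply/idP/idP => [h|h].
  have := before_find 0 h; rewrite nth_iota // add0n => /negbT; rewrite -ltnNge //.
rewrite ltnNge; apply/negP=> hi.
have hk : height (lam 0) c < k by apply: leq_ltn_trans hi ik.
have hs : has (fun i => lam 0 i <= c) (iota 0 k) by rewrite has_find size_iota.
have := nth_find 0 hs; rewrite nth_iota // add0n -/(height (lam 0) c) leqNgt.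
by rewrite (leq_trans h) //; apply: mono0.
Qed.

Lemma height_le top c : height top c <= k.
Proof. by rewrite -[X in _ <= X](size_iota 0) find_size. Qed.

Definition modrow x : 'I_n := Ordinal (ltn_pmod x n0).

Lemma modrow_jump lam c i : pattern lam -> i < k -> c < lam 0 i -> modrow (jump lam c i) = jump lam c i :> nat.
Proof. by move=> plam ik ci; rewrite /= modn_small //; case: (jumpP plam ik ci). Qed.

Lemma jump_dec_trans lam c i i' : pattern lam -> i < i' -> i' < k -> c < lam 0 i' -> jump lam c i' < jump lam c i.
Proof.
move=> plam; elim: i' => [//|i' IH]; rewrite ltnS leq_eqVlt => /orP[/eqP ->|ii'] ik ci; first exact: jump_dec.
apply: ltn_trans (jump_dec plam ik ci) (IH ii' (ltnW ik) _).
by have [_ p2 p3 _] := plam; apply: leq_trans ci (leq_trans (p3 0 i' n0 ik) (p2 0 i' n0 (ltnW ik))).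
Qed.

Definition col_minor (lam lam' : nat -> nat -> nat) c : {poly rat} :=
  (\det (\matrix_(p < height (lam 0) c, q < height (lam 0) c)
    Xmx n k B (modrow (jump lam c p)) (modrow (jump lam' c q))))%R.

(** For patterns with equal top row this is the bitableau of standard monomial theory: column c of
    the two tableaux selects the rows and columns of one minor. *)
Definition bitableau (lam lam' : nat -> nat -> nat) : {poly rat} := (\prod_(c < L) col_minor lam lam' c)%R.

(** lam j i - lam (j+1) i is the number of entries j in row i of the tableau, here a base-B digit of
    the leading exponent. *)
Definition pattern_exp (lam lam' : nat -> nat -> nat) : nat :=
  \sum_(i < k) \sum_(j < n) ((lam j i - lam j.+1 i) * B ^ ypos n k j i +
                             (lam' j i - lam' j.+1 i) * B ^ zpos n k i j).

Lemma sum_jump lam i (F : nat -> nat) : pattern lam -> i < k ->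
  \sum_(c < L | c < lam 0 i) F (jump lam c i) = \sum_(j < n) (lam j i - lam j.+1 i) * F j.
Proof.
move=> plam ik; have [p1 p2 p3 p4] := plam.
rewrite (partition_big (fun c : 'I_L => modrow (jump lam c i)) xpredT) //=; apply: eq_bigr => j _.
rewrite (eq_bigr (fun=> F j)) => [|c /andP[ci /eqP <-]]; last by rewrite (modrow_jump plam ik ci).
have le1 : lam j i <= lam 0 i by apply: pattern_mono => //; apply: ltnW.
rewrite sum_nat_const; congr (_ * _).
have := sum_interval L (lam j.+1 i) (lam j i).
have -> : minn (lam j i) L = lam j i by apply/minn_idPl; apply: leq_trans le1 (p4 i ik).
move=> <-; rewrite -sum1_card big_mkcond /=; apply: eq_bigr => c _; rewrite unfold_in /=.
case: (ltnP c (lam 0 i)) => ci /=.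
  have -> : (modrow (jump lam c i) == j) = (jump lam c i == j).
    by rewrite -val_eqE /= modn_small //; case: (jumpP plam ik ci).
  by rewrite (jump_eq plam ik ci (ltn_ord j)); case: (_ <= _ < _).
by rewrite [c < _]ltnNge (leq_trans le1 ci) andbF.
Qed.

Section Pair.
Variables (lam lam' : nat -> nat -> nat).
Hypothesis plam : pattern lam.
Hypothesis plam' : pattern lam'.
Hypothesis top : forall i, i < k -> lam 0 i = lam' 0 i.

Lemma size_bitableau : size (bitableau lam lam') = (pattern_exp lam lam').+1.
Proof.
have hk c (p : 'I_(height (lam 0) c)) : p < k /\ c < lam 0 p.
  have pk : p < k by apply: leq_trans (ltn_ord p) (height_le _ _).
  by split=> //; rewrite -heightP.
have hk' c (p : 'I_(height (lam 0) c)) : p < k /\ c < lam' 0 p.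
  by have [h1 h2] := hk c p; rewrite -top.
have szc (c : 'I_L) : size (col_minor lam lam' c) =
   (\sum_(i < k | c < lam 0 i) (B ^ ypos n k (jump lam c i) i + B ^ zpos n k i (jump lam' c i))).+1.
  rewrite /col_minor minor_lead //.
  - congr _.+1; rewrite /lead_exp.
    transitivity (\sum_(p < height (lam 0) c) (B ^ ypos n k (jump lam c p) p + B ^ zpos n k p (jump lam' c p))).
      apply: eq_bigr => p _; have [h1 h2] := hk c p; have [h1' h2'] := hk' c p.
      by rewrite (modrow_jump plam h1 h2) (modrow_jump plam' h1' h2').
    rewrite (big_ord_widen _ (fun p => B ^ ypos n k (jump lam c p) p + B ^ zpos n k p (jump lam' c p)) (height_le (lam 0) c)).
    by apply: eq_bigl => i; rewrite heightP.
  - exact: height_le.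
  - move=> p q pq; have [h1 h2] := hk c p; have [h3 h4] := hk c q.
    by rewrite (modrow_jump plam h1 h2) (modrow_jump plam h3 h4); apply: jump_dec_trans.
  move=> p q pq; have [h1 h2] := hk' c p; have [h3 h4] := hk' c q.
  by rewrite (modrow_jump plam' h1 h2) (modrow_jump plam' h3 h4); apply: jump_dec_trans.
rewrite /bitableau size_prod => [|c _]; last by rewrite -size_poly_eq0 szc.
under eq_bigr do rewrite szc -addn1; rewrite big_split /= sum1_card -addSn addnK; congr _.+1.
rewrite (exchange_big_dep xpredT) //=; apply: eq_bigr => i _.
rewrite !big_split /=; congr (_ + _).
  exact: (sum_jump (fun j => B ^ ypos n k j i)).
rewrite -(sum_jump (fun j => B ^ zpos n k i j)) //; apply: eq_bigl => c; rewrite top //.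
Qed.

Lemma mono_span_bitableau : mono_span (Xmx n k B) (\sum_(i < k) lam 0 i) (bitableau lam lam').
Proof.
have -> : \sum_(i < k) lam 0 i = \sum_(c < L) height (lam 0) c.
  transitivity (\sum_(c < L) \sum_(i < k | c < lam 0 i) 1).
    rewrite (exchange_big_dep xpredT) //=; apply: eq_bigr => i _.
    have := sum_interval L 0 (lam 0 i); have [_ _ _ p4] := plam.
    by rewrite subn0 (minn_idPl (p4 i (ltn_ord i))) => E; rewrite -[LHS]E [RHS]big_mkcond; apply: eq_bigr => c _; case: (c < _).
  apply: eq_bigr => c _; have := @big_ord_widen nat 0 addn _ k (fun=> 1) (height_le (lam 0) c).
  rewrite sum1_card card_ord => ->; apply: eq_bigl => i; rewrite heightP //.
by apply: mono_span_prod => c; apply: mono_span_det.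
Qed.

End Pair.

Lemma pos_inj : injective (fun q : ('I_k * 'I_n) + ('I_k * 'I_n) =>
  match q with inl p => ypos n k p.2 p.1 | inr p => zpos n k p.1 p.2 end).
Proof.
have zi (p q : 'I_k * 'I_n) : zpos n k p.1 p.2 = zpos n k q.1 q.2 -> p = q.
  case: p q => [i j] [i' j'] /= e.
  case: (ltngtP i i') => ii'.
  - by have := @zpos_lt n k i j i' j' (ltn_ord _) (ltn_ord _) (ltn_ord _) (or_introl ii'); rewrite e ltnn.
  - by have := @zpos_lt n k i' j' i j (ltn_ord _) (ltn_ord _) (ltn_ord _) (or_introl ii'); rewrite e ltnn.
  by move: e; rewrite /zpos ii' => /addnI jj'; congr pair; apply: ord_inj.
have yz (p q : 'I_k * 'I_n) : zpos n k p.1 p.2 < ypos n k q.2 q.1 by apply: zpos_lt_ypos.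
case=> p [] q //= e.
- by move: e; rewrite /ypos -!addnA => /addnI/zi ->.
- by have := yz q p; rewrite e ltnn.
- by have := yz p q; rewrite e ltnn.
by rewrite (zi p q e).
Qed.

(** The digits are at most L < B, hence determined; the pattern is rebuilt from its differences,
    starting at lam n = 0. *)
Lemma pattern_exp_inj lam lam' mu mu' : pattern lam -> pattern lam' -> pattern mu -> pattern mu' ->
  pattern_exp lam lam' = pattern_exp mu mu' ->
  forall j i, j <= n -> i < k -> lam j i = mu j i /\ lam' j i = mu' j i.
Proof.
move=> pl pl' pm pm' e.
pose d (la la' : nat -> nat -> nat) (q : ('I_k * 'I_n) + ('I_k * 'I_n)) :=
  match q with inl p => la p.2 p.1 - la p.2.+1 p.1 | inr p => la' p.2 p.1 - la' p.2.+1 p.1 end.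
have dB la la' : pattern la -> pattern la' -> forall q, d la la' q < B.
  move=> pa pa' [] [i j] /=; apply: leq_ltn_trans (leq_subr _ _) (leq_ltn_trans _ LB).
    by apply: leq_trans (pattern_mono pa _ (leq0n _) (ltnW _)) _ => //; case: pa => _ _ _; apply.
  by apply: leq_trans (pattern_mono pa' _ (leq0n _) (ltnW _)) _ => //; case: pa' => _ _ _; apply.
have E la la' : pattern_exp la la' = \sum_q d la la' q *
   B ^ (match q with inl p => ypos n k p.2 p.1 | inr p => zpos n k p.1 p.2 end).
  by rewrite big_sumType /= /pattern_exp pair_bigA big_split.
rewrite !E in e; have D := fin_digits_inj pos_inj (dB _ _ pl pl') (dB _ _ pm pm') e.
have rec la mu0 : pattern la -> pattern mu0 ->
  (forall (i : 'I_k) (j : 'I_n), la j i - la j.+1 i = mu0 j i - mu0 j.+1 i) ->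
  forall j i, j <= n -> i < k -> la j i = mu0 j i.
  move=> [a1 a2 _ _] [b1 b2 _ _] h j i jn ik; rewrite -(subKn jn); move: (n - j) (leq_subr j n) => t {j jn}.
  elim: t => [|t IH] tn; first by rewrite subn0 a1 // b1.
  have tn' : n - t.+1 < n by clear -n0 tn; lia.
  have := IH (ltnW tn); rewrite (_ : n - t = (n - t.+1).+1); last by clear -tn; lia.
  have := h (Ordinal ik) (Ordinal tn') => /=.
  by have := a2 _ _ tn' ik; have := b2 _ _ tn' ik; clear; lia.
move=> j i jn ik; split; apply: rec => // i' j'; first exact: (D (inl (i', j'))).
exact: (D (inr (i', j'))).
Qed.

End Patterns.

Section PatternCount.
Variables n k m : nat.
Hypothesis nE : n = m + k.
Hypothesis m0 : 0 < m.
Hypothesis k0 : 0 < k.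
Local Notation C := ('I_n * 'I_n)%type.

(** The bitableaux of the family have distinct degrees and lie in the span of the good monomials of
    degree r. Bounding exponents by [R] only makes the index set finite, since none exceeds r. *)
Lemma pattern_count (L r R : nat) (I : finType) (D : pred I) (lam lam' : I -> nat -> nat -> nat) : r <= R ->
  (forall x, D x -> [/\ pattern n k L (lam x), pattern n k L (lam' x),
     forall i, i < k -> lam x 0 i = lam' x 0 i & \sum_(i < k) lam x 0 i = r]) ->
  (forall x y, D x -> D y -> (forall j i, j <= n -> i < k -> lam x j i = lam y j i /\ lam' x j i = lam' y j i) -> x = y) ->
  #|D| <= #|[pred e : {ffun C -> 'I_R.+1} | good nE m0 (fun c => e c) & edeg (fun c => e c) == r]|.
Proof.
move=> rR DP Dinj.
have n0 := n_gt0 nE m0.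
pose B := (2 * k + L).+1.
have kB : 2 * k < B by rewrite ltnS leq_addr.
have LB : L < B by rewrite ltnS leq_addl.
pose u (x : I) := bitableau k L B n0 (lam x) (lam' x).
have su x : D x -> size (u x) = (pattern_exp n k B (lam x) (lam' x)).+1.
  by move=> /DP[h1 h2 h3 h4]; apply: size_bitableau.
apply: (@size_free_span _ _ _ _ (fun e : {ffun C -> 'I_R.+1} => mono (Xmx n k B) (fun c => e c)) (fun i => u (enum_val i))).
- by move=> i; rewrite -size_poly_eq0 su //; apply: (enum_valP i).
- move=> i j; have Di := enum_valP i; have Dj := enum_valP j.
  rewrite !su // => -[e]; apply: enum_val_inj; apply: Dinj => //.
  have [h1 h2 _ _] := DP _ Di; have [h3 h4 _ _] := DP _ Dj.
  exact: (pattern_exp_inj n0 LB h1 h2 h3 h4 e).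
move=> i; have Di := enum_valP i; have [h1 h2 h3 h4] := DP _ Di.
pose P (v : {poly rat}) := exists c : {ffun C -> 'I_R.+1} -> rat, v =
  (\sum_(e : {ffun C -> 'I_R.+1} | good nE m0 (fun c => e c) && (edeg (fun c => e c) == r)) c e *: mono (Xmx n k B) (fun c => e c))%R.
have P0 : P 0%R by exists (fun=> 0%R); rewrite big1 // => e _; rewrite scale0r.
have PB v w : P v -> P w -> P (v - w)%R.
  move=> [c ->] [d ->]; exists (fun e => c e - d e)%R.
  by rewrite -sumrB; apply: eq_bigr => e _; rewrite scalerBl.
have minor0 (f g : 'I_k.+1 -> 'I_n) : (\det (\matrix_(p, q) Xmx n k B (f p) (g q)) = 0)%R.
  have -> : (\matrix_(p, q) Xmx n k B (f p) (g q) = rowsub f (Ymx n k B) *m colsub g (Zmx n k B))%R.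
    apply/matrixP=> p q; rewrite !mxE; apply: eq_bigr => j _; rewrite !mxE //.
  exact: det_mulmx_small.
have Pm e : edeg e = r -> P (mono (Xmx n k B) e).
  apply: (@straighten n k m nE m0 k0 _ (Xmx n k B) minor0 P r) => // e' ge er.
  have le c : e' c <= r by rewrite -er /edeg (bigD1 c) //= leq_addr.
  pose e1 : {ffun C -> 'I_R.+1} := [ffun c => inord (e' c)].
  have e1E c : e1 c = e' c :> nat by rewrite ffunE inordK // ltnS (leq_trans _ rR).
  have g1 : good nE m0 (fun c => e1 c).
    rewrite /good; suff -> : strip_supp nE m0 (fun c => e1 c) = strip_supp nE m0 e' by [].
    by apply/setP=> p; rewrite !inE e1E.
  have d1 : edeg (fun c => e1 c) == r by apply/eqP; rewrite -[RHS]er; apply: eq_bigr => c _; rewrite e1E.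
  exists (fun e => (e == e1)%:R)%R.
  rewrite (bigD1 e1) ?g1 //= eqxx scale1r big1 ?addr0 => [|e2 /andP[_ /negbTE ->]]; last by rewrite scale0r.
  by apply: eq_bigr => c _; rewrite e1E.
have := @mono_span_bitableau n k L B n0 (lam (enum_val i)) (lam' (enum_val i)) h1.
by rewrite h4 => /(_ P P0 PB Pm).
Qed.

End PatternCount.

(** * Counting patterns by determinants *)

Local Open Scope nat_scope.

Lemma sum_ord_interval L a b (F : nat -> nat) : b <= L ->
  \sum_(y < L | (a <= y) && (y < b)) F y = \sum_(a <= y < b) F y.
Proof.
move=> bL; rewrite -(big_mkord (fun y => (a <= y) && (y < b))) -big_nat_widen //.
by rewrite [RHS](big_nat_widenl a 0).
Qed.

Section Transfer.
Variables k L : nat.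
Hypothesis k0 : 0 < k.
Local Notation S := {ffun 'I_k -> 'I_L}.

Definition decr (x : S) : bool := [forall i : 'I_k, forall j : 'I_k, (i < j) ==> (x j < x i)].
(** Adding the staircase k - 1, ..., 0 makes partitions strictly decreasing, and interlacing becomes
    x_(i+1) < y_i <= x_i, a separate condition on each y_i. *)
Definition prec (y x : S) : bool :=
  [forall i : 'I_k, (y i <= x i) && [forall j : 'I_k, (j == i.+1 :> nat) ==> (x j < y i)]].
Definition ground (x : S) : bool := [forall i : 'I_k, x i == k - i.+1 :> nat].
Definition chain n (x : S) (c : n.-tuple S) : bool := path (fun a b => prec b a) x c && ground (last x c).
Definition nchains n x : nat := #|[pred c : n.-tuple S | chain x c]|.

Lemma nchainsS n x : nchains n.+1 x = \sum_(y | prec y x) nchains n y.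
Proof.
rewrite /nchains -sum1_card big_mkcond /=.
rewrite (reindex (fun p : S * n.-tuple S => [tuple of p.1 :: p.2])) /=; last first.
  exists (fun c : n.+1.-tuple S => (thead c, [tuple of behead c])) => [[y c] _|c _] /=.
    by congr pair; apply: val_inj.
  by apply: val_inj; rewrite [c in RHS]tuple_eta.
rewrite [RHS]big_mkcond /=.
rewrite -[LHS](pair_bigA _ (fun (y : S) (c : n.-tuple S) => if chain x [tuple of y :: c] then 1 else 0)) /=.
apply: eq_bigr => y _; rewrite /chain /=; case: (prec y x) => /=; last by rewrite big1.
by rewrite -sum1_card [RHS]big_mkcond; apply: eq_bigr.
Qed.

Lemma nchains0 x : nchains 0 x = ground x.
Proof.
rewrite /nchains (eq_card (B := [pred c : 0.-tuple S | ground x])) => [|c]; last by rewrite !inE tuple0.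
case: (ground x); last exact: eq_card0.
by rewrite (eq_card (B := {: 0.-tuple S})) ?card_tuple // => c.
Qed.

(** The number of weakly decreasing walks of n steps from y to k - 1. *)
Fixpoint iter_sum n (y : nat) : nat :=
  if n is n'.+1 then \sum_(y' < y.+1) iter_sum n' y' else (y.+1 == k).

Arguments iter_sum : simpl never.

Lemma iter_sumS n y : iter_sum n.+1 y = \sum_(y' < y.+1) iter_sum n y'.
Proof. by []. Qed.

Lemma iter_sum_small n y : y.+1 < k -> iter_sum n y = 0.
Proof.
elim: n y => [|n IH] y yk; first by rewrite /iter_sum ltn_eqF.
by rewrite iter_sumS big1 // => y' _; apply: IH; apply: leq_ltn_trans yk; apply: ltn_ord.
Qed.

Lemma iter_sumE n y : iter_sum n.+1 y = if k <= y.+1 then 'C(y.+1 + n - k, n) else 0.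
Proof.
have r0 p : iter_sum p.+1 0 = iter_sum p 0 by rewrite iter_sumS big_ord1.
have rS p z : iter_sum p.+1 z.+1 = iter_sum p.+1 z + iter_sum p z.+1 by rewrite !iter_sumS big_ord_recr.
elim: n y => [|n IH] y; elim: y => [|y IHy].
- by rewrite r0 bin0 /iter_sum; case: leqP => h1; case: eqP => h2 //; clear -k0 h1 h2; lia.
- by rewrite rS IHy !bin0 /iter_sum; case: (leqP k y.+1) => h1; case: (leqP k y.+2) => h2; case: eqP => h3 //; clear -k0 h1 h2 h3; lia.
- rewrite r0 IH; case: leqP => // h; have -> : k = 1 by clear -k0 h; lia.
  by rewrite !add1n !subSS !subn0 !binn.
rewrite rS IHy IH; case: (leqP k y.+1) => h.
  have -> : k <= y.+2 by clear -h; lia.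
  have -> : y.+1 + n.+1 - k = y.+2 + n - k by clear -h; lia.
  by have -> : y.+2 + n.+1 - k = (y.+2 + n - k).+1 by [clear -h; lia]; rewrite binS.
case: leqP => // h2; have -> : k = y.+2 by clear -h h2; lia.
by rewrite !addKn !binn.
Qed.

Lemma decr_ge x (i : 'I_k) : decr x -> k - i.+1 <= x i.
Proof.
move=> /forallP dx; move e : (k - i.+1) => t; elim: t i e => [//|t IH] i e.
have ik : i.+1 < k by clear -e; lia.
have := IH (Ordinal ik); have /forallP/(_ (Ordinal ik))/implyP/(_ (ltnSn i)) := dx i.
by move=> h1 h2; apply: leq_ltn_trans h1; apply: h2; clear -e; rewrite /=; lia.
Qed.

Lemma decr_le x (i j : 'I_k) : decr x -> i <= j -> x j + (j - i) <= x i.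
Proof.
move=> /forallP dx; move e : (j - i) => t; elim: t j e => [|t IH] j e ij.
  by have -> : j = i by [apply: ord_inj; clear -e ij; lia]; rewrite addn0.
have jk : j.-1 < k by apply: leq_ltn_trans (leq_pred j) (ltn_ord j).
have j1 : j.-1 < j by clear -e; lia.
have /forallP/(_ j)/implyP/(_ j1) h1 := dx (Ordinal jk).
have h3 : x (Ordinal jk) + t <= x i by apply: IH; rewrite /=; clear -e; lia.
by clear -h1 h3; lia.
Qed.

Lemma prec_decr y x : prec y x -> decr y.
Proof.
move=> /forallP h; apply/forallP=> i; apply/forallP=> j; apply/implyP.
have st (p q : 'I_k) : q = p.+1 :> nat -> y q < y p.
  move=> e; have /andP[_ /forallP/(_ q)/implyP/(_ (introT eqP e)) h1] := h p.
  by have /andP[h2 _] := h q; apply: leq_ltn_trans h1.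
move e : (j - i.+1) => t; elim: t j e => [|t IH] j e ij; first by apply: st; clear -e ij; lia.
have jk : j.-1 < k by apply: leq_ltn_trans (leq_pred j) (ltn_ord j).
apply: ltn_trans (st (Ordinal jk) j _) (IH (Ordinal jk) _ _); rewrite /=; clear -e ij; lia.
Qed.

(** Interlacing restricts each row to an interval, so multilinearity moves the sum over [y] inside
    the determinant. *)
Lemma nchains_det n x : decr x ->
  ((nchains n x)%:R = \det (\matrix_(i, j) (iter_sum n (x i + j))%:R) :> rat)%R.
Proof.
elim: n x => [|n IH] x dx.
  rewrite nchains0; case: (boolP (ground x)) => [/forallP gx|].
    rewrite (_ : \matrix_(i, j) _ = 1%:M)%R ?det1 //; apply/matrixP=> i j; rewrite !mxE /iter_sum; congr (_%:R)%R.
    rewrite (eqP (gx i)) -[i == j]val_eqE /=; congr nat_of_bool.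
    by have := ltn_ord i; have := ltn_ord j; clear; lia.
  rewrite negb_forall => /existsP[i xi].
  (* A decreasing sequence other than the staircase has first entry at least k, so its row of the
     matrix vanishes. *)
  pose i0 := Ordinal (leq_ltn_trans (leq0n i) (ltn_ord i)).
  have xk : k <= x i0.
    have := @decr_le x i0 i dx (leq0n i); rewrite subn0.
    by have := decr_ge i dx; have := ltn_ord i; move: xi; clear; lia.
  rewrite (expand_det_row _ i0) big1 //= => j _; rewrite mxE /iter_sum gtn_eqF ?mul0r //.
  by clear -xk; lia.
rewrite nchainsS natr_sum.
rewrite (eq_bigr (fun y : S => \det (\matrix_(i, j) (iter_sum n (y i + j))%:R)))%R => [|y /prec_decr/IH //].
pose w (i : 'I_k) (y : 'I_L) := (y <= x i) && [forall j : 'I_k, (j == i.+1 :> nat) ==> (x j < y)].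
have -> : (\sum_(y | prec y x) \det (\matrix_(i, j) (iter_sum n (y i + j))%:R) =
   \det (\matrix_(i, j) \sum_(y : 'I_L) (w i y)%:R * (iter_sum n (y + j))%:R) :> rat)%R.
  rewrite (det_sum_rows (fun i y => (w i y)%:R)%R (fun (y : 'I_L) j => (iter_sum n (y + j))%:R)%R).
  rewrite big_mkcond; apply: eq_bigr => y _; case: (boolP (prec y x)) => [/forallP h|].
    by rewrite big1 ?mul1r // => i _; rewrite /w h.
  by rewrite negb_forall => /existsP[i h]; rewrite (bigD1 i) //= /w (negbTE h) !mul0r.
(* A sum over x_(i+1) < y <= x_i is a difference of two partial sums, that is, of two rows of the
   next matrix. *)
pose U : 'M[rat]_k := (\matrix_(i, j) ((j == i)%:R - (j == i.+1 :> nat)%:R))%R.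
have -> : (\matrix_(i, j) \sum_(y : 'I_L) (w i y)%:R * (iter_sum n (y + j))%:R =
   U *m \matrix_(i, j) (iter_sum n.+1 (x i + j))%:R :> 'M[rat]_k)%R.
  apply/matrixP=> i j; rewrite !mxE.
  (* The shift by j < k is harmless: [iter_sum n] vanishes at arguments below j. *)
  have RE z : iter_sum n.+1 (z + j) = \sum_(0 <= y < z.+1) iter_sum n (y + j).
    rewrite iter_sumS -(big_mkord xpredT) (@big_cat_nat _ _ _ j) //=; last by rewrite -addSn leq_addl.
    rewrite big_nat big1 ?add0n => [|y /andP[_ yj]]; last first.
      by apply: iter_sum_small; apply: leq_ltn_trans (ltn_ord j).
    by rewrite -{1}[nat_of_ord j]add0n big_addn -addSn addnK; apply: eq_bigr.
  under [RHS]eq_bigr do rewrite !mxE mulrBl.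
  rewrite sumrB (bigD1 i) // eqxx mul1r [X in (_ + X - _)%R]big1 => [|i' /andP[_ /negbTE ->]]; last by rewrite mul0r.
  rewrite addr0; apply/eqP; rewrite eq_sym subr_eq; apply/eqP.
  have [lo [lo_le wE ->]] : exists lo, [/\ lo <= (x i).+1, forall y, w i y = (lo <= y) && (y < (x i).+1) &
    (\sum_(i' : 'I_k) (i' == i.+1 :> nat)%:R * (iter_sum n.+1 (x i' + j))%:R =
      (\sum_(0 <= y < lo) iter_sum n (y + j))%:R :> rat)%R].
    case: (ltnP i.+1 k) => ik.
      pose i1 := Ordinal ik; exists (x i1).+1; split.
      - by have /forallP/(_ i)/forallP/(_ i1)/implyP/(_ (ltnSn _)) := dx => /ltnW.
      - move=> y; rewrite /w ltnS andbC; congr (_ && _); apply/forallP/idP => [/(_ i1)|h j']; first by rewrite eqxx.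
        by apply/implyP=> /eqP e; have -> : j' = i1 by apply: ord_inj.
      rewrite (bigD1 i1) //= eqxx mul1r [X in (_ + X)%R]big1 ?addr0 => [|i' h]; last first.
        by rewrite -[_ == _ :> nat]/(i' == i1) (negbTE h) mul0r.
      by rewrite -RE.
    exists 0; split=> //.
    - move=> y; rewrite /w leq0n ltnS /=; case: (y <= x i) => //=; apply/forallP=> j'; apply/implyP=> /eqP e.
      by have := ltn_ord j'; rewrite e ltnNge ik.
    rewrite big_geq // big1 // => i' _; rewrite (_ : (i' == i.+1 :> nat) = false) ?mul0r //.
    by apply/eqP=> e; have := ltn_ord i'; rewrite e ltnNge ik.
  have -> : (\sum_(y : 'I_L) (w i y)%:R * (iter_sum n (y + j))%:R =
      (\sum_(lo <= y < (x i).+1) iter_sum n (y + j))%:R :> rat)%R.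
    rewrite -(sum_ord_interval lo (fun y => iter_sum n (y + j)) (ltn_ord (x i))) natr_sum [RHS]big_mkcond.
    by apply: eq_bigr => y _; rewrite wE; case: (_ && _); rewrite ?mul1r ?mul0r.
  by rewrite RE (@big_cat_nat _ _ _ lo 0) //= natrD addrC.
have U1 : (\det U = 1)%R.
  rewrite -det_tr det_unitrig // => [i j ij|i]; rewrite !mxE.
    by rewrite -val_eqE /= !ltn_eqF ?subr0 // ltnS ltnW.
  by rewrite eqxx ltn_eqF // subr0.
by rewrite det_mulmx U1 mul1r.
Qed.

(** Vandermonde's convolution splits off the column shift [j] as a unitriangular factor, leaving
    functions of x i + m alone. *)
Lemma nchains_bin n m x : n = m + k -> decr x ->
  ((nchains n x)%:R = \det (\matrix_(i < k, j < k) ('C(x i + m, n.-1 - j))%:R) :> rat)%R.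
Proof.
move=> nE dx; rewrite nchains_det //.
have n0 : n = n.-1.+1 by clear -nE k0; lia.
have E y : iter_sum n y = 'C(y + m, n.-1).
  rewrite n0 iter_sumE /=; case: leqP => h; last by rewrite bin_small //; clear -h nE; lia.
  by congr 'C(_, _); clear -h nE k0; lia.
have -> : (\matrix_(i < k, j < k) (iter_sum n (x i + j))%:R =
  (\matrix_(i < k, j < k) ('C(x i + m, n.-1 - j))%:R) *m (\matrix_(l < k, j < k) ('C(j, l))%:R) :> 'M[rat]_k)%R.
  apply/matrixP=> i j; rewrite !mxE E addnAC addnC -binomial.Vandermonde natr_sum.
  have kn : k <= n.-1.+1 by clear -nE k0; lia.
  rewrite -(big_mkord xpredT (fun l => ('C(j, l) * 'C(x i + m, n.-1 - l))%:R%R)) /=.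
  rewrite (@big_cat_nat _ _ _ k) //= [X in (_ + X)%R]big_nat [X in (_ + X)%R]big1 => [|l /andP[kl _]]; last first.
    by rewrite bin_small ?mul0n // (leq_trans (ltn_ord j)).
  by rewrite addr0 big_mkord; apply: eq_bigr => l _; rewrite !mxE natrM mulrC.
rewrite det_mulmx -[X in (_ * X)%R]det_tr [X in (_ * X)%R]det_unitrig ?mulr1 // => [i j ij|i]; rewrite !mxE ?binn // bin_small //.
Qed.

Definition excess (x : S) : nat := \sum_i (x i - (k - i.+1)).

Definition at_ (x : S) (i : nat) : nat := if insub i is Some i' then x i' : nat else 0.

Lemma at_E x (i : 'I_k) : at_ x i = x i.
Proof. by rewrite /at_ valK. Qed.

Lemma at_Ord x i (ik : i < k) : at_ x i = x (Ordinal ik).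
Proof. by rewrite -at_E. Qed.

Definition lam_of n (x : S) (c : n.-tuple S) (j i : nat) : nat := at_ (nth x (x :: c) j) i - (k - i.+1).

Lemma chain_prec n (x : S) (c : n.-tuple S) j : chain x c -> j < n ->
  prec (nth x (x :: c) j.+1) (nth x (x :: c) j).
Proof. by move=> /andP[/(pathP x) h _] jn; apply: h; rewrite size_tuple. Qed.

Lemma chain_ground n (x : S) (c : n.-tuple S) : chain x c -> ground (nth x (x :: c) n).
Proof. by move=> /andP[_]; rewrite (last_nth x) size_tuple. Qed.

Lemma chain_ge n (x : S) (c : n.-tuple S) j (i : 'I_k) : chain x c -> j <= n -> k - i.+1 <= nth x (x :: c) j i.
Proof.
move=> cx jn; rewrite -(subKn jn); move: (n - j) (leq_subr j n) => t {j jn}.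
elim: t => [|t IH] tn; first by rewrite subn0; have /forallP/(_ i)/eqP -> := chain_ground cx.
have tn' : n - t.+1 < n by clear -tn; lia.
have /forallP/(_ i)/andP[h _] := chain_prec cx tn'; apply: leq_trans h.
by rewrite (_ : (n - t.+1).+1 = n - t); [apply: IH; apply: ltnW|clear -tn; lia].
Qed.

Lemma pattern_lam_of n (x : S) (c : n.-tuple S) : chain x c -> pattern n k L (lam_of x c).
Proof.
move=> cx; split.
- move=> i ik; rewrite /lam_of (at_Ord _ ik).
  by have /forallP/(_ (Ordinal ik))/eqP -> := chain_ground cx; rewrite subnn.
- move=> j i jn ik; rewrite /lam_of !(at_Ord _ ik) leq_sub2r //.
  by have /forallP/(_ (Ordinal ik))/andP[] := chain_prec cx jn.
- move=> j i jn ik; rewrite /lam_of (at_Ord _ ik) (at_Ord _ (ltnW ik)).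
  have /forallP/(_ (Ordinal (ltnW ik)))/andP[_ /forallP/(_ (Ordinal ik))/implyP/(_ (eqxx _))] := chain_prec cx jn.
  by move: (nat_of_ord _) (nat_of_ord _) => u v; clear -ik; lia.
move=> i ik; rewrite /lam_of (at_Ord _ ik).
by apply: leq_trans (leq_subr _ _) (ltnW (ltn_ord _)).
Qed.

Lemma lam_of_inj n (x y : S) (c d : n.-tuple S) : chain x c -> chain y d ->
  (forall j i, j <= n -> i < k -> lam_of x c j i = lam_of y d j i) -> x = y /\ c = d.
Proof.
move=> cx dy h.
have E j : j <= n -> nth x (x :: c) j = nth y (y :: d) j.
  move=> jn; apply/ffunP=> i; apply: ord_inj; have := h j i jn (ltn_ord i); rewrite /lam_of !at_E.
  by move=> h1; rewrite -(subnK (chain_ge i cx jn)) h1 subnK //; apply: chain_ge.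
have xy : x = y by have := E 0 (leq0n n).
split=> //; apply: val_inj; apply: (@eq_from_nth _ x); rewrite !size_tuple // => j jn.
by have := E j.+1 jn => /= ->; apply: set_nth_default; rewrite size_tuple.
Qed.

End Transfer.

(** Two chains from the same [x] are two patterns with a common top row of size [excess x], whence
    the squares. *)
Lemma nchains_good n k m (nE : n = m + k) (m0 : 0 < m) (k0 : 0 < k) L r R : r <= R ->
  \sum_(x : {ffun 'I_k -> 'I_L} | excess x == r) nchains n x ^ 2 <=
  #|[pred e : {ffun 'I_n * 'I_n -> 'I_R.+1} | good nE m0 (fun c => e c) & edeg (fun c => e c) == r]|.
Proof.
move=> rR; pose S := {ffun 'I_k -> 'I_L}.
pose D (p : S * (n.-tuple S * n.-tuple S)) := [&& excess p.1 == r, chain p.1 p.2.1 & chain p.1 p.2.2].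
have -> : \sum_(x : S | excess x == r) nchains n x ^ 2 = #|D|.
  rewrite -sum1_card (eq_bigl (fun p : S * (n.-tuple S * n.-tuple S) => (excess p.1 == r) &&
    (chain p.1 p.2.1 && chain p.1 p.2.2))) //.
  rewrite -(pair_big_dep (fun x : S => excess x == r) (fun x q => chain x q.1 && chain x q.2) (fun _ _ => 1)) /=.
  apply: eq_bigr => x _; rewrite -(pair_big (fun c : n.-tuple S => chain x c) (fun c : n.-tuple S => chain x c) (fun _ _ => 1)) /=.
  by rewrite sum_nat_const sum1_card -mulnn.
apply: (@pattern_count n k m nE m0 k0 L r R _ D (fun p => lam_of p.1 p.2.1) (fun p => lam_of p.1 p.2.2)) => //.
  move=> [x [c d]] /and3P[/= /eqP xr cx dx]; split=> //; try exact: pattern_lam_of.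
  by rewrite -xr; apply: eq_bigr => i _; rewrite /lam_of /= at_E.
move=> [x [c d]] [y [c' d']] /and3P[/= _ cx dx] /and3P[/= _ cy dy] h.
have [-> ->] := lam_of_inj cx cy (fun j i jn ik => proj1 (h j i jn ik)).
by have [_ ->] := lam_of_inj dx dy (fun j i jn ik => proj2 (h j i jn ik)).
Qed.

(** * Andreief's inequality and the Hilbert series *)

Local Open Scope ring_scope.

Lemma geom_le (t : rat) R : 0 <= t < 1 -> \sum_(s < R) t ^+ s <= (1 - t)^-1.
Proof.
move=> /andP[t0 t1]; have h : 0 < 1 - t by rewrite subr_gt0.
rewrite -[X in _ <= X]mul1r ler_pdivlMr // mulrC.
have -> : (1 - t) * (\sum_(s < R) t ^+ s) = 1 - t ^+ R.
  by rewrite -[1 - t ^+ R]opprB subrX1 -mulNr opprB.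
by rewrite gerBl exprn_ge0.
Qed.

Section GoodCount.
Variables n k m : nat.
Hypothesis nE : n = (m + k)%N.
Hypothesis m0 : (0 < m)%N.
Hypothesis k0 : (0 < k)%N.
Local Notation V := ('I_n * 'I_m)%type.
Local Notation C := ('I_n * 'I_n)%type.

Lemma strip_cell_inj : injective (strip_cell (k := k) nE m0).
Proof.
move=> [a r] [a' r'] [] /= ea; subst a' => /eqP; rewrite eqn_modDl => e; congr pair; apply: ord_inj.
wlog le : r r' e / (r <= r')%N.
  by move=> H; case: (leqP r r') => [|/ltnW] h; [apply: H|apply/esym/H; rewrite // eq_sym].
move: e; rewrite eq_sym eqn_mod_dvd ?leq_add2l // subnDl => d.
apply/eqP; rewrite eqn_leq le -subn_eq0; apply/eqP; case: (posnP (r' - r)) => // h.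
have := dvdn_leq h d; have := ltn_ord r'; have mn : (m <= n)%N by rewrite nE leq_addr.
by move: (nat_of_ord r') (nat_of_ord r) mn => u v; clear; lia.
Qed.

(** The cells on which a monomial supported by the facet [F] is free: all but the m^2 cells of its
    reduced word. *)
Definition allowed (F : {set V}) : {set C} := ~: (strip_cell (k := k) nE m0 @: ~: F).

Lemma card_allowed F : F \in facetsB n m -> #|allowed F| = (n ^ 2 - m ^ 2)%N.
Proof.
move=> /(facetsB_card nE) cF.
have := cardsC (strip_cell (k := k) nE m0 @: ~: F); rewrite -/(allowed F).
rewrite card_imset; last exact: strip_cell_inj.
have := cardsC F; rewrite cF !card_prod !card_ord; have := nE.
by move: #|_| #|_| => u v; clear; nia.
Qed.

(** The strip support of a good monomial lies in some facet; each facet contributes at most one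
    geometric series per allowed cell. *)
Lemma good_count R (t : rat) : 0 <= t < 1 ->
  \sum_(e : {ffun C -> 'I_R.+1} | good nE m0 (fun c => e c)) t ^+ edeg (fun c => e c) <=
  (T n k)%:R * (1 - t)^-1 ^+ (n ^ 2 - m ^ 2).
Proof.
move=> t01; have /andP[t0 t1] := t01.
have tX s : 0 <= t ^+ s by apply: exprn_ge0.
pose G (F : {set V}) (c : C) (s : 'I_R.+1) : rat :=
  if (c \in allowed F) || (s == 0%N :> nat) then t ^+ s else 0.
have G0 F c s : 0 <= G F c s by rewrite /G; case: ifP.
rewrite (T_facetsB nE m0 k0).
have step1 : \sum_(e : {ffun C -> 'I_R.+1} | good nE m0 (fun c => e c)) t ^+ edeg (fun c => e c) <=
   \sum_(F in facetsB n m) \sum_(e : {ffun C -> 'I_R.+1}) \prod_c G F c (e c).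
  rewrite exchange_big /= big_mkcond; apply: ler_sum => e _.
  have P0 F : 0 <= \prod_c G F c (e c) by apply: prodr_ge0 => c _.
  case: ifP => [ge|_]; last by apply: sumr_ge0.
  have [F FB eF] := face_facetB k0 ge.
  rewrite (bigD1 F) //= ler_wpDr ?sumr_ge0 //.
  rewrite /edeg expr_sum ler_prod // => c _; rewrite tX /G.
  case: ifP => //= /negbT; rewrite negb_or in_setC negbK => /andP[/imsetP[p pF cE] e0].
  by move: pF; rewrite inE (subsetP eF) // inE -cE lt0n.
apply: le_trans step1 _; rewrite mulrC -[#|_|]sum1_card natr_sum mulr_sumr mulr1; apply: ler_sum => F FB.
rewrite -bigA_distr_bigA -(card_allowed FB) -prodr_const.
rewrite [X in _ <= X]big_mkcond; apply: ler_prod => c _; rewrite sumr_ge0 //=.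
rewrite /G; case: (c \in allowed F) => /=; first exact: geom_le.
by rewrite big_mkcond /= big_ord_recl /= big1 ?addr0.
Qed.

(** The sum of the entries is at least [excess x], so with t < 1 the change of weight goes in the
    right direction; [k * L] bounds every excess. *)
Lemma nchains_sum_le L (t : rat) : 0 <= t < 1 ->
  \sum_(x : {ffun 'I_k -> 'I_L} | decr x) t ^+ (\sum_i x i)%N * (nchains n x)%:R ^+ 2 <=
  (T n k)%:R * (1 - t)^-1 ^+ (n ^ 2 - m ^ 2).
Proof.
move=> t01; have /andP[t0 t1] := t01.
have tX s : 0 <= t ^+ s by apply: exprn_ge0.
pose S : finType := {ffun 'I_k -> 'I_L}; pose R := (k * L)%N.
have exR (x : S) : (excess x < R.+1)%N.
  rewrite ltnS /R -[k in (k * L)%N]card_ord -sum_nat_const; apply: leq_sum => i _.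
  by apply: leq_trans (leq_subr _ _) (ltnW (ltn_ord _)).
apply: le_trans (good_count R t01).
apply: (@le_trans _ _ (\sum_(x : S) t ^+ excess x * (nchains n x)%:R ^+ 2)).
  rewrite big_mkcond; apply: ler_sum => x _; case: ifP => _; last by rewrite mulr_ge0 // exprn_ge0.
  apply: ler_wpM2r; first by rewrite exprn_ge0.
  by apply: ler_wiXn2l; rewrite // ?(ltW t1) //; apply: leq_sum => i _; apply: leq_subr.
rewrite (partition_big (fun x => Ordinal (exR x)) xpredT) //=.
apply: (@le_trans _ _ (\sum_(r < R.+1) t ^+ r *
   #|[pred e : {ffun C -> 'I_R.+1} | good nE m0 (fun c => e c) & edeg (fun c => e c) == r]|%:R)).
  apply: ler_sum => r _.
  rewrite (eq_bigl (fun x : S => excess x == r)) => [|x]; last by rewrite -val_eqE.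
  rewrite (eq_bigr (fun x => t ^+ r * (nchains n x ^ 2)%:R)) => [|x /eqP ->]; last by rewrite natrX.
  rewrite -mulr_sumr -natr_sum ler_wpM2l // ler_nat; apply: nchains_good => //.
  by rewrite -ltnS.
have -> : \sum_(r < R.+1) t ^+ r *
   #|[pred e : {ffun C -> 'I_R.+1} | good nE m0 (fun c => e c) & edeg (fun c => e c) == r]|%:R =
  \sum_(r < R.+1) \sum_(e : {ffun C -> 'I_R.+1} | good nE m0 (fun c => e c) && (edeg (fun c => e c) == r)) t ^+ edeg (fun c => e c).
  apply: eq_bigr => r _; rewrite -sum1_card natr_sum mulr_sumr; apply: eq_big => [e|e]; first by rewrite inE.
  by rewrite inE => /andP[_ /eqP ->]; rewrite mulr1.
rewrite (exchange_big_dep (fun e : {ffun C -> 'I_R.+1} => good nE m0 (fun c => e c))) /=; last by move=> r e _ /andP[].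
apply: ler_sum => e ge; rewrite ge /=.
case: (ltnP (edeg (fun c => e c)) R.+1) => h.
  by rewrite (big_pred1 (Ordinal h)) // => r; rewrite -val_eqE eq_sym.
by rewrite big_pred0 // => r; apply/negbTE; rewrite neq_ltn (leq_trans (ltn_ord r) h) orbT.
Qed.

End GoodCount.

Section Andreief.
Variables (k L : nat) (t : rat) (g : 'I_k -> nat -> rat).
Hypothesis t0 : 0 <= t.
Local Notation S := {ffun 'I_k -> 'I_L}.

(** The rearrangement maximising the sum weighted by k - i has no ascent. *)
Lemma decr_perm (f : S) : injective f -> exists u : {perm 'I_k}, decr [ffun i => f (u i)].
Proof.
move=> fi; pose F (u : {perm 'I_k}) := (\sum_(i < k) f (u i) * (k - i))%N.
have [/= u _ um] := @arg_maxnP _ 1%g xpredT F isT; exists u.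
apply/forallP=> i; apply/forallP=> j; apply/implyP=> ij; rewrite !ffunE ltnNge; apply/negP=> h.
have ij' : i != j by apply: contraTneq ij => ->; rewrite ltnn.
have {}h : (f (u i) < f (u j))%N.
  by rewrite ltn_neqAle h andbT; apply: contraNneq ij' => e; rewrite -(inj_eq (@perm_inj _ u)); apply/eqP/fi/ord_inj.
have := um (tperm i j * u)%g isT; rewrite leqNgt => /negP; apply.
have Fsplit v : F v = (f (v i) * (k - i) + f (v j) * (k - j) + \sum_(p | (p != i) && (p != j)) f (v p) * (k - p))%N.
  by rewrite /F (bigD1 i) //= (bigD1 j) 1?eq_sym //= addnA.
rewrite !Fsplit !permM tpermL tpermR.
rewrite [X in (_ < _ + X)%N](eq_bigr (fun p => f (u p) * (k - p))%N) ?ltn_add2r; last first.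
  by move=> p /andP[pi pj]; rewrite permM tpermD // eq_sym.
have lt : (k - j < k - i)%N by have := ltn_ord j; clear -ij; lia.
by move: (nat_of_ord (f (u i))) (nat_of_ord (f (u j))) (k - i)%N (k - j)%N h lt => a b c d; clear; nia.
Qed.

(** Times k!, the determinant is the sum of W f * D f ^ 2 over all f. Repeated values give D f = 0,
    and every injective f becomes decreasing under some permutation. *)
Lemma andreief_le :
  \det (\matrix_(i, j) \sum_(y < L) t ^+ y * g i y * g j y) <=
  \sum_(x : S | decr x) t ^+ (\sum_i x i)%N * \det (\matrix_(i, j) g j (x i)) ^+ 2.
Proof.
pose W (f : S) := t ^+ (\sum_i f i)%N; pose D (f : S) := \det (\matrix_(i, j) g j (f i)).
pose cp (f : S) (u : {perm 'I_k}) : S := [ffun i => f (u i)].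
have reind u (F : S -> rat) : \sum_f F f = \sum_f F (cp f u).
  rewrite (reindex (cp^~ u)) //; exists (cp^~ (u^-1)%g) => f _; apply/ffunP=> i; rewrite !ffunE ?permK ?permKV //.
have Wcp f u : W (cp f u) = W f.
  rewrite /W [in RHS](reindex_inj (@perm_inj _ u)) /=; congr (_ ^+ _); apply: eq_bigr => i _; rewrite ffunE //.
have Dcp f u : D (cp f u) = (-1) ^+ u * D f.
  rewrite /D -det_perm -det_mulmx; congr (\det _); apply/matrixP=> i j; rewrite !mxE ffunE.
  rewrite (bigD1 (u i)) //= !mxE eqxx mul1r big1 ?addr0 // => p pu.
  by rewrite !mxE eq_sym (negbTE pu) mul0r.
set H := \det _.
have HE : H = \sum_f W f * (\prod_i g i (f i)) * D f.
  rewrite /H (det_sum_rows (fun i (y : 'I_L) => t ^+ y * g i y) (fun y j => g j y)).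
  apply: eq_bigr => f _; congr (_ * _); rewrite big_split /= /W; congr (_ * _).
  by rewrite -expr_sum.
have kH : (k`!)%:R * H = \sum_f W f * D f ^+ 2.
  have -> : (k`!)%:R * H = \sum_(u : {perm 'I_k}) H.
    by rewrite sumr_const card_Sn mulr_natl.
  transitivity (\sum_(u : {perm 'I_k}) \sum_f W f * D f * ((-1) ^+ u * \prod_i g i (f (u i)))).
    apply: eq_bigr => u _; rewrite HE (reind u); apply: eq_bigr => f _; rewrite Wcp Dcp.
    rewrite (eq_bigr (fun i => g i (f (u i)))) => [|i _]; last by rewrite ffunE.
    by move: (W f) (D f) (\prod_i _) ((-1) ^+ u) => w' d' p' s'; clear; ring.
  rewrite exchange_big /=; apply: eq_bigr => f _; rewrite -mulr_sumr expr2 mulrA; congr (_ * _).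
  rewrite /D -det_tr; apply: eq_bigr => u _; congr (_ * _); apply: eq_bigr => i _; rewrite !mxE //.
have W0 f : 0 <= W f by apply: exprn_ge0.
have WD0 f : 0 <= W f * D f ^+ 2 by rewrite mulr_ge0 // sqr_ge0.
have k1 : 0 < (k`!)%:R :> rat by rewrite ltr0n fact_gt0.
rewrite -(ler_pM2l k1) kH.
have -> : (k`!)%:R * (\sum_(x : S | decr x) t ^+ (\sum_i x i)%N * \det (\matrix_(i, j) g j (x i)) ^+ 2) =
  \sum_f \sum_(u : {perm 'I_k} | decr (cp f u)) W f * D f ^+ 2.
  rewrite (exchange_big_dep xpredT) //= mulr_natl -card_Sn -sumr_const; apply: eq_bigr => u _.
  rewrite [LHS]big_mkcond (reind u) [RHS]big_mkcond; apply: eq_bigr => f _.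
  case: ifP => // _; rewrite -/(W _) -/(D _) Wcp Dcp exprMn -exprM mulnC exprM sqrrN expr1n mul1r //.
apply: ler_sum => f _.
case: (boolP (injectiveb f)) => [/injectiveP/decr_perm[u du]|/injectivePn[p [q pq fpq]]]; last first.
  rewrite /D (determinant_alternate pq) ?expr0n ?mulr0 ?sumr_ge0 //.
  by move=> j; rewrite !mxE fpq.
by rewrite (bigD1 u) //= lerDl sumr_ge0.
Qed.

End Andreief.

(** Terms with z < m vanish since n - 1 - i >= m. Shifting z by m extracts t^m from each row, a
    factor at most 1. *)
Lemma det_hankel_le n k m L (t : rat) : n = (m + k)%N -> (0 < m)%N -> (0 < k)%N -> (m <= L)%N -> 0 <= t < 1 ->
  \det (\matrix_(i < k, j < k) \sum_(z < L) t ^+ z * ('C(z, n.-1 - i))%:R * ('C(z, n.-1 - j))%:R) <=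
  (T n k)%:R * (1 - t)^-1 ^+ (n ^ 2 - m ^ 2).
Proof.
move=> nE m0 k0 mL t01; have /andP[t0 t1] := t01.
have B := nchains_sum_le nE m0 k0 (L - m) t01.
have A := @andreief_le k (L - m) t (fun i z => ('C(z + m, n.-1 - i))%:R) t0.
rewrite (eq_bigr (fun x : {ffun 'I_k -> 'I_(L - m)} => t ^+ (\sum_i x i)%N * (nchains n x)%:R ^+ 2)) in A; last first.
  by move=> x dx; rewrite (nchains_bin k0 nE dx).
have {A B} AB := le_trans A B.
have -> : \matrix_(i < k, j < k) (\sum_(z < L) t ^+ z * ('C(z, n.-1 - i))%:R * ('C(z, n.-1 - j))%:R) =
   t ^+ m *: \matrix_(i < k, j < k) \sum_(y < L - m) t ^+ y * ('C(y + m, n.-1 - i))%:R * ('C(y + m, n.-1 - j))%:R :> 'M[rat]_k.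
  apply/matrixP=> i j; rewrite !mxE.
  rewrite -(big_mkord xpredT (fun z => t ^+ z * ('C(z, n.-1 - i))%:R * ('C(z, n.-1 - j))%:R)).
  rewrite (@big_cat_nat _ _ _ m) //= big_nat big1 ?add0r => [|z /andP[_ zm]]; last first.
    by rewrite bin_small ?mulr0 ?mul0r //; have := ltn_ord i; clear -zm nE; lia.
  rewrite -{1}[m]add0n big_addn big_mkord mulr_sumr; apply: eq_bigr => y _.
  by rewrite exprD -!mulrA mulrCA.
rewrite detZ; apply: le_trans (ler_wpM2l _ AB) _; first by rewrite !exprn_ge0.
rewrite ler_piMl // ?exprn_ile1 ?exprn_ge0 ?(ltW t1) //.
by rewrite mulr_ge0 // exprn_ge0 // invr_ge0 subr_ge0 ltW.
Qed.

(** * The limit t -> 1 *)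

Local Open Scope ring_scope.

(** Convergence at rate O(1 / Q), which passes through sums, products and determinants. *)
Definition near (u : nat -> rat) (l : rat) : Prop :=
  exists C : rat, forall Q, (0 < Q)%N -> `|u Q - l| <= C / Q%:R.

Lemma near_const l : near (fun=> l) l.
Proof. by exists 0 => Q _; rewrite subrr normr0 mul0r. Qed.

Lemma near_ext u v l : (forall Q, (0 < Q)%N -> u Q = v Q) -> near u l -> near v l.
Proof. by move=> h [C hC]; exists C => Q Q0; rewrite -h // hC. Qed.

Lemma nearD u v l l' : near u l -> near v l' -> near (fun Q => u Q + v Q) (l + l').
Proof.
move=> [C hC] [D hD]; exists (C + D) => Q Q0.
rewrite (_ : _ - _ = (u Q - l) + (v Q - l')); last by ring.
by rewrite mulrDl; apply: le_trans (ler_normD _ _) (lerD (hC Q Q0) (hD Q Q0)).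
Qed.

Lemma nearM u v l l' : near u l -> near v l' -> near (fun Q => u Q * v Q) (l * l').
Proof.
move=> [C hC] [D hD]; exists (C * (`|l'| + D) + `|l| * D) => Q Q0.
have C0 : 0 <= C by have := le_trans (normr_ge0 _) (hC 1%N isT); rewrite divr1.
have D0 : 0 <= D by have := le_trans (normr_ge0 _) (hD 1%N isT); rewrite divr1.
have Q1 : 0 < Q%:R :> rat by rewrite ltr0n.
have vD : `|v Q| <= `|l'| + D.
  rewrite -[v Q](subrK l') addrC; apply: le_trans (ler_normD _ _) _; rewrite lerD2l.
  by apply: le_trans (hD Q Q0) _; rewrite ler_pdivrMr // ler_peMr // ler1n.
rewrite (_ : _ - _ = (u Q - l) * v Q + l * (v Q - l')); last by ring.
apply: le_trans (ler_normD _ _) _; rewrite !normrM mulrDl; apply: lerD.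
  by rewrite mulrAC; apply: ler_pM => //; apply: hC.
by rewrite -mulrA; apply: ler_wpM2l => //; apply: hD.
Qed.

Lemma near_sum (I : Type) (s : seq I) (u : I -> nat -> rat) l : (forall i, near (u i) (l i)) ->
  near (fun Q => \sum_(i <- s) u i Q) (\sum_(i <- s) l i).
Proof.
move=> h; elim: s => [|i s IH]; first by rewrite big_nil; apply: near_ext (near_const 0) => Q _; rewrite big_nil.
by rewrite big_cons; apply: near_ext (nearD (h i) IH) => Q _; rewrite big_cons.
Qed.

Lemma near_prod (I : Type) (s : seq I) (u : I -> nat -> rat) l : (forall i, near (u i) (l i)) ->
  near (fun Q => \prod_(i <- s) u i Q) (\prod_(i <- s) l i).
Proof.
move=> h; elim: s => [|i s IH]; first by rewrite big_nil; apply: near_ext (near_const 1) => Q _; rewrite big_nil.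
by rewrite big_cons; apply: near_ext (nearM (h i) IH) => Q _; rewrite big_cons.
Qed.

Lemma near_det k (A : nat -> 'M[rat]_k) (M : 'M[rat]_k) : (forall i j, near (fun Q => A Q i j) (M i j)) ->
  near (fun Q => \det (A Q)) (\det M).
Proof.
by move=> h; apply: near_sum => s; apply: nearM; [apply: near_const|apply: near_prod => i; apply: h].
Qed.

Lemma near_le u l c : near u l -> (forall Q, (0 < Q)%N -> u Q <= c) -> l <= c.
Proof.
move=> [C hC] uc; rewrite leNgt; apply/negP=> cl.
have d0 : 0 < l - c by rewrite subr_gt0.
have C0 : 0 <= C by have := le_trans (normr_ge0 _) (hC 1%N isT); rewrite divr1.
have h0 : 0 <= C / (l - c) by rewrite divr_ge0 // ltW.
have := archi_boundP h0; set Q := Num.bound _ => hQ.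
have Q1 : 0 < Q%:R :> rat by apply: le_lt_trans hQ.
have Q0 : (0 < Q)%N by rewrite -(ltr0n rat).
have := hC Q Q0; rewrite ler_pdivlMr // distrC ger0_norm; last by rewrite subr_ge0 (le_trans (uc Q Q0)) // ltW.
apply/negP; rewrite -ltNge; move: hQ; rewrite ltr_pdivrMr // => hQ; apply: lt_le_trans hQ _.
by rewrite mulrC; apply: ler_wpM2r; [apply: ltW|rewrite lerD2l lerN2 uc].
Qed.

Local Open Scope nat_scope.

Lemma leq_expr2 a b e : a <= b -> a ^ e <= b ^ e.
Proof. by move=> ab; elim: e => // e IH; rewrite !expnS leq_mul. Qed.

Lemma bin_le_exp L a : 'C(L, a) <= L ^ a.
Proof.
elim: a L => [|a IH] [|L]; rewrite ?bin0 //.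
apply: (@leq_trans (L.+1 * 'C(L, a))).
  by have := mul_bin_diag L.+1 a; rewrite /= => ->; rewrite leq_pmull.
by rewrite expnS leq_mul2l /= (leq_trans (IH L)) // leq_expr2.
Qed.

Lemma bernoulli_nat Q j : Q ^ j * (Q + j) <= Q.+1 ^ j * Q.
Proof.
elim: j => [|j IH]; first by rewrite addn0.
rewrite !expnS; have : Q * (Q + j.+1) <= Q.+1 * (Q + j) by clear; nia.
by move: (Q ^ j) (Q.+1 ^ j) IH => a b; clear; nia.
Qed.

(** Bernoulli's inequality gives (1 + 1/Q)^Q >= 2, and 2^Q > Q; the pQ-th power of the first then
    exceeds Q^p. *)
Lemma exp_gap Q p : 0 < Q -> Q ^ p * Q ^ (Q * (p * Q)) <= Q.+1 ^ (Q * (p * Q)).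
Proof.
move=> Q0; have h : 2 * Q ^ Q <= Q.+1 ^ Q.
  by have := bernoulli_nat Q Q; rewrite addnn -mul2n mulnA leq_pmul2r // mulnC.
rewrite !(expnM _ Q).
apply: (@leq_trans ((2 * Q ^ Q) ^ (p * Q))); last exact: leq_expr2.
rewrite expnMn leq_mul2r mulnC (expnM 2) leq_expr2 ?orbT // ltnW // ltn_expl //.
Qed.

Local Open Scope ring_scope.

Section HankelLimit.
Variable n : nat.
Let p := (4 * n).+1.
(* The truncation Lq is long enough for the tail of order t^L L^(2n) to be O(1/Q)
   at t = Q / (Q + 1). *)
Definition tq (Q : nat) : rat := Q%:R / Q.+1%:R.
Definition Lq (Q : nat) : nat := (Q * (p * Q))%N.
Definition bin_sum (t : rat) L a b : rat := \sum_(z < L) t ^+ z * ('C(z, a))%:R * ('C(z, b))%:R.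

Lemma tqE Q : 1 - tq Q = Q.+1%:R^-1.
Proof. by rewrite /tq -[in X in X - _](divff (x := Q.+1%:R)) ?pnatr_eq0 // -mulrBl -natr1 addrC addKr mul1r. Qed.

Lemma near_1tq : near (fun Q => 1 - tq Q) 0.
Proof.
exists 1 => Q Q0; rewrite tqE subr0 ger0_norm ?invr_ge0 ?ler0n // mul1r.
by rewrite lef_pV2 ?posrE ?ltr0n // ler_nat.
Qed.

Lemma near_tq : near tq 1.
Proof.
have h := nearD (near_const 1) (nearM (near_const (-1)) near_1tq).
rewrite mulr0 addr0 in h; apply: near_ext h => Q _; ring.
Qed.

(** [exp_gap] bounds the power of t by Q^(-p), and the binomials by L^(2n) = p^(2n) Q^(4n); p = 4n +
    1 leaves one factor 1 / Q. *)
Lemma near_tail a b : (a <= n)%N -> (b <= n)%N ->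
  near (fun Q => tq Q ^+ Lq Q * ('C(Lq Q, a))%:R * ('C(Lq Q, b))%:R) 0.
Proof.
move=> an bn; exists (p ^ (2 * n))%:R => Q Q0.
have L0 : (0 < Lq Q)%N by rewrite /Lq !muln_gt0 Q0.
rewrite subr0 ger0_norm; last by rewrite !mulr_ge0 // exprn_ge0 // divr_ge0.
rewrite ler_pdivlMr ?ltr0n // /tq expr_div_n -!mulrA [_^-1 * _]mulrC !mulrA ler_pdivrMr; last first.
  by rewrite exprn_gt0 // ltr0n.
rewrite -!natrX -!natrM ler_nat.
have hb c : (c <= n)%N -> ('C(Lq Q, c) <= Lq Q ^ n)%N.
  by move=> cn; apply: leq_trans (bin_le_exp _ _) _; rewrite leq_pexp2l.
have h1 : ('C(Lq Q, a) * 'C(Lq Q, b) * Q <= p ^ (2 * n) * Q ^ p)%N.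
  have -> : (p ^ (2 * n) * Q ^ p = Lq Q ^ n * Lq Q ^ n * Q)%N.
    rewrite -expnD addnn -mul2n /Lq mulnCA expnMn -mulnA; congr (_ * _)%N.
    by rewrite mulnn -expnM -expnSr; congr (_ ^ _)%N; rewrite /p; clear; lia.
  by rewrite leq_mul2r leq_mul ?hb ?orbT.
have := exp_gap p Q0; rewrite -/(Lq Q).
move: (Q ^ Lq Q)%N (Q.+1 ^ Lq Q)%N (Q ^ p)%N (p ^ (2 * n))%N ('C(Lq Q, a)) ('C(Lq Q, b)) h1 => A B C D E F h1 h2.
have := leq_mul (leqnn D) h2; have := leq_mul h1 (leqnn A).
by clear; nia.
Qed.

Lemma sum_by_parts (t : rat) L (h : nat -> rat) :
  (1 - t) * (\sum_(z < L) t ^+ z * h z) = h 0%N - t ^+ L * h L + t * (\sum_(z < L) t ^+ z * (h z.+1 - h z)).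
Proof.
elim: L => [|L IH]; first by rewrite !big_ord0 !mulr0 expr0 mul1r subrr addr0.
rewrite !big_ord_recr /= !mulrDr IH exprS.
by move: (\sum_(_ < _) _) (h 0%N) (h L) (h L.+1) (t ^+ L) => s a b c d; ring.
Qed.

(** Summation by parts replaces one factor 1 - t by a difference of products of binomials. Pascal's
    rule splits it into the cases (a - 1, b), (a, b - 1) and (a - 1, b - 1); the last keeps a spare
    factor 1 - t and vanishes, so the limits obey Pascal's rule. *)
Lemma near_bin_sum a b : (a <= n)%N -> (b <= n)%N ->
  near (fun Q => (1 - tq Q) ^+ (a + b).+1 * bin_sum (tq Q) (Lq Q) a b) ('C(a + b, a))%:R.
Proof.
pose M a b Q := (1 - tq Q) ^+ (a + b).+1 * bin_sum (tq Q) (Lq Q) a b.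
rewrite -/(M a b).
pose tl a b Q := tq Q ^+ Lq Q * ('C(Lq Q, a))%:R * ('C(Lq Q, b))%:R.
have nX j : exists l, near (fun Q => (1 - tq Q) ^+ j) l.
  elim: j => [|j [l IH]]; first by exists 1; apply: near_ext (near_const 1) => Q _; rewrite expr0.
  by exists (0 * l); apply: near_ext (nearM near_1tq IH) => Q _; rewrite exprS.
have ntl a' b' j : (a' <= n)%N -> (b' <= n)%N -> near (fun Q => (1 - tq Q) ^+ j * tl a' b' Q) 0.
  by move=> ha hb; have [l hl] := nX j; have := nearM hl (near_tail ha hb); rewrite mulr0.
have E a' b' Q : M a' b' Q = ('C(0, a'))%:R * ('C(0, b'))%:R * (1 - tq Q) ^+ (a' + b') +
    (-1 * ((1 - tq Q) ^+ (a' + b') * tl a' b' Q) + tq Q * ((1 - tq Q) ^+ (a' + b') *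
     \sum_(z < Lq Q) tq Q ^+ z * (('C(z.+1, a'))%:R * ('C(z.+1, b'))%:R - ('C(z, a'))%:R * ('C(z, b'))%:R))).
  rewrite /M /bin_sum exprSr -mulrA.
  rewrite (eq_bigr (fun z : 'I__ => tq Q ^+ z * (('C(z, a'))%:R * ('C(z, b'))%:R))) => [|z _]; last by rewrite mulrA.
  rewrite (sum_by_parts _ _ (fun z => ('C(z, a'))%:R * ('C(z, b'))%:R)) /tl.
  by move: (\sum_(_ < _) _) (_ ^+ _) (_ ^+ _) => s u v; ring.
have rec a' b' (D : nat -> rat) l c : (a' <= n)%N -> (b' <= n)%N ->
  (forall Q, ('C(0, a'))%:R * ('C(0, b'))%:R * (1 - tq Q) ^+ (a' + b') = c) ->
  (forall Q, (1 - tq Q) ^+ (a' + b') *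
     (\sum_(z < Lq Q) tq Q ^+ z * (('C(z.+1, a'))%:R * ('C(z.+1, b'))%:R - ('C(z, a'))%:R * ('C(z, b'))%:R)) = D Q) ->
  near D l -> near (M a' b') (c + l).
  move=> ha hb hc hD nD.
  have := nearD (near_const c) (nearD (nearM (near_const (-1)) (ntl a' b' (a' + b')%N ha hb)) (nearM near_tq nD)).
  by rewrite mulr0 add0r mul1r; apply: near_ext => Q _; rewrite E hc hD.
elim: a b => [|a IHa] b.
  elim: b => [|b IHb] an bn.
    have := @rec 0%N 0%N (fun=> 0) 0 1 an bn _ _ (near_const 0); rewrite addr0; apply=> Q; first by rewrite mulr1.
    by rewrite expr0 mul1r big1 // => z _; rewrite !bin0 subrr mulr0.
  have := @rec 0%N b.+1 (M 0%N b) _ 0 an bn _ _ (IHb an (ltnW bn)); rewrite add0r !bin0; apply=> Q; first by rewrite mulr0 mul0r.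
  rewrite /M !add0n /bin_sum; congr (_ * _); apply: eq_bigr => z _.
  by rewrite !bin0 !mul1r binS natrD addrAC subrr add0r mulr1.
elim: b => [|b IHb] an bn.
  have := @rec a.+1 0%N (M a 0%N) _ 0 an bn _ _ (IHa 0%N (ltnW an) bn).
  rewrite add0r !addn0 !binn; apply=> Q; first by rewrite bin0n /= !mul0r.
  rewrite /M !addn0 /bin_sum; congr (_ * _); apply: eq_bigr => z _.
  by rewrite !bin0 !mulr1 binS natrD addrAC subrr add0r.
have h1 := IHa b.+1 (ltnW an) bn; have h2 := IHb an (ltnW bn); have h3 := IHa b (ltnW an) (ltnW bn).
have -> : ('C(a.+1 + b.+1, a.+1))%:R = 0 + (('C(a + b.+1, a))%:R + (('C(a.+1 + b, a.+1))%:R + 0 * ('C(a + b, a))%:R)) :> rat.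
  rewrite mul0r addr0 add0r -natrD; congr (_%:R).
  by rewrite addSn [in LHS]binS addnC; congr (_ + _)%N; congr 'C(_, _); rewrite addSn addnS.
apply: (@rec a.+1 b.+1 _ _ 0 an bn _ _ (nearD h1 (nearD h2 (nearM near_1tq h3)))) => Q.
  by rewrite bin0n /= !mul0r.
rewrite /M /bin_sum.
have -> : \sum_(z < Lq Q) tq Q ^+ z * (('C(z.+1, a.+1))%:R * ('C(z.+1, b.+1))%:R - ('C(z, a.+1))%:R * ('C(z, b.+1))%:R) =
   \sum_(z < Lq Q) tq Q ^+ z * ('C(z, a))%:R * ('C(z, b.+1))%:R +
   (\sum_(z < Lq Q) tq Q ^+ z * ('C(z, a.+1))%:R * ('C(z, b))%:R +
    \sum_(z < Lq Q) tq Q ^+ z * ('C(z, a))%:R * ('C(z, b))%:R).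
  rewrite -!big_split /=; apply: eq_bigr => z _; rewrite !binS !natrD.
  by move: (_ ^+ _) ('C(z, a))%:R ('C(z, b))%:R ('C(z, a.+1))%:R ('C(z, b.+1))%:R => w c d e f; ring.
rewrite (addSn a) (addnS a) !exprS.
by rewrite !mulrDr !mulrA.
Qed.

End HankelLimit.

Lemma sum_odd_squares n k : (k <= n)%N -> (\sum_(i < k) ((n.-1 - i) + (n.-1 - i).+1) = n ^ 2 - (n - k) ^ 2)%N.
Proof.
elim: k => [|k IH] kn; first by rewrite big_ord0 subn0 subnn.
rewrite big_ord_recr /= IH; last exact: ltnW.
have [j nE] : exists j, n = (k + j.+1)%N by exists (n - k.+1)%N; clear -kn; lia.
rewrite nE; have -> : ((k + j.+1).-1 - k = j)%N by clear; lia.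
have -> : (k + j.+1 - k = j.+1)%N by clear; lia.
have -> : (k + j.+1 - k.+1 = j)%N by clear; lia.
by clear; nia.
Qed.

(** Scaling row i by (1 - t)^(a i + 1) and column j by (1 - t)^(a j) makes every entry converge; by
    [sum_odd_squares] the total power cancels that of [det_hankel_le]. *)
Theorem det_bin_le_T n k m : n = (m + k)%N -> (0 < m)%N -> (0 < k)%N ->
  \det (\matrix_(i < k, j < k) ('C((n.-1 - i) + (n.-1 - j), n.-1 - i))%:R) <= (T n k)%:R :> rat.
Proof.
move=> nE m0 k0.
pose a (i : 'I_k) := (n.-1 - i)%N.
pose A Q : 'M[rat]_k := \matrix_(i, j) ((1 - tq Q) ^+ (a i + a j).+1 * bin_sum (tq Q) (Lq n Q) (a i) (a j)).
have an i : (a i <= n)%N by rewrite /a; clear; lia.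
apply: (@near_le (fun Q => \det (A Q))).
  apply: near_det => i j; rewrite mxE; apply: near_ext (near_bin_sum (an i) (an j)) => Q _; rewrite mxE //.
move=> Q Q0; set t := tq Q.
have t01 : 0 <= t < 1.
  by rewrite /t /tq divr_ge0 ?ler0n //= ltr_pdivrMr ?ltr0n // mul1r ltr_nat.
have mL : (m <= Lq n Q)%N.
  by rewrite /Lq; have := leq_mul Q0 (leq_mul (leqnn (4 * n).+1) Q0); rewrite muln1 mul1n nE; clear; lia.
have B := det_hankel_le nE m0 k0 mL t01.
have u0 : 0 < 1 - t by rewrite subr_gt0; case/andP: t01.
have -> : A Q = diag_mx (\row_i (1 - t) ^+ (a i).+1) *m
   (\matrix_(i < k, j < k) \sum_(z < Lq n Q) t ^+ z * ('C(z, n.-1 - i))%:R * ('C(z, n.-1 - j))%:R) *m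
   diag_mx (\row_j (1 - t) ^+ a j).
  apply/matrixP=> i j; rewrite mul_diag_mx mul_mx_diag !mxE /bin_sum -/(a i) -/(a j) mulrAC.
  by rewrite -exprD addSn.
rewrite !det_mulmx !det_diag.
under eq_bigr do rewrite mxE; under [X in _ * X]eq_bigr do rewrite mxE.
rewrite mulrAC -big_split /=; under eq_bigr do rewrite -exprD.
rewrite -expr_sum (_ : (\sum_(i < k) ((a i).+1 + a i))%N = (n ^ 2 - m ^ 2)%N); last first.
  under eq_bigr do rewrite addnC; rewrite sum_odd_squares ?nE ?leq_addl //.
  by rewrite addnK.
rewrite mulrC -ler_pdivlMr ?exprn_gt0 // -exprVn //.
Qed.

(** * The bounds *)

Local Open Scope nat_scope.

Lemma facets_upper_bound n k (D := (n - k) ^ 2) (d := k * (n - k)) : odd d ->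
  'C(D + d./2, D) + 'C(D + d.-1./2, D) = upper_bound n k.
Proof.
rewrite /upper_bound -/D -/d => dodd; rewrite dodd divn2 subn1 mul2n -addnn; congr ('C(_ + _, _) + _).
by clear -dodd; lia.
Qed.

Lemma facets_le_upper_bound n k (D := (n - k) ^ 2) (d := k * (n - k)) :
  'C(D + d./2, D) + 'C(D + d.-1./2, D) <= upper_bound n k.
Proof.
case: (boolP (odd d)) => dodd; first by rewrite -facets_upper_bound.
rewrite /upper_bound -/D -/d (negbTE dodd) divn2 mul2n -addnn -addnA leq_add2l; apply: leq_trans (leq_addr _ _).
by rewrite leq_bin2l // leq_add2l half_leq // leq_pred.
Qed.

Local Open Scope ring_scope.

Theorem theorem3p6 (n k : nat) (hn : (2 <= n)%N) (hk : (1 <= k <= n - 1)%N) :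
  let det1 : rat :=
    \det (\matrix_(i < k, j < k)
            ('C(2 * n - i.+1 - j.+1, n - i.+1))%:R) in
  let det2 : rat :=
    \det (\matrix_(i < k, j < k)
            (binz (2 * (n - k)) ((n - k)%:Z + i.+1%:Z - j.+1%:Z))%:R) in
  let prod3 : rat :=
    \prod_(1 <= h < (n - k).+1) \prod_(1 <= i < k.+1)
      \prod_(1 <= j < (n - k).+1)
        ((h + i + j - 1)%:R / (h + i + j - 2)%:R) in
  [/\ det1 <= (T n k)%:R,
      det1 = det2,
      det2 = prod3,
      (T n k <= upper_bound n k)%N
    & forall (R : realFieldType) (t : 'I_(n * (n - k)) -> R),
        (forall i j : 'I_(n * (n - k)), (i < j)%N -> t i < t j) ->
        let cyc := cyclic_polytope_facets (k * (n - k)) t in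
        [/\ (T n k <= cyc)%N,
            (cyc <= upper_bound n k)%N
          & odd (k * (n - k)) -> cyc = upper_bound n k]].
Proof.
move=> det1 det2 prod3.
have nE : n = ((n - k) + k)%N by clear -hk hn; lia.
have m0 : (0 < n - k)%N by clear -hk hn; lia.
have k0 : (0 < k)%N by clear -hk; lia.
(* Reversing the indices turns n - i, for i = 1..k, into (n - k) + r with r = k - i. *)
have det1E : det1 = \det (\matrix_(r < k, s < k) ('C(2 * (n - k) + r + s, (n - k) + r))%:R : 'M[rat]_k).
  rewrite -(det_rev k (fun r s => ('C(2 * (n - k) + r + s, (n - k) + r))%:R)) /det1; congr (\det _).
  apply/matrixP=> i j; rewrite !mxE; congr ('C(_, _)%:R); have := ltn_ord i; have := ltn_ord j; clear -nE; lia.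
have det2E : det2 = \det (\matrix_(i < k, j < k) (binz (2 * (n - k)) ((n - k)%:Z + i%:Z - j%:Z))%:R).
  rewrite /det2; congr (\det _); apply/matrixP=> i j; rewrite !mxE; congr ((binz _ _)%:R).
  by rewrite -[i.+1]addn1 -[j.+1]addn1 !PoszD; ring.
have Tle := T_upper nE m0 k0.
split.
- have := det_bin_le_T nE m0 k0; congr (_ <= _); rewrite /det1; congr (\det _).
  by apply/matrixP=> i j; rewrite !mxE; congr ('C(_, _)%:R); have := ltn_ord i; have := ltn_ord j; clear -nE; lia.
- by rewrite det1E det2E det_bin_shift.
- by rewrite det2E -det_bin_shift det_bin_prod -box_prod.
- exact: leq_trans Tle (facets_le_upper_bound n k).
move=> R t tincr cyc.
have cycE : cyc = ('C((n - k) ^ 2 + (k * (n - k))./2, (n - k) ^ 2) +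
                   'C((n - k) ^ 2 + (k * (n - k)).-1./2, (n - k) ^ 2))%N.
  apply: cyclic_polytope_facetsE => //; rewrite ?expn_gt0 ?m0 ?muln_gt0 ?k0 //.
  by rewrite {1}nE mulnDl mulnn.
split; first by rewrite cycE.
  by rewrite cycE facets_le_upper_bound.
by rewrite cycE; apply: facets_upper_bound.
Qed.
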